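(* Suppose that $F\in\operatorname{dom}(D)$ is such that $\mathbb{E}[F]=0$, and let $Z\sim N(0,1)$. Let $f,g\in L^2(\mu)$ be representatives of $F$ and $L^{-1}F$, respectively. Then $$d_{\mathcal W}(F,Z)\leq\sqrt{\frac{2}{\pi}}\;\mathbb{E}\bigl|1-\Gamma_0(F,-L^{-1}F)\bigr|+\frac12\sum_{k=1}^\infty\mathbb{E}\Bigl[\bigl|g(\mathbb{X}^{(k)})-g(\mathbb{X})\bigr|\bigl(f(\mathbb{X}^{(k)})-f(\mathbb{X})\bigr)^2\Bigr]$$ and $$d_{\mathcal K}(F,Z)\leq\mathbb{E}\bigl|1-\Gamma_0(F,-L^{-1}F)\bigr|+\mathbb{E}\biggl|\mathbb{E}\Bigl[\sum_{k=1}^\infty\bigl|g(\mathbb{X}^{(k)})-g(\mathbb{X})\bigr|\bigl(f(\mathbb{X}^{(k)})-f(\mathbb{X})\bigr)\,\Big|\,F\Bigr]\biggr|.$$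
   Context: Let $(E_n,\mathcal{B}_n,\mu_n)$, $n\in\mathbb{N}$, be probability spaces with product $(E,\mathcal{B},\mu)$. On a probability space $(\Omega,\mathcal{A},\mathbb{P})$ let $\mathbb{X}=(X_n)_{n\in\mathbb{N}}$ and $\mathbb{X}'=(X'_n)_{n\in\mathbb{N}}$ be two independent $E$-valued random sequences, each with distribution $\mu$. For $k\in\mathbb{N}$, $\mathbb{X}^{(k)}$ is obtained from $\mathbb{X}$ by replacing $X_k$ with $X_k'$. Let $\mathcal{F}=\sigma(\mathbb{X})$, $\mathcal{F}_M=\sigma(X_j:j\in M)$, $\mathcal{F}_n=\mathcal{F}_{\{1,\dotsc,n\}}$, $\mathcal{G}_k=\sigma(X_j:j\neq k)$, $L^2_{\mathbb{X}}=L^2(\Omega,\mathcal{F},\mathbb{P})$. A representative of $F\in L^2_{\mathbb{X}}$ is $f\in L^2(\mu)$ with $F=f(\mathbb{X})$ a.s. $\kappa$ is counting measure on $\mathbb{N}$, $\mathbb{P}_{\mathcal F}$ the restriction of $\mathbb{P}$ to $\mathcal{F}$. $D_kF:=F-\mathbb{E}[F\mid\mathcal{G}_k]$. On the space of all $F\in L^2_{\mathbb{X}}$ that are $\mathcal{F}_n$-measurable for some $n$, put $DF:=(D_kF)_{k\in\mathbb{N}}\in L^2(\kappa\otimes\mathbb{P}_{\mathcal F})$; this is closable, its closure is denoted $D$ with domain $\operatorname{dom}(D)$. With $\delta$ the Hilbert space adjoint of $D$, put $\operatorname{dom}(L)=\{F\in\operatorname{dom}(D):DF\in\operatorname{dom}(\delta)\}$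 and $LF:=-\delta DF$. For centered $G\in L^2_{\mathbb{X}}$, $L^{-1}G$ is the unique centered element of $\operatorname{dom}(L)$ with $L(L^{-1}G)=G$; explicitly $L^{-1}G=-\sum_{\emptyset\neq M\subseteq\mathbb{N}\text{ finite}}|M|^{-1}G_M$ in $L^2(\mathbb{P})$, where $G_M=\sum_{K\subseteq M}(-1)^{|M|-|K|}\mathbb{E}[G\mid\mathcal{F}_K]$. For $F,G\in\operatorname{dom}(D)$ with representatives $f,g$, $\Gamma_0(F,G):=\frac12\sum_{k=1}^\infty\mathbb{E}\bigl[(f(\mathbb{X}^{(k)})-f(\mathbb{X}))(g(\mathbb{X}^{(k)})-g(\mathbb{X}))\mid\mathbb{X}\bigr]\in L^1(\mathbb{P})$. Distances: $d_{\mathcal W}(Y,W)=\sup_h|\mathbb{E}[h(Y)]-\mathbb{E}[h(W)]|$ over all $1$-Lipschitz $h:\mathbb{R}\to\mathbb{R}$; $d_{\mathcal K}(Y,W)=\sup_{z\in\mathbb{R}}|\mathbb{P}(Y\le z)-\mathbb{P}(W\le z)|$. The right-hand side of the first bound may be $+\infty$. *)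

(* Defs.v *)
From HB Require Import structures.
From mathcomp Require Import all_boot all_order all_algebra.
From mathcomp Require Import all_classical all_reals all_analysis.

Set Implicit Arguments.
Unset Strict Implicit.
Unset Printing Implicit Defensive.

Import Order.TTheory GRing.Theory Num.Theory.
Import numFieldNormedType.Exports.

Local Open Scope classical_set_scope.
Local Open Scope ring_scope.
Local Open Scope ereal_scope.

(* Countable products of measurable spaces and of probability measures.
   The index set {1, 2, ...} is represented by nat = {0, 1, ...}.             *)

Section product_space.
Context (dE : nat -> measure_display) (E : forall n, measurableType (dE n)).

Definition coord_sets : set (set (forall n, E n)) :=
  \bigcup_n preimage_set_system setT (fun x : forall n, E n => x n) measurable.

Definition prodE : Type := g_sigma_algebraType coord_sets.
HB.instance Definition _ := Measurable.on prodE.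

(* The values on finite-dimensional rectangles determine mu. *)
Definition is_product_measure (R : realType)
    (mu_ : forall n, probability (E n) R) (mu : probability prodE R) :=
  forall (n : nat) (A : forall i, set (E i)),
    (forall i, measurable (A i)) ->
    mu [set x | forall i, (i < n)%N -> A i (x i)] = \prod_(i < n) mu_ i (A i).

End product_space.

Section probability_notions.
Context d (T : measurableType d) (R : realType) (P : probability T R).

Definition has_law d' (S : measurableType d') (Y : {RV P >-> S})
    (nu : set S -> \bar R) :=
  forall A, measurable A -> distribution P Y A = nu A.

Definition independent_RV d1 (S1 : measurableType d1) d2
    (S2 : measurableType d2) (Y1 : {RV P >-> S1}) (Y2 : {RV P >-> S2}) :=
  forall A B, measurable A -> measurable B ->
    P (Y1 @^-1` A `&` Y2 @^-1` B) = P (Y1 @^-1` A) * P (Y2 @^-1` B).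

(* Below, G is always a sub-sigma-algebra, so that <<s G >> = G. *)
Definition measurable_wrt (G : set (set T)) (Y : T -> R) :=
  measurable_fun [set: g_sigma_algebraType G] (Y : g_sigma_algebraType G -> R).

Definition is_cond_exp (G : set (set T)) (Y H : T -> R) :=
  [/\ measurable_wrt G H,
      P.-integrable setT (EFin \o H) &
      forall A, <<s G >> A ->
        \int[P]_(w in A) (H w)%:E = \int[P]_(w in A) (Y w)%:E].

(* A chosen version of E[Y | G]; the value 0 is junk, taken only when Y has no
   conditional expectation (in particular never for integrable Y).            *)
Definition cond_exp (G : set (set T)) (Y : T -> R) : T -> R :=
  xget (cst 0%R) [set H | is_cond_exp G Y H].

End probability_notions.

Section distances.
Context (R : realType) d (T : measurableType d) (P : probability T R)
  d' (S : measurableType d') (Q : probability S R).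

Definition dW (Y : {RV P >-> R}) (W : {RV Q >-> R}) : \bar R :=
  ereal_sup [set `| 'E_P[h \o Y] - 'E_Q[h \o W] |
            | h in [set h : R -> R | (1 : R).-lipschitz h]].

Definition dK (Y : {RV P >-> R}) (W : {RV Q >-> R}) : \bar R :=
  ereal_sup [set `| P [set w | Y w <= z]%R - Q [set w | W w <= z]%R |
            | z in [set: R]].

End distances.

Section malliavin.
Context (dE : nat -> measure_display) (E : forall n, measurableType (dE n))
  d (T : measurableType d) (R : realType) (P : probability T R).

Section operators.
Variable X : {RV P >-> prodE E}.

Definition sigmaX : set (set T) := g_sigma_algebra_preimage X.

(* sigma(X_j : j in M) *)
Definition sigma_coords (M : set nat) : set (set T) :=
  <<s \bigcup_(j in M) preimage_set_system setT (fun w => X w j) measurable >>.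

(* Elements of L^2_X are represented by sigma(X)-measurable functions; the
   relations D_graph, delta_graph and L_graph below do not distinguish such
   functions when they are equal a.s.                                         *)
Definition L2X (F : T -> R) := measurable_wrt sigmaX F /\ F \in Lfun P 2%:E.

(* L^2(kappa \x P_F), where kappa is the counting measure on nat and P_F the
   restriction of P to sigma(X): the function (k, w) |-> u k w is given by the
   sequence of its sections, and integration against kappa is summation.      *)
Definition L2kX (u : nat -> T -> R) :=
  (forall k, L2X (u k)) /\
  \sum_(0 <= k <oo) 'E_P[fun w => u k w ^+ 2]%R < +oo.

Definition Dk (k : nat) (F : T -> R) : T -> R :=
  (F \- cond_exp P (sigma_coords [set j | j <> k]) F)%R.

(* The initial domain of D: `I_n = {0, ..., n-1} indexes the first n
   coordinates.                                                               *)
Definition finitely_based (F : T -> R) :=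
  L2X F /\ exists n, measurable_wrt (sigma_coords `I_n) F.

(* "F is in dom(D) and DF = u": (F, u) is in the closure, for the norm of
   L^2_X x L^2(kappa \x P_F), of the graph of F |-> (Dk k F)_k on the initial
   domain.                                                                    *)
Definition D_graph (F : T -> R) (u : nat -> T -> R) :=
  [/\ L2X F, L2kX u &
      forall e : R, (0 < e)%R -> exists G : T -> R,
        [/\ finitely_based G,
            'E_P[fun w => (F w - G w) ^+ 2]%R < e%:E &
            \sum_(0 <= k <oo) 'E_P[fun w => (u k w - Dk k G w) ^+ 2]%R
              < e%:E]].

Definition dom_D (F : T -> R) := exists u, D_graph F u.

(* "u is in dom(delta) and delta u = H" for the Hilbert space adjoint delta of
   D.                                                                         *)
Definition delta_graph (u : nat -> T -> R) (H : T -> R) :=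
  [/\ L2kX u, L2X H &
      forall F v, D_graph F v ->
        \sum_(0 <= k <oo) 'E_P[fun w => v k w * u k w]%R
          = 'E_P[fun w => F w * H w]%R].

(* "F is in dom(L) and LF = H", where L = - delta D. *)
Definition L_graph (F H : T -> R) :=
  exists u, D_graph F u /\ delta_graph u (\- H)%R.

(* G = L^{-1} F for a centered F: the unique (up to null sets) centered element
   of dom(L) with LG = F.                                                     *)
Definition is_Linv (F G : T -> R) := L_graph G F /\ 'E_P[G] = 0.

Definition is_representative (mu : probability (prodE E) R)
    (f : prodE E -> R) (F : T -> R) :=
  f \in Lfun mu 2%:E /\ {ae P, forall w, F w = f (X w)}.

End operators.

Section carre_du_champ.
Variables X X' : {RV P >-> prodE E}.

Definition resample (k : nat) (w : T) : prodE E :=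
  fun j => if j == k then X' w j else X w j.

Definition Delta (k : nat) (f : prodE E -> R) (w : T) : R :=
  (f (resample k w) - f (X w))%R.

(* Gamma_0(F, G) in terms of representatives f of F and g of G. The sum is taken
   pointwise; it converges absolutely a.s. for F and G in dom(D).             *)
Definition Gamma0 (f g : prodE E -> R) (w : T) : R :=
  (2^-1 * limn (series (fun k =>
     cond_exp P (sigmaX X) (fun w' => Delta k f w' * Delta k g w') w)))%R.

End carre_du_champ.

End malliavin.

(* Main.v *)
Require Import Defs.
From mathcomp Require Import all_boot all_order all_algebra.
From mathcomp Require Import all_classical all_reals all_analysis.
From mathcomp Require Import measurable_realfun ring lra.

Set Implicit Arguments.
Unset Strict Implicit.
Unset Printing Implicit Defensive.

Import Order.TTheory GRing.Theory Num.Theory.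
Import numFieldNormedType.Exports.

Local Open Scope classical_set_scope.
Local Open Scope ring_scope.
Local Open Scope ereal_scope.

(* Stein's method. The equation psi x = x phi x + h x - E[h(Z)], with psi = phi',
   turns E[h(F)] - E[h(Z)] into E[psi(F)] - E[F phi(F)].
   The operator D preserves Lipschitz images, D(phi(F)) = (D_k phi(F))_k, because
   the projections 1 - E[. | G_k] satisfy E[(D_k phi(Y))^2] <= C^2 E[(D_k Y)^2].
   Duality with delta, applied to F = - delta D L^{-1} F, and the exchangeability
   of (X, X^(k)) then give
     E[F phi(F)] = - 1/2 sum_k E[Delta_k(phi o f) Delta_k g].
   Replacing Delta_k(phi o f) by psi(f(X)) Delta_k f produces E[psi(F) Gamma_0],
   up to the remainders R_k = Delta_k(phi o f) - psi(f(X)) Delta_k f.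
   For Lipschitz h, psi is bounded by sqrt(2 / pi) and 2-Lipschitz, so that
   |R_k| <= (Delta_k f)^2.
   For half-lines, |psi| <= 1 and |R_k| <= Delta_k f Delta_k(zeta o f) with zeta
   nondecreasing and |zeta| <= 1; exchangeability collapses the sum of the
   E[|Delta_k g| Delta_k f Delta_k(zeta o f)] to
   - 2 E[zeta(F) sum_k |Delta_k g| Delta_k f], where the series may be
   conditioned on F. *)

(** * Real expectations *)

(** Composition with a Lipschitz phi is not continuous for the graph norm: D_k phi(F) - D_k phi(H)
    is not controlled by D_k (F - H). What holds is E[(D_k phi(F))^2] <= C^2 E[(D_k F)^2] and the
    L^2-continuity of each single D_k; [D_graph_lipschitz] combines the two, so that Stein solutions
    with a kink are admissible. Only second moments are available. The series of
    E[|Delta_k g| (Delta_k f)^2] may diverge, so the bound with remainders lives in the extended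
    reals. For half-lines zeta is bounded and the series of E[|Delta_k g Delta_k f|] converges, so
    the exchange argument takes place among finite numbers. The constant sqrt(2 / pi) is twice the
    normal density at 0: |psi| <= 2 galpha gbeta / gp, and this quotient is largest at 0. The
    Lipschitz constant 2 of psi is 1 from h plus 1 from x phi x. For half-lines everything rests on
    x phi x being nondecreasing with values in an interval of length 1. *)

Section real_expectation.
Context d (T : measurableType d) (R : realType) (P : probability T R).
Local Open Scope ring_scope.
Implicit Types Y Z : T -> R.

(** Real-valued, so that [ring] and [lra] apply; an infinite expectation becomes 0, hence the L^1
    hypotheses below. *)
Definition Ex (Y : T -> R) : R := fine 'E_P[Y].

Lemma expectationE Y : 'E_P[Y] = (\int[P]_w (Y w)%:E)%E.
Proof. by rewrite unlock. Qed.

Lemma ExE Y : Y \in Lfun P 1 -> 'E_P[Y] = (Ex Y)%:E.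
Proof. by move=> L; rewrite /Ex fineK// expectation_fin_num. Qed.

Lemma L1_integrable Y : Y \in Lfun P 1 -> P.-integrable setT (EFin \o Y).
Proof. by move/Lfun1_integrable. Qed.

Lemma L1_measurable Y r : Y \in Lfun P r -> measurable_fun setT Y.
Proof. by move/sub_Lfun_mfun; rewrite inE. Qed.

Lemma L1_ge0P Y : measurable_fun setT Y -> (forall w, 0 <= Y w) ->
  ('E_P[Y] < +oo)%E -> Y \in Lfun P 1.
Proof.
move=> mY Y0 YE; apply/Lfun1_integrable/integrableP; split.
  exact/measurable_EFinP.
rewrite expectationE in YE; rewrite (eq_integral (fun w => (Y w)%:E))// => w _.
by rewrite /= ger0_norm.
Qed.

Lemma L1_le Y Z : measurable_fun setT Y -> (forall w, `|Y w| <= `|Z w|) ->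
  Z \in Lfun P 1 -> Y \in Lfun P 1.
Proof.
move=> mY YZ /Lfun1_integrable LZ; apply/Lfun1_integrable.
apply: (le_integrable _ _ _ LZ) => //; first exact/measurable_EFinP.
by move=> w _; rewrite lee_fin.
Qed.

Lemma ExD Y Z : Y \in Lfun P 1 -> Z \in Lfun P 1 -> Ex (Y \+ Z) = Ex Y + Ex Z.
Proof.
by move=> LY LZ; rewrite /Ex expectationD// fineD// expectation_fin_num.
Qed.

Lemma ExB Y Z : Y \in Lfun P 1 -> Z \in Lfun P 1 -> Ex (Y \- Z) = Ex Y - Ex Z.
Proof.
by move=> LY LZ; rewrite /Ex expectationB// fineB// expectation_fin_num.
Qed.

Lemma ExZ k Y : Y \in Lfun P 1 -> Ex (fun w => k * Y w) = k * Ex Y.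
Proof.
move=> LY; rewrite /Ex -[fun w => k * Y w]/(k \*o Y).
rewrite (_ : k \*o Y = k \o* Y); last by apply/funext => w /=; rewrite mulrC.
by rewrite expectationZl// fineM// expectation_fin_num.
Qed.

Lemma Ex_cst k : Ex (cst k) = k.
Proof. by rewrite /Ex expectation_cst. Qed.

Lemma Ex_ge0 Y : (forall w, 0 <= Y w) -> 0 <= Ex Y.
Proof. by move=> Y0; rewrite /Ex fine_ge0// expectation_ge0. Qed.

Lemma Ex_le Y Z : Y \in Lfun P 1 -> Z \in Lfun P 1 ->
  (forall w, Y w <= Z w) -> Ex Y <= Ex Z.
Proof.
move=> LY LZ YZ; rewrite -subr_ge0 -ExB//; apply: Ex_ge0 => w /=.
by rewrite subr_ge0.
Qed.

Lemma L1_scale k Y : Y \in Lfun P 1 -> (fun w => k * Y w) \in Lfun P 1.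
Proof.
move=> LY; rewrite (_ : (fun w => _) = k \o* Y); last first.
  by apply/funext => w /=; rewrite mulrC.
exact: Lfun_scale.
Qed.

Lemma L1_norm Y : Y \in Lfun P 1 -> (fun w => `|Y w|) \in Lfun P 1.
Proof. exact: Lfun_norm. Qed.

Lemma L1_D Y Z : Y \in Lfun P 1 -> Z \in Lfun P 1 -> (Y \+ Z) \in Lfun P 1.
Proof. by move=> LY LZ; exact: rpredD. Qed.

Lemma L1_B Y Z : Y \in Lfun P 1 -> Z \in Lfun P 1 -> (Y \- Z) \in Lfun P 1.
Proof. by move=> LY LZ; exact: rpredB. Qed.

Lemma L2_B Y Z : Y \in Lfun P 2%:E -> Z \in Lfun P 2%:E -> (Y \- Z) \in Lfun P 2%:E.
Proof. by move=> LY LZ; rewrite rpredB ?lee1n//. Qed.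

Lemma L2_D Y Z : Y \in Lfun P 2%:E -> Z \in Lfun P 2%:E -> (Y \+ Z) \in Lfun P 2%:E.
Proof. by move=> LY LZ; rewrite rpredD ?lee1n//. Qed.

Lemma L2_L1 Y : Y \in Lfun P 2%:E -> Y \in Lfun P 1.
Proof. by apply: Lfun_subset12; exact: fin_num_measure. Qed.

Lemma L2M Y Z : Y \in Lfun P 2%:E -> Z \in Lfun P 2%:E ->
  (fun w => Y w * Z w) \in Lfun P 1.
Proof. exact: Lfun2_mul_Lfun1. Qed.

Lemma L2_sqr Y : Y \in Lfun P 2%:E -> (fun w => Y w ^+ 2) \in Lfun P 1.
Proof. by move=> L; apply/Lfun1_integrable; exact: Lfun2_integrable_sqr. Qed.

Lemma L2P Y : measurable_fun setT Y -> (fun w => Y w ^+ 2) \in Lfun P 1 ->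
  Y \in Lfun P 2%:E.
Proof.
move=> mY /Lfun1_integrable/integrableP[_ H]; rewrite inE/=; apply/andP; split; rewrite inE//=.
rewrite /finite_norm unlock poweR_lty//.
rewrite (eq_integral (fun w => `|(Y w ^+ 2)%:E|%E))//.
by move=> w _ /=; rewrite normrX powR_mulrn.
Qed.

Lemma L2_le Y Z k : measurable_fun setT Y -> (forall w, `|Y w| <= k * `|Z w|) ->
  Z \in Lfun P 2%:E -> Y \in Lfun P 2%:E.
Proof.
move=> mY YZ LZ; apply: L2P => //.
apply: (@L1_le _ (fun w => k ^+ 2 * Z w ^+ 2)).
- exact: measurable_funX.
- move=> w; rewrite -exprMn !normrX lerXn2r ?nnegrE//.
  by rewrite (le_trans (YZ w))// normrM ler_wpM2r// ler_norm.
- exact/L1_scale/L2_sqr.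
Qed.

Lemma L2_scale k Y : Y \in Lfun P 2%:E -> (fun w => k * Y w) \in Lfun P 2%:E.
Proof.
move=> LY; apply: (@L2_le _ Y `|k|) => //.
  by apply: measurable_funM => //; exact: L1_measurable LY.
by move=> w; rewrite normrM.
Qed.

Lemma L1_bounded Y C : measurable_fun setT Y -> (forall w, `|Y w| <= C) ->
  Y \in Lfun P 1.
Proof.
move=> mY YC; apply: (@L1_le _ (cst C)) => //; last exact: Lfun_cst.
by move=> w; rewrite (le_trans (YC w))// ler_norm.
Qed.

Lemma L2_bounded Y C : measurable_fun setT Y -> (forall w, `|Y w| <= C) ->
  Y \in Lfun P 2%:E.
Proof.
move=> mY YC; apply: (@L2_le _ (cst 1) C) => //; last exact: Lfun_cst.
by move=> w; rewrite normr1 mulr1.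
Qed.

Lemma L1_boundedM Y Z C : measurable_fun setT Y -> (forall w, `|Y w| <= C) ->
  Z \in Lfun P 1 -> (fun w => Y w * Z w) \in Lfun P 1.
Proof.
move=> mY YC LZ; apply: (@L1_le _ (fun w => C * Z w)).
- by apply: measurable_funM => //; exact: L1_measurable LZ.
- by move=> w; rewrite !normrM ler_wpM2r// (le_trans (YC w))// ler_norm.
- exact: L1_scale.
Qed.

Lemma Ex_norm Y : Y \in Lfun P 1 -> `|Ex Y| <= Ex (fun w => `|Y w|).
Proof.
move=> LY; rewrite ler_norml; apply/andP; split.
  rewrite -mulN1r -ExZ ?L1_norm//; apply: Ex_le => //.
    by apply/L1_scale/L1_norm.
  by move=> w; rewrite mulN1r lerNl -normrN ler_norm.
by apply: Ex_le => //; [exact: L1_norm|move=> w; exact: ler_norm].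
Qed.

Lemma Ex_ae Y Z : measurable_fun setT Y -> measurable_fun setT Z ->
  {ae P, forall w, Y w = Z w} -> 'E_P[Y] = 'E_P[Z].
Proof.
move=> mY mZ YZ; rewrite !expectationE; apply: ae_eq_integral => //.
- exact/measurable_EFinP.
- exact/measurable_EFinP.
- by apply: filterS YZ => w /= ->.
Qed.

Lemma Ex_sqr_eq0 Y : Y \in Lfun P 2%:E -> Ex (fun w => Y w ^+ 2) = 0 ->
  {ae P, forall w, Y w = 0}.
Proof.
move=> LY Y0; have mY := L1_measurable LY.
have : ('E_P[fun w => (Y w ^+ 2)%R] = 0)%E by rewrite ExE ?L2_sqr// Y0.
rewrite expectationE => H.
have /ae_eq_integral_abs : measurable_fun setT (EFin \o (fun w => Y w ^+ 2)).
  by apply/measurable_EFinP; exact: measurable_funX.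
move=> /(_ P measurableT) [+ _].
rewrite (eq_integral (EFin \o (fun w => Y w ^+ 2))); last first.
  by move=> w _ /=; rewrite ger0_norm// sqr_ge0.
move=> /(_ H); apply: filterS => w /= /(_ I) [] /eqP.
by rewrite sqrf_eq0 => /eqP.
Qed.

End real_expectation.

(** * Conditional expectations *)

Section conditional_expectation.
Import HBNNSimple.
Context d (T : measurableType d) (R : realType) (P : probability T R).
Variables (G : set (set T)) (Gm : G `<=` (@measurable _ T)).
Local Open Scope ring_scope.
Implicit Types Y H xi W : T -> R.

Lemma sub_sigma_measurable : <<s G >> `<=` (@measurable _ T).
Proof. exact: smallest_sub (@sigma_algebra_measurable _ T) Gm. Qed.

Lemma measurable_id_sub : measurable_fun [set: T] (id : T -> g_sigma_algebraType G).
Proof. by move=> _ B mB; rewrite setTI preimage_id; exact: sub_sigma_measurable. Qed.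

Lemma measurable_sub d' (U : measurableType d') (Y : T -> U) :
  measurable_fun [set: g_sigma_algebraType G] (Y : g_sigma_algebraType G -> U) ->
  measurable_fun [set: T] Y.
Proof.
move=> mY _ B mB; rewrite setTI; apply: sub_sigma_measurable.
by have := mY measurableT B mB; rewrite setTI.
Qed.

Lemma measurable_wrt_measurable Y : measurable_wrt G Y -> measurable_fun setT Y.
Proof. exact: measurable_sub. Qed.

Lemma integral_indicM Y A :
  (\int[P]_(w in A) (Y w)%:E = \int[P]_w (Y w * \1_A w)%:E)%E.
Proof.
rewrite integral_mkcond; apply: eq_integral => w _.
by rewrite patchE indicE; case: (w \in A); rewrite ?mulr1 ?mulr0.
Qed.

Lemma L1_indicM Y A : measurable A -> Y \in Lfun P 1 ->
  (fun w => Y w * \1_A w) \in Lfun P 1.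
Proof.
move=> mA LY; rewrite (_ : (fun w => _) = (fun w => \1_A w * Y w)); last first.
  by apply/funext => w; rewrite mulrC.
apply: (@L1_boundedM _ _ _ _ _ _ 1) => //.
by move=> w; rewrite indicE; case: (w \in A); rewrite ?normr1 ?normr0.
Qed.

(** Radon-Nikodym on the smaller sigma-algebra: the charge A |-> E[Y 1_A], restricted to [G], is
    dominated by the restriction of [P], and its density is [G]-measurable by construction.
    Restrictions are written as push-forwards along the identity [I] from [T] to the type [TG] that
    carries [<<s G >>]. *)
Lemma exists_cond_exp Y : Y \in Lfun P 1 -> exists H, is_cond_exp P G Y H.
Proof.
move=> /Lfun1_integrable iY.
pose TG := g_sigma_algebraType G.
pose i : T -> TG := id.
pose im := isMeasurableFun.Build _ _ T TG i measurable_id_sub.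
pose I : {mfun T >-> TG} := MeasurableFun.Pack (MeasurableFun.Class im).
pose nu := pushforward (induced_charge iY) (I : T -> TG).
have numu : nu `<< distribution P I.
  apply/null_content_dominatesP => A mA PA.
  apply: null_set_integral => //.
  - exact: sub_sigma_measurable.
  - apply: (measurable_funS measurableT) => //; exact: measurable_int iY.
have mI : measurable_fun [set: T] (I : T -> TG) by exact: measurable_id_sub.
have fin := Radon_Nikodym_fin_num _ numu; have {}fin := fin mI.
have int := Radon_Nikodym_integrable numu; have {}int := int mI.
have eqA A := @Radon_Nikodym_integral _ _ _ _ _ A numu; have {}eqA := eqA mI.
move: fin int eqA; set f := (Radon_Nikodym _ _) => fin int eqA.
have mf : measurable_fun [set: TG] f by exact: measurable_int int.
have fE : f = EFin \o (fine \o f) by apply/funext => x /=; rewrite fineK.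
have mff : measurable_fun [set: TG] (fine \o f).
  by apply/measurable_EFinP; rewrite -fE.
have iT : P.-integrable setT (EFin \o (fine \o f : T -> R)).
  rewrite -[X in P.-integrable _ X]fE.
  apply/integrableP; split.
    exact: measurable_sub.
  have /integrableP[_] := int.
  rewrite ge0_integral_pushforward//=; last by apply: measurableT_comp.
exists (fine \o f); split => // A sA.
rewrite (eq_integral (f : T -> \bar R)); last by move=> x _ /=; rewrite fineK.
rewrite -[RHS]/(nu A) [RHS]eqA//= integral_pushforward//=.
apply: (@integrableS _ _ _ _ setT) => //; first exact: sub_sigma_measurable.
by rewrite -fE in iT.
Qed.

Lemma cond_expP Y : Y \in Lfun P 1 -> is_cond_exp P G Y (cond_exp P G Y).
Proof.
by move=> /exists_cond_exp[H HY]; apply: (xgetPex (cst 0) (ex_intro _ H HY)).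
Qed.

(** Simple functions increase to [xi]; [W] integrates to 0 against each of them, and [|W xi|]
    dominates. They are built over [TG], so that their level sets belong to [<<s G >>]. *)
Lemma orthogonal_ge0 W xi : W \in Lfun P 1 ->
  (forall A, <<s G >> A -> (\int[P]_(w in A) (W w)%:E = 0)%E) ->
  measurable_wrt G xi -> (forall w, 0 <= xi w) ->
  (fun w => W w * xi w) \in Lfun P 1 -> 'E_P[fun w => (W w * xi w)%R] = 0%E.
Proof.
move=> LW WA mxi xi0 LWxi.
pose TG := g_sigma_algebraType G.
have mf : measurable_fun [set: TG] (EFin \o (xi : TG -> R)) by exact/measurable_EFinP.
have f0 (x : TG) : [set: TG] x -> (0 <= (EFin \o (xi : TG -> R)) x)%E by rewrite lee_fin.
pose s n : TG -> R := nnsfun_approx measurableT mf n.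
have mW := L1_measurable LW.
have ms n : measurable_fun [set: T] (s n : T -> R).
  by apply: measurable_wrt_measurable; rewrite /measurable_wrt /s; exact: measurable_funP.
have s_bound n w : 0 <= s n w <= xi w.
  rewrite /s; apply/andP; split; first exact: fun_ge0.
  by rewrite nnsfun_approxE -lee_fin; exact: (@le_approx _ _ _ _ (EFin \o (xi : TG -> R))).
have s0 n : (\int[P]_w (W w * s n w)%:E = 0)%E.
  pose S : seq R := finmap.enum_fset (fset_set (range (s n))).
  have fim w : s n w = \sum_(y <- S) y * \1_(s n @^-1` [set y]) w.
    by rewrite {1}/s fimfunE fsbig_finite//=; exact: fimfunP.
  have mS y : <<s G >> (s n @^-1` [set y]).
    rewrite -[X in <<s G >> X]setTI.
    exact: (measurable_funP (nnsfun_approx measurableT mf n)).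
  rewrite (eq_integral (fun w => \sum_(y <- S) (y * (W w * \1_(s n @^-1` [set y]) w))%:E)%E); last first.
    move=> w _; rewrite sumEFin [in LHS]fim mulr_sumr; congr (_%:E).
    by apply: eq_bigr => y _; rewrite mulrCA.
  have Li y : (fun w => W w * \1_(s n @^-1` [set y]) w) \in Lfun P 1.
    by apply: L1_indicM => //; apply: sub_sigma_measurable; exact: mS.
  rewrite (@integral_sum _ _ _ _ _ measurableT _
    (fun y w => (y * (W w * \1_(s n @^-1` [set y]) w))%:E)); last first.
    by move=> y; apply: L1_integrable; exact: L1_scale.
  rewrite big1// => y _.
  under eq_integral do rewrite EFinM.
  rewrite integralZl//; last exact: L1_integrable.
  by rewrite -integral_indicM WA ?mule0.
have s_cvg w : (fun n => (W w * s n w)%:E) @ \oo --> (W w * xi w)%:E.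
  apply: cvg_EFin; first exact: nearW.
  rewrite /comp/=; apply: cvgMr.
  under eq_fun do rewrite /s nnsfun_approxE.
  exact: (@cvg_approx _ _ _ setT (EFin \o (xi : TG -> R)) w f0 I (ltry _)).
have s_dom w n : setT w -> (`|(W w * s n w)%:E| <= `|W w * xi w|%:E)%E.
  move=> _ /=; rewrite lee_fin !normrM ler_wpM2l//.
  have /andP[? ?] := s_bound n w.
  by rewrite !ger0_norm.
have [_ _ H] := @dominated_convergence _ T R P setT measurableT
  (fun n w => (W w * s n w)%:E) (fun w => (W w * xi w)%:E)
  (fun w => `|W w * xi w|%:E)
  (fun n => (measurable_EFinP _ _).2 (measurable_funM mW (ms n)))
  ((measurable_EFinP _ _).2 (L1_measurable LWxi))
  (aeW _ (fun w _ => s_cvg w)) (L1_integrable (L1_norm LWxi))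
  (aeW _ s_dom).
rewrite expectationE.
apply: (cvg_unique _ H) => //.
rewrite [X in X @ _](_ : _ = cst 0%E); first exact: cvg_cst.
by apply/funext => n /=; rewrite s0.
Qed.

Lemma measurable_wrtB Y Z : measurable_wrt G Y -> measurable_wrt G Z ->
  measurable_wrt G (Y \- Z).
Proof. exact: measurable_funB. Qed.

Lemma measurable_wrt_comp (h : R -> R) Y : measurable_fun setT h ->
  measurable_wrt G Y -> measurable_wrt G (h \o Y).
Proof. by move=> mh mY; exact: measurableT_comp. Qed.

Lemma orthogonal W xi : W \in Lfun P 1 ->
  (forall A, <<s G >> A -> (\int[P]_(w in A) (W w)%:E = 0)%E) ->
  measurable_wrt G xi ->
  (fun w => W w * xi w) \in Lfun P 1 -> Ex P (fun w => W w * xi w) = 0.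
Proof.
move=> LW WA mxi LWxi.
pose xp w := Num.max (xi w) 0; pose xn w := Num.max (- xi w) 0.
have mp : measurable_wrt G xp by apply: measurable_maxr => //.
have mn : measurable_wrt G xn.
  by apply: measurable_maxr => //; exact: measurableT_comp.
have mW := L1_measurable LW.
have Lp : (fun w => W w * xp w) \in Lfun P 1.
  apply: (L1_le _ _ LWxi).
    by apply: measurable_funM => //; exact: measurable_wrt_measurable.
  move=> w; rewrite !normrM ler_wpM2l// /xp; case: (leP (xi w) 0) => //.
  by rewrite normr0.
have Ln : (fun w => W w * xn w) \in Lfun P 1.
  apply: (L1_le _ _ LWxi).
    by apply: measurable_funM => //; exact: measurable_wrt_measurable.
  move=> w; rewrite !normrM ler_wpM2l// /xn; case: (leP (- xi w) 0) => //.
    by rewrite normr0.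
  by rewrite normrN.
have -> : (fun w => W w * xi w) = (fun w => W w * xp w) \- (fun w => W w * xn w).
  apply/funext => w /=; rewrite -mulrBr /xp /xn; congr (_ * _).
  by case: (leP (xi w) 0); case: (leP (- xi w) 0); lra.
rewrite ExB// /Ex !orthogonal_ge0 ?subr0//.
- by move=> w; rewrite /xn le_max lexx orbT.
- by move=> w; rewrite /xp le_max lexx orbT.
Qed.

Lemma cond_exp_orthogonal Y H xi : Y \in Lfun P 1 -> is_cond_exp P G Y H ->
  measurable_wrt G xi -> (fun w => (Y w - H w) * xi w) \in Lfun P 1 ->
  Ex P (fun w => (Y w - H w) * xi w) = 0.
Proof.
move=> LY [mH /Lfun1_integrable LH HY] mxi L; apply: orthogonal => //.
  exact: L1_B.
move=> A sA; have mA := sub_sigma_measurable sA.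
rewrite integralB_EFin//; last 2 first.
- by apply: (integrableS measurableT) => //; exact: L1_integrable.
- by apply: (integrableS measurableT) => //; exact: L1_integrable.
rewrite HY// subee// integrable_fin_num//.
by apply: (integrableS measurableT) => //; exact: L1_integrable.
Qed.

Lemma cond_exp_L1 Y H : is_cond_exp P G Y H -> H \in Lfun P 1.
Proof. by case=> _ /Lfun1_integrable. Qed.

Lemma cond_exp_pullout Y H xi : Y \in Lfun P 1 -> is_cond_exp P G Y H ->
  measurable_wrt G xi -> (fun w => Y w * xi w) \in Lfun P 1 ->
  (fun w => H w * xi w) \in Lfun P 1 ->
  Ex P (fun w => Y w * xi w) = Ex P (fun w => H w * xi w).
Proof.
move=> LY HY mxi LYx LHx; apply/eqP; rewrite -subr_eq0 -ExB//.
rewrite (_ : _ \- _ = (fun w => (Y w - H w) * xi w)); last first.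
  by apply/funext => w /=; rewrite mulrBl.
rewrite (cond_exp_orthogonal LY HY)//.
rewrite (_ : (fun w => _) = (fun w => Y w * xi w) \- (fun w => H w * xi w)).
  exact: L1_B.
by apply/funext => w /=; rewrite mulrBl.
Qed.

Lemma cond_exp_pullout_bounded Y H xi C : Y \in Lfun P 1 ->
  is_cond_exp P G Y H -> measurable_wrt G xi -> (forall w, `|xi w| <= C) ->
  Ex P (fun w => xi w * Y w) = Ex P (fun w => xi w * H w).
Proof.
move=> LY HY mxi xiC; have mx := measurable_wrt_measurable mxi.
have LH := cond_exp_L1 HY.
under eq_fun do rewrite mulrC.
under [in RHS]eq_fun do rewrite mulrC.
apply: cond_exp_pullout => //.
  by under eq_fun do rewrite mulrC; exact: (L1_boundedM mx xiC).
by under eq_fun do rewrite mulrC; exact: (L1_boundedM mx xiC).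
Qed.

(** The sign of [H] is an admissible bounded test function: E|H| = E[sg(H) H] = E[sg(H) Y] <=
    E|Y|. *)
Lemma cond_exp_norm Y H : Y \in Lfun P 1 -> is_cond_exp P G Y H ->
  Ex P (fun w => `|H w|) <= Ex P (fun w => `|Y w|).
Proof.
move=> LY HY; have LH := cond_exp_L1 HY.
pose xi w := Num.sg (H w).
have sg1 w : `|xi w| <= 1 by rewrite /xi normr_sg lern1 leq_b1.
have mxi : measurable_wrt G xi.
  case: HY => mH _ _.
  rewrite /measurable_wrt (_ : xi = (fun w => if 0 < H w then 1 else if H w < 0 then -1 else 0)).
    apply: measurable_fun_ifT => //; first exact: measurable_fun_ltr.
    by apply: measurable_fun_ifT => //; exact: measurable_fun_ltr.
  by apply/funext => w; rewrite /xi; case: sgrP => // ->; rewrite ltxx.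
have mx := measurable_wrt_measurable mxi.
have -> : (fun w => `|H w|) = (fun w => xi w * H w).
  by apply/funext => w; rewrite normrEsg.
rewrite -(cond_exp_pullout_bounded LY HY mxi sg1).
apply: Ex_le; [exact: (L1_boundedM mx sg1)|exact: L1_norm|move=> w].
by rewrite (le_trans (ler_norm _))// normrM ler_piMl.
Qed.

End conditional_expectation.

Section conditional_expectation_L2.
Context d (T : measurableType d) (R : realType) (P : probability T R).
Variables (G : set (set T)) (Gm : G `<=` (@measurable _ T)).
Local Open Scope ring_scope.
Implicit Types Y H xi W : T -> R.

(* Testing against the truncations of H bounds E[H_n ^ 2] = E[Y H_n] by
   E[Y ^ 2]; Fatou concludes. *)
Lemma cond_exp_L2 Y H : Y \in Lfun P 2%:E -> is_cond_exp P G Y H ->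
  H \in Lfun P 2%:E.
Proof.
move=> LY HY; have [mH' _ _] := HY; have mH := measurable_wrt_measurable Gm mH'.
have LY1 := L2_L1 LY; have LH := cond_exp_L1 HY.
(* Large values are set to 0 instead of being clipped at n, so that [Hn n w * H w] is
   [Hn n w ^+ 2]. *)
pose Hn (n : nat) w := if `|H w| <= n%:R then H w else 0.
have Hn_b n w : `|Hn n w| <= n%:R.
  by rewrite /Hn; case: ifPn => // _; rewrite normr0.
have mHn n : measurable_wrt G (Hn n).
  apply: measurable_fun_ifT => //.
  by apply: measurable_fun_ler => //; exact: measurableT_comp.
have mHnT n := measurable_wrt_measurable Gm (mHn n).
have LHn n : Hn n \in Lfun P 2%:E by exact: L2_bounded (Hn_b n).
have HnE n : Ex P (fun w => Hn n w ^+ 2) <= Ex P (fun w => Y w ^+ 2).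
  have E : Ex P (fun w => Hn n w * Y w) = Ex P (fun w => Hn n w ^+ 2).
    rewrite (cond_exp_pullout_bounded Gm LY1 HY (mHn n) (Hn_b n)).
    congr Ex; apply/funext => w; rewrite /Hn expr2.
    by case: ifPn => // _; rewrite !mul0r.
  (* In place of the Cauchy-Schwarz inequality: the left side equals 2 E[H_n^2], so E[H_n^2] <=
     E[Y^2] remains. *)
  have : Ex P (fun w => 2 * (Hn n w * Y w)) <=
         Ex P ((fun w => Hn n w ^+ 2) \+ (fun w => Y w ^+ 2)).
    apply: Ex_le; first by apply/L1_scale/L2M.
      by apply: L1_D; exact: L2_sqr.
    move=> w /=; rewrite -subr_ge0.
    rewrite (_ : _ - _ = (Hn n w - Y w) ^+ 2); first exact: sqr_ge0.
    by ring.
  rewrite ExZ ?L2M// ExD ?L2_sqr// E; lra.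
apply: L2P => //; apply: L1_ge0P; first exact: measurable_funX.
  by move=> w; exact: sqr_ge0.
apply: (@le_lt_trans _ _ (Ex P (fun w => Y w ^+ 2))%:E); last exact: ltry.
rewrite expectationE.
have cvgHn w : (fun n => (Hn n w ^+ 2)%:E) @ \oo --> (H w ^+ 2)%:E.
  apply: cvg_near_cst; near=> n; rewrite /Hn ifT//.
  by near: n; exact: nbhs_infty_ger.
have lim_eq w : (H w ^+ 2)%:E = limn_einf (fun n => (Hn n w ^+ 2)%:E).
  by rewrite (cvg_limn_einf_sup (cvgHn w)).1.
rewrite (eq_integral _ _ (fun w _ => lim_eq w)).
apply: (@le_trans _ _ (limn_einf (fun n => (\int[P]_w (Hn n w ^+ 2)%:E)%E))).
  apply: fatou => // [n|n w _]; last by rewrite lee_fin sqr_ge0.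
  by apply/measurable_EFinP; exact: measurable_funX.
rewrite limn_einf_lim; apply: lime_le; first exact: is_cvg_einfs.
apply: nearW => n; apply: ge_ereal_inf; exists (\int[P]_w (Hn n w ^+ 2)%:E)%E.
  by exists n => /=.
by rewrite -expectationE ExE ?lee_fin ?L2_sqr.
Unshelve. all: by end_near. Qed.

(** Pythagoras: [Y - H] is orthogonal to the [G]-measurable [H - xi]. *)
Lemma cond_exp_best_approx Y H xi : Y \in Lfun P 2%:E -> is_cond_exp P G Y H ->
  measurable_wrt G xi -> xi \in Lfun P 2%:E ->
  Ex P (fun w => (Y w - H w) ^+ 2) <= Ex P (fun w => (Y w - xi w) ^+ 2).
Proof.
move=> LY HY mxi Lxi; have LH := cond_exp_L2 LY HY; have [mH _ _] := HY.
have LYH := L2_B LY LH; have LHx := L2_B LH Lxi; have LYx := L2_B LY Lxi.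
have O : Ex P (fun w => (Y w - H w) * (H w - xi w)) = 0.
  apply: (cond_exp_orthogonal Gm (L2_L1 LY) HY); last exact: L2M.
  exact: measurable_wrtB.
rewrite -subr_ge0 -ExB; [|exact: L2_sqr..].
rewrite (_ : _ \- _ = (fun w => (H w - xi w) ^+ 2) \+
    (fun w => 2 * ((Y w - H w) * (H w - xi w)))); last first.
  by apply/funext => w /=; ring.
rewrite ExD; [|exact: L2_sqr|by apply/L1_scale/L2M].
rewrite ExZ ?L2M// O mulr0 addr0; apply: Ex_ge0 => w; exact: sqr_ge0.
Qed.

Lemma is_cond_expB Y1 Y2 H1 H2 : Y1 \in Lfun P 1 -> Y2 \in Lfun P 1 ->
  is_cond_exp P G Y1 H1 -> is_cond_exp P G Y2 H2 ->
  is_cond_exp P G (Y1 \- Y2) (H1 \- H2).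
Proof.
move=> L1 L2 HY1 HY2; have [m1 _ E1] := HY1; have [m2 _ E2] := HY2.
have LH1 := cond_exp_L1 HY1; have LH2 := cond_exp_L1 HY2.
split; [exact: measurable_wrtB|by apply: L1_integrable; exact: L1_B|].
move=> A sA; have mA := sub_sigma_measurable Gm sA.
have iA Y : Y \in Lfun P 1 -> P.-integrable A (EFin \o Y).
  by move=> LY; apply: (integrableS measurableT) => //; exact: L1_integrable.
rewrite !integralB_EFin//; [|exact: iA..].
by rewrite E1// E2.
Qed.

(** Best approximation of [Y1 - Y2], compared with the constant 0. *)
Lemma cond_exp_contraction Y1 Y2 H1 H2 :
  Y1 \in Lfun P 2%:E -> Y2 \in Lfun P 2%:E ->
  is_cond_exp P G Y1 H1 -> is_cond_exp P G Y2 H2 ->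
  Ex P (fun w => ((Y1 w - H1 w) - (Y2 w - H2 w)) ^+ 2) <=
  Ex P (fun w => (Y1 w - Y2 w) ^+ 2).
Proof.
move=> L1 L2 HY1 HY2.
have := @cond_exp_best_approx (Y1 \- Y2) (H1 \- H2) (cst 0).
have := is_cond_expB (L2_L1 L1) (L2_L1 L2) HY1 HY2.
move=> H /(_ (L2_B L1 L2) H (measurable_cst _) (Lfun_cst _ _ _)) /=.
under [in X in _ <= X -> _]eq_fun do rewrite subr0.
apply: le_trans; rewrite le_eqVlt; apply/orP; left; apply/eqP.
by congr Ex; apply/funext => w; congr (_ ^+ 2); lra.
Qed.

(** [phi \o H] is a competitor in the best approximation of [phi \o Y], and its error is at most C
    |Y - H|. *)
Lemma cond_exp_lipschitz (phi : R -> R) C Y H Hphi : measurable_fun setT phi ->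
  (forall x y, `|phi x - phi y| <= C * `|x - y|) ->
  Y \in Lfun P 2%:E -> (phi \o Y) \in Lfun P 2%:E ->
  is_cond_exp P G Y H -> is_cond_exp P G (phi \o Y) Hphi ->
  Ex P (fun w => (phi (Y w) - Hphi w) ^+ 2) <=
  C ^+ 2 * Ex P (fun w => (Y w - H w) ^+ 2).
Proof.
move=> mphi phiC LY LphiY HY HphiY.
have LH := cond_exp_L2 LY HY; have [mH _ _] := HY.
have mH' := measurable_wrt_measurable Gm mH.
have L0 : (phi \o H) \in Lfun P 2%:E.
  have -> : phi \o H = (fun w => phi (H w) - phi 0) \+ cst (phi 0).
    by apply/funext => w /=; rewrite subrK.
  apply: L2_D; last exact: Lfun_cst.
  apply: (L2_le (k := C) _ _ LH) => [|w]; last by rewrite (le_trans (phiC _ _))// subr0.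
  by apply: measurable_funB => //; exact: measurableT_comp.
apply: (le_trans (cond_exp_best_approx LphiY HphiY (measurable_wrt_comp mphi mH) L0)).
rewrite -ExZ; last by apply: L2_sqr; exact: L2_B.
apply: Ex_le.
- by apply: L2_sqr; exact: (L2_B LphiY L0).
- by apply: L1_scale; apply: L2_sqr; exact: L2_B.
move=> w /=; rewrite -exprMn.
rewrite -[leLHS]ger0_norm ?sqr_ge0// -[leRHS]ger0_norm ?sqr_ge0// !normrX.
by rewrite lerXn2r ?nnegrE// (le_trans (phiC _ _))// normrM ler_wpM2r// ler_norm.
Qed.

End conditional_expectation_L2.

(** * Expectations of absolutely convergent series *)

Section series_of_random_variables.
Context d (T : measurableType d) (R : realType) (P : probability T R).
Local Open Scope ring_scope.

Lemma cvg_limn_einf_esup (u : nat -> R) (l : R) :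
  limn_einf (EFin \o u) = l%:E -> limn_esup (EFin \o u) = l%:E ->
  u n @[n --> \oo] --> l.
Proof.
move=> ul lu; suff /fine_cvg : (EFin \o u) n @[n --> \oo] --> l%:E by [].
apply: (@squeeze_cvge _ _ _ _ (einfs (EFin \o u)) _ (esups (EFin \o u))).
- apply: nearW => n; apply/andP; split.
    by apply: ereal_inf_lbound; exists n => /=.
  by apply: ereal_sup_ubound; exists n => /=.
- by rewrite -ul limn_einf_lim; exact: is_cvg_einfs.
- by rewrite -lu limn_esup_lim; exact: is_cvg_esups.
Qed.

(** [limn] takes the default value 0 where the sequence diverges. The limit is therefore rebuilt
    from liminf and limsup, which are equal and finite exactly where the sequence converges. *)
Lemma measurable_fun_limn (u : nat -> T -> R) :
  (forall n, measurable_fun setT (u n)) ->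
  measurable_fun setT (fun w => limn (u ^~ w)).
Proof.
move=> mu.
pose s w := limn_esup (fun n => (u n w)%:E).
pose i w := limn_einf (fun n => (u n w)%:E).
have meu n : measurable_fun setT (EFin \o u n) by exact/measurable_EFinP.
have ms : measurable_fun setT s by apply: measurable_fun_limn_esup.
have mi : measurable_fun setT i.
  apply: measurableT_comp => //; apply: measurable_fun_limn_esup => n.
  by apply: measurableT_comp => //; exact: meu.
rewrite (_ : (fun w => _) = (fun w =>
    if i w == s w then if (s w < +oo)%E then if (-oo < s w)%E then fine (s w) else 0 else 0
    else 0)).
  apply: measurable_fun_ifT => //; first exact: measurable_fun_eqe.
  apply: measurable_fun_ifT => //; first exact: measurable_fun_lte.
  apply: measurable_fun_ifT => //; first exact: measurable_fun_lte.
  exact: measurableT_comp.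
apply/funext => w.
have [cu|ncu] := pselect (cvgn (u ^~ w)).
  have : (fun n => (u n w)%:E) @ \oo --> (limn (u ^~ w))%:E.
    by apply: cvg_EFin => //; exact: nearW.
  move=> /cvg_limn_einf_sup[iE sE].
  by rewrite /i /s iE sE eqxx ltry ltNyr.
rewrite dvgP//.
case: eqP => // is_; case: ifPn => // s1; case: ifPn => // s2.
exfalso; apply: ncu; apply/cvg_ex; exists (fine (s w)).
have sfin : s w \is a fin_num by rewrite fin_numElt s1 s2.
by apply: cvg_limn_einf_esup; rewrite fineK//.
Qed.

Lemma expectation_series (Y : nat -> T -> R) : (forall k, Y k \in Lfun P 1) ->
  (\sum_(0 <= k <oo) 'E_P[fun w => `|Y k w|%R] < +oo)%E ->
  [/\ (fun w => limn (series (Y ^~ w))) \in Lfun P 1,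
      {ae P, forall w, cvgn (series (Y ^~ w))} &
      series (fun k => Ex P (Y k)) @ \oo -->
        Ex P (fun w => limn (series (Y ^~ w)))].
Proof.
move=> LY Yoo.
(* The dominating function: its integral is the assumed finite sum, so it is finite a.s., which
   gives absolute convergence. *)
pose g w := (\sum_(0 <= k <oo) `|Y k w|%:E)%E.
have g0 w : (0 <= g w)%E by apply: nneseries_ge0.
have mY k := L1_measurable (LY k).
have mS n : measurable_fun setT (fun w => series (Y ^~ w) n).
  by rewrite /series /=; apply: measurable_sum => k; exact: mY.
have mS' : measurable_fun setT (fun w => limn (series (Y ^~ w))).
  exact: (measurable_fun_limn mS).
have mN k : measurable_fun setT (fun w => `|Y k w|%:E).
  by apply/measurable_EFinP; exact: measurableT_comp.
have mg : measurable_fun setT g by apply: ge0_emeasurable_sum.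
have ig : P.-integrable setT g.
  apply/integrableP; split => //.
  rewrite (eq_integral g); last first.
    by move=> w _; rewrite gee0_abs ?g0.
  rewrite integral_nneseries//.
  by under eq_eseriesr do rewrite -expectationE.
have cg : {ae P, forall w, cvgn (series (Y ^~ w))}.
  have := integrable_ae measurableT ig; apply: filterS => w /(_ I) gfin.
  apply: normed_cvg; apply: nnseries_is_cvg => [i|]; first exact: normr_ge0.
  by move: gfin; rewrite ge0_fin_numE ?g0.
have c_ae : {ae P, forall w, setT w ->
    (fun n => (series (Y ^~ w) n)%:E) @ \oo --> (limn (series (Y ^~ w)))%:E}.
  by apply: filterS cg => w cw _; apply: cvg_EFin => //; exact: nearW.
have dom w n : setT w -> (`|(series (Y ^~ w) n)%:E| <= g w)%E.
  move=> _ /=; apply: (@le_trans _ _ (\sum_(0 <= k < n) `|Y k w|%:E)%E).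
    by rewrite sumEFin lee_fin /series /= ler_norm_sum.
  exact: nneseries_lim_ge.
have [iS _ cS] := @dominated_convergence _ T R P setT measurableT
  (fun n w => (series (Y ^~ w) n)%:E) (fun w => (limn (series (Y ^~ w)))%:E) g
  (fun n => (measurable_EFinP _ _).2 (mS n)) ((measurable_EFinP _ _).2 mS')
  c_ae ig (aeW _ dom).
have LS : (fun w => limn (series (Y ^~ w))) \in Lfun P 1 by apply/Lfun1_integrable.
split => //.
suff /fine_cvg : (EFin \o series (fun k => Ex P (Y k))) n @[n --> \oo] -->
  (Ex P (fun w => limn (series (Y ^~ w))))%:E by [].
rewrite -ExE// expectationE.
rewrite [X in X @ _](_ : _ = [sequence (\int[P]_w (series (Y ^~ w) n)%:E)%E]_n)//.
apply/funext => n /=; rewrite {1}/series /= -sumEFin.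
rewrite (eq_integral (fun w => \sum_(0 <= k < n) (Y k w)%:E)%E); last first.
  by move=> w _; rewrite sumEFin.
rewrite (@integral_sum _ _ _ _ _ measurableT _ (fun k w => (Y k w)%:E)); last first.
  by move=> k; exact: L1_integrable.
by apply: eq_bigr => k _; rewrite -ExE// expectationE.
Qed.

End series_of_random_variables.

(** * Resampling one coordinate *)

Section pi_systems.
Context d (T : measurableType d) (R : realType) (P : probability T R).
Context d' (U : measurableType d') (Gen : set (set U)).
Hypothesis UE : @measurable _ U = <<s Gen >>.
Hypothesis GenI : setI_closed Gen.
Hypothesis GenT : Gen setT.

Lemma finite_measure_eq (m1 m2 : {measure set U -> \bar R}) :
  (forall A, Gen A -> m1 A = m2 A) -> m1 setT < +oo ->
  forall A, measurable A -> m1 A = m2 A.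
Proof.
move=> m12 fin A; rewrite UE.
apply: (@g_sigma_algebra_measure_unique _ _ _ Gen _ (fun=> setT)) => //.
- by move=> B GB; rewrite UE; exact: sub_sigma_algebra.
- by rewrite bigcup_const//; exists 0%N.
Qed.

(** The fixed events [D1] and [D2] allow an identity about two sets to be extended from [Gen] to all
    measurable sets, one set at a time. *)
Lemma probability_preimage_eq (f1 f2 : T -> U) (D1 D2 : set T) :
  measurable_fun setT f1 -> measurable_fun setT f2 ->
  measurable D1 -> measurable D2 ->
  (forall A, Gen A -> P (f1 @^-1` A `&` D1) = P (f2 @^-1` A `&` D2)) ->
  forall A, measurable A -> P (f1 @^-1` A `&` D1) = P (f2 @^-1` A `&` D2).
Proof.
move=> mf1 mf2 mD1 mD2 H A mA.
have := @finite_measure_eq (pushforward (mrestr P mD1) f1) (pushforward (mrestr P mD2) f2).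
move=> /(_ mf1 mf2); apply => //.
rewrite /= /pushforward /mrestr preimage_setT setTI.
by rewrite (le_lt_trans (probability_le1 P mD1)) ?ltry.
Qed.

Lemma probability_preimage_indep (f : T -> U) (D : set T) :
  measurable_fun setT f -> measurable D ->
  (forall A, Gen A -> P (f @^-1` A `&` D) = P D * P (f @^-1` A)) ->
  forall A, measurable A -> P (f @^-1` A `&` D) = P D * P (f @^-1` A).
Proof.
move=> mf mD H A mA.
have PD0 : (0 <= fine (P D))%R by exact: fine_ge0.
have PDE : P D = (fine (P D))%:E by rewrite fineK// fin_num_measure.
pose r := NngNum PD0.
have := @finite_measure_eq (pushforward (mrestr P mD) f) (mscale r (pushforward P f)).
move=> /(_ mf mf) H'; have := H' _ _ A mA.
rewrite /= /mscale /pushforward /mrestr /= -PDE; apply.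
  by move=> B GB; rewrite H.
rewrite preimage_setT setTI.
by rewrite (le_lt_trans (probability_le1 P mD)) ?ltry.
Qed.

(** [W] has no sign, so uniqueness of measures gives way to a Dynkin induction on the charge A |->
    E[W 1_A]; [GenT] supplies the total mass 0 used for complements. *)
Lemma integral_preimage_eq0 (f : T -> U) (W : T -> R) :
  measurable_fun setT f -> W \in Lfun P 1 ->
  (forall A, Gen A -> \int[P]_(w in f @^-1` A) (W w)%:E = 0) ->
  forall A, measurable A -> \int[P]_(w in f @^-1` A) (W w)%:E = 0.
Proof.
move=> mf LW W0 A; rewrite UE; move: A.
have iW := L1_integrable LW.
pose nu := [the {charge set T -> \bar R} of induced_charge iW].
have mfA A : measurable A -> measurable (f @^-1` A).
  by move=> mA; rewrite -[X in measurable X]setTI; exact: mf.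
apply: (@dynkin_induction _ _ Gen (fun A => \int[P]_(w in f @^-1` A) (W w)%:E = 0)) => //.
- exact: W0.
- move=> A mA A0.
  have WT : nu setT = 0 by have := W0 _ GenT; rewrite preimage_setT.
  have : nu (f @^-1` A `|` f @^-1` (~` A)) = nu (f @^-1` A) + nu (f @^-1` (~` A)).
    apply: chargeU; [exact: mfA|exact/mfA/measurableC|].
    by rewrite -preimage_setI setICr preimage_set0.
  rewrite -preimage_setU setUCr preimage_setT WT.
  by rewrite [nu (f @^-1` A)]A0 add0e => /esym.
- move=> F mF tF F0.
  have tF' : trivIset setT (fun n => f @^-1` (F n)).
    apply/trivIsetP => i j _ _ ij; rewrite -preimage_setI.
    by move/trivIsetP : tF => /(_ i j I I ij) ->; rewrite preimage_set0.
  have mU : measurable (\bigcup_n (f @^-1` (F n))).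
    by apply: bigcupT_measurable => n; exact: mfA.
  have := @charge_semi_sigma_additive _ _ _ nu _ (fun n => mfA _ (mF n)) tF' mU.
  rewrite preimage_bigcup => H; apply: (cvg_unique _ H) => //.
  rewrite [X in X @ _](_ : _ = cst 0); first exact: cvg_cst.
  by apply/funext => n; rewrite big1// => i _; exact: F0.
Qed.

End pi_systems.

Lemma ge0_expectation_comp_eq d (T : measurableType d) (R : realType)
    (P : probability T R) d' (U : measurableType d') (f1 f2 : T -> U)
    (psi : U -> R) :
  measurable_fun setT f1 -> measurable_fun setT f2 -> measurable_fun setT psi ->
  (forall A, measurable A -> P (f1 @^-1` A) = P (f2 @^-1` A)) ->
  (forall u, (0 <= psi u)%R) ->
  'E_P[psi \o f1] = 'E_P[psi \o f2].
Proof.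
move=> mf1 mf2 mpsi H psi0; rewrite !expectationE.
have mp : measurable_fun setT (EFin \o psi) by exact/measurable_EFinP.
have := @ge0_integral_pushforward _ _ T U R f1 mf1 P setT (EFin \o psi) measurableT mp.
rewrite preimage_setT /= => <-//; last by move=> y _; rewrite lee_fin.
have := @ge0_integral_pushforward _ _ T U R f2 mf2 P setT (EFin \o psi) measurableT mp.
rewrite preimage_setT /= => <-//; last by move=> y _; rewrite lee_fin.
by apply: eq_measure_integral => A mA _; exact: H.
Qed.

(** Positive and negative parts are compared separately, so the identity also covers infinite
    expectations. *)
Lemma expectation_comp_eq d (T : measurableType d) (R : realType)
    (P : probability T R) d' (U : measurableType d') (f1 f2 : T -> U)
    (psi : U -> R) :
  measurable_fun setT f1 -> measurable_fun setT f2 -> measurable_fun setT psi ->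
  (forall A, measurable A -> P (f1 @^-1` A) = P (f2 @^-1` A)) ->
  'E_P[psi \o f1] = 'E_P[psi \o f2].
Proof.
move=> mf1 mf2 mpsi H; rewrite !expectationE integralE [RHS]integralE.
pose pp u := Num.max (psi u) 0%R; pose pn u := Num.max (- psi u)%R 0%R.
have mpp : measurable_fun setT pp by apply: measurable_maxr.
have mpn : measurable_fun setT pn.
  by apply: measurable_maxr => //; exact: measurableT_comp.
have E1 f : \int[P]_x ((fun w => (psi (f w))%:E)^\+)%E x = 'E_P[pp \o f].
  rewrite expectationE; apply: eq_integral => w _.
  by rewrite /pp funeposE /= EFin_max.
have E2 f : \int[P]_x ((fun w => (psi (f w))%:E)^\-)%E x = 'E_P[pn \o f].
  rewrite expectationE; apply: eq_integral => w _.
  by rewrite /pn funenegE /= EFin_max EFinN.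
rewrite (E1 f1) (E1 f2) (E2 f1) (E2 f2).
rewrite (ge0_expectation_comp_eq mf1 mf2 mpp H); last first.
  by move=> u; rewrite /pp le_max lexx orbT.
rewrite (ge0_expectation_comp_eq mf1 mf2 mpn H)// => u.
by rewrite /pn le_max lexx orbT.
Qed.

(** * Cylinder sets *)

Section cylinders.
Context (dE : nat -> measure_display) (E : forall n, measurableType (dE n)).

Definition cyl (A : forall i, set (E i)) : set (prodE E) :=
  [set x | forall i, A i (x i)].

(** Only finitely many coordinates are constrained, so [mu] of such a set is a finite product.
    Unlike preimages under single coordinates, these sets are stable under intersection. *)
Definition cylinders : set (set (prodE E)) :=
  [set C | exists A, [/\ forall i, measurable (A i),
     exists N, forall i, (N <= i)%N -> A i = setT & C = cyl A]].

Lemma measurable_coord k : measurable_fun setT (fun x : prodE E => x k).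
Proof.
move=> _ B mB; rewrite setTI; apply: sub_sigma_algebra.
by exists k => //; exists B => //; rewrite setTI.
Qed.

Lemma measurable_cyl A : (forall i, measurable (A i)) -> measurable (cyl A).
Proof.
move=> mA; rewrite (_ : cyl A = \bigcap_i ((fun x : prodE E => x i) @^-1` A i)).
  apply: bigcapT_measurable => i; rewrite -[X in measurable X]setTI.
  exact: measurable_coord.
by apply/seteqP; split => [x Ax i _|x Ax i]; [exact: Ax|exact: (Ax i I)].
Qed.

Lemma cylinders_setI : setI_closed cylinders.
Proof.
move=> _ _ [A [mA [N AN] ->]] [B [mB [M BM] ->]].
exists (fun i => A i `&` B i); split.
- by move=> i; exact: measurableI.
- exists (maxn N M) => i; rewrite geq_max => /andP[Ni Mi].
  by rewrite AN// BM// setTI.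
- apply/seteqP; split => [x [Ax Bx] i|x ABx]; first by split.
  by split => i; have [] := ABx i.
Qed.

Lemma cylindersT : cylinders setT.
Proof.
exists (fun=> setT); split => //; first by exists 0%N.
by apply/seteqP; split.
Qed.

Lemma sigma_cylinders : @measurable _ (prodE E) = <<s cylinders >>.
Proof.
apply/seteqP; split; last first.
  apply: smallest_sub; first exact: sigma_algebra_measurable.
  by move=> _ [A [mA _ ->]]; exact: measurable_cyl.
apply: smallest_sub; first exact: smallest_sigma_algebra.
move=> _ [k _ [B mB <-]]; apply: sub_sigma_algebra.
(* The family must be [B] at index k and [setT] elsewhere; since the types depend on the index, [B]
   is transported along a proof of i = k. *)
exists (fun i => [set x : E i | forall e : i = k, B (eq_rect i (fun j => E j) x k e)]).
split.
- move=> i; have [ik|ik] := pselect (i = k).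
    subst i; rewrite (_ : [set _ | _] = B)//.
    apply/seteqP; split => [x /(_ erefl)//|x Bx e].
    by rewrite (Prop_irrelevance e erefl).
  rewrite (_ : [set _ | _] = setT)//.
  by apply/seteqP; split => // x _ e.
- exists k.+1 => i ki; apply/seteqP; split => // x _ e; exfalso.
  by move: ki; rewrite e ltnn.
- rewrite setTI; apply/seteqP; split => [x Bx i e|x /(_ k erefl)//].
  by subst k.
Qed.

Lemma measurable_prodE d (T : measurableType d) (Y : T -> prodE E) :
  (forall k, measurable_fun setT (fun w => Y w k)) -> measurable_fun setT Y.
Proof.
move=> mY; apply: (@measurability _ _ T (prodE E) setT Y (coord_sets (E := E))) => //.
move=> _ [_ [k _ [B mB <-]] <-]; rewrite !setTI.
by have := mY k measurableT B mB; rewrite setTI.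
Qed.

End cylinders.

Section resampling.
Context (dE : nat -> measure_display) (E : forall n, measurableType (dE n)).
Context (R : realType) (mu_ : forall n, probability (E n) R)
  (mu : probability (prodE E) R).
Hypothesis hmu : is_product_measure mu_ mu.
Context d (T : measurableType d) (P : probability T R) (X X' : {RV P >-> prodE E}).
Hypotheses (hX : has_law X mu) (hX' : has_law X' mu) (hXX' : independent_RV X X').

Lemma mu_cyl N (A : forall i, set (E i)) : (forall i, measurable (A i)) ->
  (forall i, (N <= i)%N -> A i = setT) -> mu (cyl A) = \prod_(i < N) mu_ i (A i).
Proof.
move=> mA AN; rewrite -hmu//; congr (mu _).
apply/seteqP; split => [x Ax i _|x Ax i]; first exact: Ax.
by case: (ltnP i N) => [/Ax//|/AN ->].
Qed.

Lemma measurable_resample k : measurable_fun setT (resample X X' k).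
Proof.
apply: measurable_prodE => j; rewrite /resample.
case: (j == k); apply: (@measurableT_comp _ _ _ _ _ _ (fun x : prodE E => x j)) => //;
  exact: measurable_coord.
Qed.

Lemma P_law (Y : {RV P >-> prodE E}) A : has_law Y mu -> measurable A ->
  P (Y @^-1` A) = mu A.
Proof. by move=> hY mA; rewrite -hY. Qed.

Lemma measurable_preimage d' (U : measurableType d') (Y : T -> U) A :
  measurable_fun setT Y -> measurable A -> measurable (Y @^-1` A).
Proof. by move=> mY mA; rewrite -[X in measurable X]setTI; exact: mY. Qed.

(** Joint law of X and X^(k) on cylinders: coordinate k is drawn twice independently, the others are
    shared. The value is symmetric in [A] and [B], which is the source of exchangeability. *)
Lemma P_cyl_resample k N (A B : forall i, set (E i)) :
  (forall i, measurable (A i)) -> (forall i, measurable (B i)) ->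
  (forall i, (N <= i)%N -> A i = setT) -> (forall i, (N <= i)%N -> B i = setT) ->
  (k < N)%N ->
  P (X @^-1` cyl A `&` resample X X' k @^-1` cyl B) =
  \prod_(i < N) (if i == k :> nat then mu_ i (A i) * mu_ i (B i)
                 else mu_ i (A i `&` B i)).
Proof.
move=> mA mB AN BN kN.
(* [C] collects the constraints on [X], [D] the single one on [X']. *)
pose C i := if i == k then A i else A i `&` B i.
pose D i := if i == k then B i else setT.
have mC i : measurable (C i) by rewrite /C; case: ifP => // _; exact: measurableI.
have mD i : measurable (D i) by rewrite /D; case: ifP.
have CN i : (N <= i)%N -> C i = setT.
  by move=> Ni; rewrite /C AN// BN// setTI; case: ifP.
have DN i : (N <= i)%N -> D i = setT.
  by move=> Ni; rewrite /D BN//; case: ifP.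
rewrite (_ : _ `&` _ = X @^-1` cyl C `&` X' @^-1` cyl D); last first.
  apply/seteqP; split => w /= [].
    move=> Aw Bw; split => i; have := Bw i; rewrite /C /D /resample.
      by case: ifP => _ Bi; [exact: Aw|split => //; exact: Aw].
    by case: ifP.
  move=> Cw Dw; split => i; have := Cw i; have := Dw i; rewrite /C /D /resample.
    by case: ifP => // _ _ [].
  by case: ifP => // _ _ [].
rewrite hXX'; [|exact: measurable_cyl..].
rewrite !P_law//; [|exact: measurable_cyl..].
rewrite (mu_cyl mC CN) (mu_cyl mD DN) -big_split/=.
apply: eq_bigr => i _; rewrite /C /D; case: ifP => // _.
by rewrite probability_setT mule1.
Qed.

Lemma cylinders_bound2 (A B : set (prodE E)) k : cylinders A -> cylinders B ->
  exists A' B' N, [/\ forall i, measurable (A' i), forall i, measurable (B' i),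
    A = cyl A', B = cyl B' & [/\ (k < N)%N, forall i, (N <= i)%N -> A' i = setT
    & forall i, (N <= i)%N -> B' i = setT]].
Proof.
move=> [A' [mA [N AN] ->]] [B' [mB [M BM] ->]].
exists A', B', (maxn k.+1 (maxn N M)); split => //; split.
- by rewrite leq_max ltnSn.
- by move=> i; rewrite !geq_max => /and3P[_ Ni _]; exact: AN.
- by move=> i; rewrite !geq_max => /and3P[_ _ Mi]; exact: BM.
Qed.

Lemma P_exchange k A B : measurable A -> measurable B ->
  P (X @^-1` A `&` resample X X' k @^-1` B) =
  P (resample X X' k @^-1` A `&` X @^-1` B).
Proof.
have mR := measurable_resample k.
have mX : measurable_fun setT X by [].
have step A0 B0 : cylinders A0 -> cylinders B0 ->
    P (X @^-1` A0 `&` resample X X' k @^-1` B0) =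
    P (resample X X' k @^-1` A0 `&` X @^-1` B0).
  move=> cA cB.
  have [A' [B' [N [mA mB -> -> [kN AN BN]]]]] := cylinders_bound2 k cA cB.
  rewrite (P_cyl_resample mA mB AN BN kN) setIC (P_cyl_resample mB mA BN AN kN).
  by apply: eq_bigr => i _; case: ifP => _; [rewrite muleC|rewrite setIC].
(* From cylinders to measurable sets in the first argument, and afterwards in the second. *)
have step2 A0 B0 : measurable A0 -> cylinders B0 ->
    P (X @^-1` A0 `&` resample X X' k @^-1` B0) =
    P (resample X X' k @^-1` A0 `&` X @^-1` B0).
  move=> mA0 cB.
  have mB0 : measurable B0 by rewrite sigma_cylinders; exact: sub_sigma_algebra.
  apply: (probability_preimage_eq (sigma_cylinders E) (@cylinders_setI _ E) (cylindersT E)) => //.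
  - exact: measurable_preimage.
  - exact: measurable_preimage.
  - by move=> A1 cA; exact: step.
move=> mA mB; rewrite [in LHS]setIC [in RHS]setIC.
apply: (probability_preimage_eq (sigma_cylinders E) (@cylinders_setI _ E) (cylindersT E)) => //.
- exact: measurable_preimage.
- exact: measurable_preimage.
- by move=> B1 cB; rewrite [in LHS]setIC step2// setIC.
Qed.

Lemma resample_law k A : measurable A -> P (resample X X' k @^-1` A) = mu A.
Proof.
move=> mA; have := P_exchange k mA measurableT.
by rewrite !preimage_setT !setIT => <-; exact: P_law.
Qed.

Definition pairX k (w : T) : prodE E * prodE E := (X w, resample X X' k w).
Definition pairX_swap k (w : T) : prodE E * prodE E := (resample X X' k w, X w).

Lemma measurable_pairX k : measurable_fun setT (pairX k).
Proof. by apply: measurable_fun_pair => //; exact: measurable_resample. Qed.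

Lemma measurable_pairX_swap k : measurable_fun setT (pairX_swap k).
Proof. by apply: measurable_fun_pair => //; exact: measurable_resample. Qed.

Lemma pairX_exchange k A : measurable A ->
  P (pairX k @^-1` A) = P (pairX_swap k @^-1` A).
Proof.
move=> mA; rewrite -[pairX k @^-1` A]setIT -[pairX_swap k @^-1` A]setIT.
apply: (@probability_preimage_eq _ _ _ P _ _
  [set A `*` B | A in measurable & B in measurable]) => //.
- exact: measurable_prod_measurableType.
- move=> _ _ [A1 mA1 [B1 mB1 <-]] [A2 mA2 [B2 mB2 <-]].
  exists (A1 `&` A2); first exact: measurableI.
  exists (B1 `&` B2); first exact: measurableI.
  by rewrite setXI.
- by exists setT => //; exists setT => //; rewrite setXTT.
- exact: measurable_pairX.
- exact: measurable_pairX_swap.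
- by move=> _ [A1 mA1 [B1 mB1 <-]]; rewrite !setIT; exact: P_exchange.
Qed.

Lemma expectation_exchange k (psi : prodE E * prodE E -> R) :
  measurable_fun setT psi ->
  'E_P[fun w => psi (X w, resample X X' k w)] =
  'E_P[fun w => psi (resample X X' k w, X w)].
Proof.
move=> mpsi.
exact: (expectation_comp_eq (measurable_pairX k) (measurable_pairX_swap k) mpsi
  (@pairX_exchange k)).
Qed.

End resampling.

Section independence.
Context d (T : measurableType d) (R : realType) (P : probability T R).
Local Open Scope ring_scope.

(** Independence expressed as a constant conditional expectation; the factorization of E[1_D Y] is
    then the pull-out property. *)
Lemma is_cond_exp_indep (G : set (set T)) (Gm : G `<=` measurable) (D : set T) :
  measurable D ->
  (forall C, <<s G >> C -> (P (C `&` D) = P D * P C)%E) ->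
  is_cond_exp P G \1_D (cst (fine (P D))).
Proof.
move=> mD H; split.
- exact: measurable_cst.
- by apply: L1_integrable; exact: Lfun_cst.
- move=> C sC; have mC := sub_sigma_measurable Gm sC.
  rewrite (eq_integral (cst (P D))); last first.
    by move=> w _ /=; rewrite fineK// fin_num_measure.
  by rewrite integral_cst// integral_indic// setIC; apply/esym/H.
Qed.

Lemma Ex_indicM_indep (G : set (set T)) (Gm : G `<=` measurable) (D : set T) Y :
  measurable D ->
  (forall C, <<s G >> C -> (P (C `&` D) = P D * P C)%E) ->
  measurable_wrt G Y -> Y \in Lfun P 1 ->
  Ex P (fun w => \1_D w * Y w) = fine (P D) * Ex P Y.
Proof.
move=> mD H mY LY; have LD : (\1_D : T -> R) \in Lfun P 1.
  by apply/Lfun1_integrable; exact: integrable_indic.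
rewrite (cond_exp_pullout Gm LD (is_cond_exp_indep Gm mD H) mY) ?ExZ//.
  by under eq_fun do rewrite mulrC; exact: L1_indicM.
exact: L1_scale.
Qed.

Lemma measurable_wrt_preimage d' (U : measurableType d') (Y : T -> U)
    (psi : U -> R) : measurable_fun setT psi ->
  measurable_wrt (g_sigma_algebra_preimage Y) (psi \o Y).
Proof.
move=> mpsi _ B mB; rewrite setTI comp_preimage; apply: sub_sigma_algebra.
exists (psi @^-1` B); last by rewrite setTI.
by rewrite -[X in measurable X]setTI; exact: mpsi.
Qed.

Lemma sigma_preimage d' (U : measurableType d') (Y : T -> U) C :
  <<s g_sigma_algebra_preimage Y >> C -> exists2 C0, measurable C0 & C = Y @^-1` C0.
Proof.
rewrite sigma_algebra_id; first by move=> [C0 mC0 <-]; exists C0; rewrite ?setTI.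
by apply: sigma_algebra_preimage; exact: sigma_algebra_measurable.
Qed.

Lemma preimage_sub_measurable d' (U : measurableType d') (Y : T -> U) :
  measurable_fun setT Y -> g_sigma_algebra_preimage Y `<=` measurable.
Proof. by move=> mY _ [B mB <-]; exact: mY. Qed.

End independence.

(** * Conditioning on all coordinates but one *)

Section resampling_conditional_expectation.
Context (dE : nat -> measure_display) (E : forall n, measurableType (dE n)).
Context (R : realType) (mu_ : forall n, probability (E n) R)
  (mu : probability (prodE E) R).
Hypothesis hmu : is_product_measure mu_ mu.
Context d (T : measurableType d) (P : probability T R) (X X' : {RV P >-> prodE E}).
Hypotheses (hX : has_law X mu) (hX' : has_law X' mu) (hXX' : independent_RV X X').
Variable k : nat.
Local Open Scope ring_scope.
Let Rk := resample X X' k.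
Let Gk : set (set T) := sigma_coords X [set j | j <> k].
Let mRk : measurable_fun setT Rk := measurable_resample X X' k.

Lemma measurable_X : measurable_fun setT (X : T -> prodE E).
Proof. by []. Qed.

Lemma sigma_coords_sub M : sigma_coords X M `<=` sigmaX X.
Proof.
apply: smallest_sub.
  by apply: sigma_algebra_preimage; exact: sigma_algebra_measurable.
move=> _ [j _ [B mB <-]]; exists ((fun x : prodE E => x j) @^-1` B) => //.
by rewrite -[X in measurable X]setTI; exact: measurable_coord.
Qed.

Lemma sigmaX_measurable : sigmaX X `<=` measurable.
Proof. exact: preimage_sub_measurable measurable_X. Qed.

Lemma sigma_coords_measurable M : sigma_coords X M `<=` measurable.
Proof. by move=> A /sigma_coords_sub; exact: sigmaX_measurable. Qed.

Lemma sigma_sigma_coords M : <<s sigma_coords X M >> = sigma_coords X M.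
Proof. by apply: sigma_algebra_id; exact: smallest_sigma_algebra. Qed.

Lemma sub_sigma_sigmaX M : <<s sigma_coords X M >> `<=` <<s sigmaX X >>.
Proof. by rewrite sigma_sigma_coords => A /sigma_coords_sub; exact: sub_sigma_algebra. Qed.

Lemma measurable_wrt_sigmaX M (Y : T -> R) :
  measurable_wrt (sigma_coords X M) Y -> measurable_wrt (sigmaX X) Y.
Proof. by move=> mY _ B mB; apply: (@sub_sigma_sigmaX M); exact: mY. Qed.

(** X and X^(k) agree off coordinate k, so the same [C0] describes the event through either of them.
    The sets with this property form a sigma-algebra that contains the generators. *)
Lemma sigma_coords_resample C : Gk C ->
  exists2 C0, measurable C0 & C = X @^-1` C0 /\ C = Rk @^-1` C0.
Proof.
pose CC : set (set T) :=
  [set C | exists2 C0, measurable C0 & C = X @^-1` C0 /\ C = Rk @^-1` C0].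
suff: Gk `<=` CC by apply.
clear C.
apply: smallest_sub; last first.
  move=> _ [j /= jk [B mB <-]]; exists ((fun x : prodE E => x j) @^-1` B).
    by rewrite -[X in measurable X]setTI; exact: measurable_coord.
  rewrite !setTI; split => //; have /negbTE jk' : j != k by exact/eqP.
  by apply/seteqP; split => w; rewrite /Rk /resample /= jk'.
split.
- by exists set0 => //; rewrite !preimage_set0.
- move=> A [C0 mC0 [E1 E2]]; exists (~` C0); first exact: measurableC.
  by rewrite setTD; split; [rewrite E1|rewrite E2]; rewrite preimage_setC.
- move=> F CF; have /choice[F0 HF0] : forall n, exists C0,
      measurable C0 /\ F n = X @^-1` C0 /\ F n = Rk @^-1` C0.
    by move=> n; have [C0 mC0 e] := CF n; exists C0.
  exists (\bigcup_n F0 n); first by apply: bigcupT_measurable => n; exact: (HF0 n).1.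
  rewrite !preimage_bigcup; split.
    by apply: eq_bigcupr => n _; exact: (HF0 n).2.1.
  by apply: eq_bigcupr => n _; exact: (HF0 n).2.2.
Qed.

Section coordinate_event.
Variable B : forall i, set (E i).
Arguments B : clear implicits.
Hypothesis mB : forall i, measurable (B i).
Let D : set T := [set w | B k (X w k)].
Let Bk i : set (E i) := if i == k then B i else setT.
Arguments Bk : clear implicits.

Lemma coordinate_eventE : D = X @^-1` cyl Bk.
Proof.
apply/seteqP; split => w.
  by move=> Dw i; rewrite /Bk; case: eqP => // ->.
by move/(_ k); rewrite /Bk eqxx.
Qed.

Let mBk i : measurable (Bk i). Proof. by rewrite /Bk; case: ifP. Qed.

Lemma measurable_coordinate_event : measurable D.
Proof.
rewrite coordinate_eventE; apply: (measurable_preimage measurable_X).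
exact: measurable_cyl.
Qed.

(** The coordinates of X^(k) are X'_k and the X_j with j <> k, and X_k is independent of all of them
    jointly. *)
Lemma coordinate_event_indep_resample A : measurable A ->
  (P (Rk @^-1` A `&` D) = P D * P (Rk @^-1` A))%E.
Proof.
move: A; apply: (probability_preimage_indep (sigma_cylinders E)
  (@cylinders_setI _ E) (cylindersT E)) => //.
  exact: measurable_coordinate_event.
move=> _ [A [mA [N AN] ->]].
pose M := maxn k.+1 N.
have kM : (k < M)%N by rewrite leq_max ltnSn.
have AM i : (M <= i)%N -> A i = setT by rewrite geq_max => /andP[_]; exact: AN.
have BM i : (M <= i)%N -> Bk i = setT.
  rewrite /Bk geq_max => /andP[ki _]; case: eqP => // ik.
  by move: ki; rewrite ik ltnn.
rewrite coordinate_eventE setIC.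
rewrite (P_cyl_resample hmu hX hX' hXX' mBk mA BM AM kM).
rewrite (resample_law hmu hX hX' hXX')//; last exact: measurable_cyl.
rewrite (P_law hX); last exact: measurable_cyl.
rewrite (mu_cyl hmu mA AM) (mu_cyl hmu mBk BM) -big_split/=.
apply: eq_bigr => i _; rewrite /Bk; case ik : (i == k :> nat) => //.
by rewrite setTI probability_setT mul1e.
Qed.

(** An event of G_k can be read off X^(k) instead of X. *)
Lemma coordinate_event_indep_sigma C : <<s Gk >> C ->
  (P (C `&` D) = P D * P C)%E.
Proof.
rewrite sigma_sigma_coords => /sigma_coords_resample[C0 mC0 [_ ->]].
exact: coordinate_event_indep_resample.
Qed.

End coordinate_event.

Lemma cyl_in_sigma_coords (A : forall i, set (E i)) :
  (forall i, measurable (A i)) -> A k = setT -> <<s Gk >> (X @^-1` cyl A).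
Proof.
move=> mA Ak.
rewrite (_ : _ @^-1` _ = \bigcap_i (fun w => X w i) @^-1` A i); last first.
  by apply/seteqP; split => [w Aw i _|w Aw i]; [exact: Aw|exact: (Aw i I)].
apply: (@bigcapT_measurable _ (g_sigma_algebraType Gk)) => i.
have [->|ik] := eqVneq i k; first by rewrite Ak preimage_setT; exact: measurableT.
(* Twice, because [Gk] is itself a generated sigma-algebra. *)
apply: sub_sigma_algebra; apply: sub_sigma_algebra.
exists i; first exact/eqP.
by exists (A i) => //; rewrite setTI.
Qed.

Lemma Ex_resample (psi : prodE E -> R) : measurable_fun setT psi ->
  'E_P[psi \o Rk] = 'E_P[psi \o X].
Proof.
move=> mpsi; apply: expectation_comp_eq => // A mA.
by rewrite (resample_law hmu hX hX' hXX')// (P_law hX).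
Qed.

Lemma L1_resample (psi : prodE E -> R) : measurable_fun setT psi ->
  psi \o X \in Lfun P 1 -> psi \o Rk \in Lfun P 1.
Proof.
move=> mpsi /L1_integrable/integrableP[_ fin]; apply/Lfun1_integrable/integrableP.
split; first by apply/measurable_EFinP; exact: measurableT_comp.
have := @Ex_resample (fun x => `|psi x|) _.
by rewrite !expectationE /= => ->//; exact: measurableT_comp.
Qed.

Lemma L2_resample (psi : prodE E -> R) : measurable_fun setT psi ->
  psi \o X \in Lfun P 2%:E -> psi \o Rk \in Lfun P 2%:E.
Proof.
move=> mpsi L; apply: L2P; first exact: measurableT_comp.
apply: (@L1_resample (fun x => psi x ^+ 2)); last exact: L2_sqr.
exact: measurable_funX.
Qed.

(* Averaging over the resampled coordinate is conditioning on the others. *)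
Lemma cond_exp_resample (g : prodE E -> R) (H : T -> R) :
  measurable_fun setT g -> g \o X \in Lfun P 1 ->
  is_cond_exp P Gk (g \o X) H -> is_cond_exp P (sigmaX X) (g \o Rk) H.
Proof.
move=> mg LgX HgX; have [mH _ EH] := HgX; have LH := cond_exp_L1 HgX.
have Gkm := @sigma_coords_measurable [set j | j <> k].
have LgR := L1_resample mg LgX.
have LW : (g \o Rk) \- H \in Lfun P 1 by exact: L1_B.
have mHT := measurable_wrt_measurable Gkm mH.
split; [exact: measurable_wrt_sigmaX mH|exact: L1_integrable|].
suff Z A : measurable A -> (\int[P]_(w in X @^-1` A) (((g \o Rk) \- H) w)%:E = 0)%E.
  move=> C /sigma_preimage[A mA ->].
  have mC : measurable (X @^-1` A) by exact: (measurable_preimage measurable_X).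
  have := Z _ mA; rewrite integralB_EFin//; [move/eqP|..].
  - rewrite sube_eq ?add0e; [by move/eqP|..].
      by apply: integrable_fin_num => //; apply: (integrableS measurableT) => //; exact: L1_integrable.
    by rewrite fin_num_adde_defr// integrable_fin_num//;
      apply: (integrableS measurableT) => //; exact: L1_integrable.
  - by apply: (integrableS measurableT) => //; exact: L1_integrable.
  - by apply: (integrableS measurableT) => //; exact: L1_integrable.
move: A; apply: (integral_preimage_eq0 (sigma_cylinders E) (@cylinders_setI _ E)
  (cylindersT E) measurable_X LW).
move=> _ [A [mA _ ->]].
(* Dropping the constraint on coordinate k splits {X in cyl A} into [D], an event of X_k, and [C],
   an event of G_k. *)
pose A' i : set (E i) := if i == k then setT else A i.
have mA' i : measurable (A' i) by rewrite /A'; case: ifP.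
have A'k : A' k = setT by rewrite /A' eqxx.
pose C := X @^-1` cyl A'; pose D : set T := [set w | A k (X w k)].
have mD : measurable D := measurable_coordinate_event mA.
have CR : C = Rk @^-1` cyl A'.
  apply/seteqP; split => w Cw i; have := Cw i; rewrite /A' /Rk /resample;
    by case: ifP.
have sC : <<s Gk >> C by exact: cyl_in_sigma_coords.
have mC := sub_sigma_measurable Gkm sC.
have indE : (\1_(X @^-1` cyl A) : T -> R) = (fun w => \1_D w * \1_C w).
  apply/funext => w; rewrite -[RHS]/((\1_D \* \1_C) w) -indicI; congr (\1__ w).
  apply/seteqP; split => w' /=.
    by move=> Aw; split; [exact: Aw|move=> i; rewrite /A'; case: ifP].
  by move=> [Dw Cw] i; have := Cw i; rewrite /A'; case: eqP => // ->.
have L1C Y : Y \in Lfun P 1 -> (fun w => Y w * \1_C w) \in Lfun P 1.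
  exact: L1_indicM.
have LA : (fun w => ((g \o Rk) \- H) w * \1_(X @^-1` cyl A) w) \in Lfun P 1.
  by apply: L1_indicM => //; exact: (measurable_preimage measurable_X (measurable_cyl mA)).
rewrite integral_indicM -expectationE (ExE LA) indE.
congr (_%:E).
rewrite (_ : (fun w => _) = (fun w => \1_D w * (g (Rk w) * \1_C w)) \-
   (fun w => \1_D w * (H w * \1_C w))); last by apply/funext => w /=; ring.
have DL Y : Y \in Lfun P 1 -> (fun w => \1_D w * Y w) \in Lfun P 1.
  move=> LY; apply: (@L1_boundedM _ _ _ _ _ _ 1) => // w.
  by rewrite indicE; case: (w \in D); rewrite ?normr1 ?normr0.
rewrite ExB; [|by apply: DL; exact: L1C..].
have LgC : (fun w => g (Rk w) * \1_C w) \in Lfun P 1 by exact: (L1C (g \o Rk)).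
pose psi x := g x * \1_(cyl A') x.
have mpsi : measurable_fun setT psi.
  by apply: measurable_funM => //; apply: measurable_indic; exact: measurable_cyl.
have psiR : (fun w => g (Rk w) * \1_C w) = psi \o Rk.
  by apply/funext => w; rewrite /psi CR.
(* The indicator of [D] factors out of both expectations: [D] is independent of X^(k) in the first
   and of G_k in the second. *)
rewrite (@Ex_indicM_indep _ _ _ P (g_sigma_algebra_preimage Rk)) //; last 3 first.
- exact: preimage_sub_measurable.
- by move=> C1 /sigma_preimage[A1 mA1 ->]; exact: coordinate_event_indep_resample.
- by rewrite psiR; exact: measurable_wrt_preimage.
rewrite (@Ex_indicM_indep _ _ _ P Gk) //; last 3 first.
- by move=> C1; exact: coordinate_event_indep_sigma.
- apply: measurable_funM => //; apply: measurable_indic; exact: sC.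
- exact: L1C.
(* It remains to see that E[g(X^(k)) 1_C] = E[H 1_C]. Since [C] is the preimage of [cyl A'] under
   both X and X^(k), equality of laws turns the left side into E[g(X) 1_C]. *)
apply/eqP; rewrite subr_eq0; apply/eqP; congr (_ * _).
rewrite psiR /Ex Ex_resample//; congr fine.
transitivity 'E_P[fun w => (g (X w) * \1_C w)%R]; first by [].
by rewrite !expectationE -!integral_indicM EH.
Qed.

(** [H] may be replaced by g(X^(k)), whose conditional expectation given X it is. The exchange of X
    and X^(k) shows that E[psi(X) (g(X) - g(X^(k)))] equals its copy with X and X^(k) swapped; the
    two copies add up to the product of the differences, hence the factor 1/2. *)
Lemma Ex_mul_Dk (psi g : prodE E -> R) (H : T -> R) :
  measurable_fun setT psi -> measurable_fun setT g ->
  psi \o X \in Lfun P 2%:E -> g \o X \in Lfun P 2%:E ->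
  is_cond_exp P Gk (g \o X) H ->
  Ex P (fun w => psi (X w) * (g (X w) - H w)) =
  2^-1 * Ex P (fun w => Delta X X' k psi w * Delta X X' k g w).
Proof.
move=> mpsi mg Lpsi Lg HgX; have Gkm := @sigma_coords_measurable [set j | j <> k].
have LH := cond_exp_L2 Gkm Lg HgX.
have LpsiR := L2_resample mpsi Lpsi; have LgR := L2_resample mg Lg.
have HR := cond_exp_resample mg (L2_L1 Lg) HgX.
have E1 : Ex P (fun w => H w * psi (X w)) = Ex P (fun w => g (Rk w) * psi (X w)).
  apply/esym; apply: (cond_exp_pullout sigmaX_measurable (L2_L1 LgR) HR).
  - exact: (measurable_wrt_preimage (Y := X) mpsi).
  - exact: (L2M LgR Lpsi).
  - exact: (L2M LH Lpsi).
have E2 : Ex P (fun w => psi (X w) * (g (X w) - g (Rk w))) =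
          Ex P (fun w => psi (Rk w) * (g (Rk w) - g (X w))).
  congr fine; apply: (@expectation_exchange _ _ _ _ _ hmu _ _ _ _ _ hX hX' hXX' k
    (fun z => psi z.1 * (g z.1 - g z.2))).
  apply: measurable_funM; first exact: measurableT_comp.
  by apply: measurable_funB; exact: measurableT_comp.
have L3 : (fun w => psi (X w) * (g (X w) - g (Rk w))) \in Lfun P 1.
  exact: (L2M Lpsi (L2_B Lg LgR)).
have L4 : (fun w => psi (Rk w) * (g (Rk w) - g (X w))) \in Lfun P 1.
  exact: (L2M LpsiR (L2_B LgR Lg)).
have -> : (fun w => Delta X X' k psi w * Delta X X' k g w) =
    (fun w => psi (X w) * (g (X w) - g (Rk w))) \+
    (fun w => psi (Rk w) * (g (Rk w) - g (X w))).
  by apply/funext => w; rewrite /Delta /= -/(Rk w); ring.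
rewrite ExD// -E2.
transitivity (Ex P (fun w => psi (X w) * (g (X w) - g (Rk w)))); last by lra.
rewrite (_ : (fun w => _) = (fun w => psi (X w) * g (X w)) \- (fun w => H w * psi (X w))); last first.
  by apply/funext => w /=; ring.
rewrite ExB; [|exact: (L2M Lpsi Lg)|exact: (L2M LH Lpsi)].
rewrite E1 -ExB; [|exact: (L2M Lpsi Lg)|exact: (L2M LgR Lpsi)].
by congr Ex; apply/funext => w /=; ring.
Qed.

End resampling_conditional_expectation.

(** * Monotonicity and derivatives *)

Section calculus.
Context (R : realType).
Local Open Scope ring_scope.
Implicit Types (f g : R -> R) (x y a : R).

Lemma derD f g x df dg : is_derive x 1 f df -> is_derive x 1 g dg ->
  is_derive x 1 (fun t => f t + g t) (df + dg).
Proof. by move=> ? ?; exact: is_deriveD. Qed.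

Lemma derB f g x df dg : is_derive x 1 f df -> is_derive x 1 g dg ->
  is_derive x 1 (fun t => f t - g t) (df - dg).
Proof. by move=> ? ?; exact: is_deriveB. Qed.

Lemma derN f x df : is_derive x 1 f df -> is_derive x 1 (fun t => - f t) (- df).
Proof. by move=> ?; exact: is_deriveN. Qed.

Lemma derM f g x df dg : is_derive x 1 f df -> is_derive x 1 g dg ->
  is_derive x 1 (fun t => f t * g t) (df * g x + f x * dg).
Proof.
move=> ? ?; apply: (@is_derive_eq _ _ _ (f * g)).
by rewrite /GRing.scale /= addrC [g x * df]mulrC.
Qed.

Lemma derC a x : is_derive x 1 (fun=> a) 0.
Proof. exact: is_derive_cst. Qed.

Lemma derI x : is_derive x 1 (fun t : R => t) 1.
Proof. exact: is_derive_id. Qed.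

Lemma derV f x df : f x != 0 -> is_derive x 1 f df ->
  is_derive x 1 (fun t => (f t)^-1) (- df / f x ^+ 2).
Proof.
move=> fx0 [dfx <-]; apply: DeriveDef; first exact: derivableV.
by rewrite deriveV// /GRing.scale /= mulrC mulrN mulNr.
Qed.

Lemma derExp f x df : is_derive x 1 f df ->
  is_derive x 1 (fun t => expR (f t)) (expR (f x) * df).
Proof.
by move=> dfx; apply: (is_derive_eq (is_derive1_comp (is_derive_expR (f x)) dfx)).
Qed.

Lemma der_eq f x df df' : is_derive x 1 f df -> df = df' -> is_derive x 1 f df'.
Proof. by move=> ? <-. Qed.

Lemma der_continuous f x df : is_derive x 1 f df -> {for x, continuous f}.
Proof. by move=> [dfx _]; apply/differentiable_continuous/derivable1_diffP. Qed.

Lemma MVT_closed f df x y : x <= y ->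
  (forall t, x <= t <= y -> is_derive t 1 f (df t)) ->
  exists2 c, x <= c <= y & f y - f x = df c * (y - x).
Proof.
move=> xy H; have [||c] := @MVT_segment _ f df x y xy.
- by move=> t; rewrite in_itv/= => /andP[/ltW ? /ltW ?]; apply: H; apply/andP.
- apply: derivable_within_continuous => t; rewrite in_itv/= => /H[] //.
- by rewrite in_itv/= => ? ?; exists c.
Qed.

Lemma der_ge0_le f df x y : x <= y ->
  (forall t, x <= t <= y -> is_derive t 1 f (df t)) ->
  (forall t, x <= t <= y -> 0 <= df t) -> f x <= f y.
Proof.
move=> xy H df0; have [c cxy E] := MVT_closed xy H.
by rewrite -subr_ge0 E mulr_ge0 ?df0// subr_ge0.
Qed.

Lemma der_le0_ge f df x y : x <= y ->
  (forall t, x <= t <= y -> is_derive t 1 f (df t)) ->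
  (forall t, x <= t <= y -> df t <= 0) -> f y <= f x.
Proof.
move=> xy H df0; have [c cxy E] := MVT_closed xy H.
by rewrite -subr_le0 E mulr_le0_ge0 ?df0// subr_ge0.
Qed.

Lemma der_bounded_lipschitz f (df : R -> R) (C : R) : (forall t : R, is_derive t 1 f (df t)) ->
  (forall t, `|df t| <= C) -> forall x y, `|f x - f y| <= C * `|x - y|.
Proof.
move=> H dfC x y; wlog xy : x y / x <= y.
  by move=> W; have [/W//|/ltW/W] := leP x y; rewrite distrC [`|y - x|]distrC.
have [c _ E] := MVT_closed xy (fun t _ => H t).
by rewrite distrC E normrM [`|x - y|]distrC ler_wpM2r.
Qed.

Lemma lipschitz_measurable (phi : R -> R) (C : R) :
  (forall x y, `|phi x - phi y| <= C * `|x - y|) -> measurable_fun setT phi.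
Proof.
move=> phiC; apply: continuous_measurable_fun => x.
have C0 : 0 <= C.
  by have := le_trans (normr_ge0 _) (phiC 1 0); rewrite subr0 normr1 mulr1.
apply/cvgrPdist_le => e e0.
(* [C + 1] instead of [C], which may be 0. *)
have eC : 0 < e / (C + 1) by rewrite divr_gt0// ltr_wpDl.
near=> y; apply: (le_trans (phiC _ _)).
apply: (@le_trans _ _ (C * (e / (C + 1)))).
  rewrite ler_wpM2l//; near: y.
rewrite mulrA ler_pdivrMr ?ltr_wpDl// mulrDr mulr1 mulrC lerDl ltW//.
Unshelve. all: by end_near. Qed.

End calculus.

(** * The Malliavin derivative *)

Section malliavin_derivative.
Context (dE : nat -> measure_display) (E : forall n, measurableType (dE n)).
Context (R : realType) d (T : measurableType d) (P : probability T R)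
  (X : {RV P >-> prodE E}).
Local Open Scope ring_scope.
Let G k : set (set T) := sigma_coords X [set j | j <> k].
Let Gm k : G k `<=` measurable.
Proof. exact: sigma_coords_measurable. Qed.

Lemma L2X_measurable F : L2X X F -> measurable_fun setT F.
Proof. by case=> mF _; exact: (measurable_wrt_measurable (@sigmaX_measurable _ _ _ _ _ _ X) mF). Qed.

Lemma Dk_cond_exp k F : F \in Lfun P 2%:E ->
  is_cond_exp P (G k) F (cond_exp P (G k) F).
Proof. by move=> LF; apply: (cond_expP (@Gm k)); exact: L2_L1. Qed.

Lemma L2X_Dk k F : L2X X F -> L2X X (Dk X k F).
Proof.
move=> [mF LF]; have H := Dk_cond_exp k LF; split.
  apply: measurable_wrtB => //.
  by case: H => mH _ _; exact: (measurable_wrt_sigmaX mH).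
by apply: L2_B => //; exact: (cond_exp_L2 (@Gm k) LF H).
Qed.

Lemma Dk_contraction k F H : L2X X F -> L2X X H ->
  Ex P (fun w => (Dk X k F w - Dk X k H w) ^+ 2) <=
  Ex P (fun w => (F w - H w) ^+ 2).
Proof.
move=> [_ LF] [_ LH].
exact: (cond_exp_contraction (@Gm k) LF LH (Dk_cond_exp k LF) (Dk_cond_exp k LH)).
Qed.

Lemma L2X_lipschitz (phi : R -> R) (C : R) F : measurable_fun setT phi ->
  (forall x y, `|phi x - phi y| <= C * `|x - y|) ->
  L2X X F -> L2X X (phi \o F).
Proof.
move=> mphi phiC LF; have mF := L2X_measurable LF; have [mwF L2F] := LF.
split; first exact: measurable_wrt_comp.
have -> : phi \o F = (fun w => phi (F w) - phi 0) \+ cst (phi 0).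
  by apply/funext => w /=; rewrite subrK.
apply: L2_D; last exact: Lfun_cst.
apply: (L2_le (k := C) _ _ L2F) => [|w]; last by rewrite (le_trans (phiC _ _))// subr0.
by apply: measurable_funB => //; exact: measurableT_comp.
Qed.

Lemma Dk_lipschitz k (phi : R -> R) (C : R) F : measurable_fun setT phi ->
  (forall x y, `|phi x - phi y| <= C * `|x - y|) -> L2X X F ->
  Ex P (fun w => Dk X k (phi \o F) w ^+ 2) <=
  C ^+ 2 * Ex P (fun w => Dk X k F w ^+ 2).
Proof.
move=> mphi phiC LF; have [_ Lphi] := L2X_lipschitz mphi phiC LF; have [_ L] := LF.
exact: (cond_exp_lipschitz (@Gm k) mphi phiC L Lphi (Dk_cond_exp k L) (Dk_cond_exp k Lphi)).
Qed.

Lemma Ex_sqrD_le Y Z : Y \in Lfun P 2%:E -> Z \in Lfun P 2%:E ->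
  Ex P (fun w => (Y w + Z w) ^+ 2) <=
  2 * Ex P (fun w => Y w ^+ 2) + 2 * Ex P (fun w => Z w ^+ 2).
Proof.
move=> LY LZ; rewrite -!ExZ ?L2_sqr//.
rewrite -ExD; [|by apply/L1_scale/L2_sqr..].
apply: Ex_le; first by apply/L2_sqr/L2_D.
  by apply: L1_D; apply/L1_scale/L2_sqr.
move=> w /=; rewrite -subr_ge0 (_ : _ - _ = (Y w - Z w) ^+ 2) ?sqr_ge0//; ring.
Qed.

Lemma Ex_sqr_ge0 Y : 0 <= Ex P (fun w => Y w ^+ 2).
Proof. by apply: Ex_ge0 => w; exact: sqr_ge0. Qed.

Lemma E_sqr Y : Y \in Lfun P 2%:E ->
  'E_P[fun w => Y w ^+ 2] = (Ex P (fun w => Y w ^+ 2))%:E.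
Proof. by move=> LY; rewrite ExE// L2_sqr. Qed.

(** The concrete form of closability: each D_k is continuous on L^2, so a limit in the graph agrees
    with D_k F in every component. *)
Lemma D_graph_Dk F u k : D_graph X F u ->
  {ae P, forall w, u k w = Dk X k F w}.
Proof.
move=> [LF [Lu _] appr]; have [_ LFk] := L2X_Dk k LF; have [_ Luk] := Lu k.
have LuD := L2_B Luk LFk.
suff Z : Ex P (fun w => (u k w - Dk X k F w) ^+ 2) = 0.
  by have := Ex_sqr_eq0 LuD Z; apply: filterS => w /eqP; rewrite subr_eq0 => /eqP.
apply/eqP; rewrite eq_le Ex_sqr_ge0 andbT; apply/ler_addgt0Pr => e e0.
(* Two errors of at most e / 4, each doubled by [Ex_sqrD_le]. *)
have e4 : 0 < e / 4 by rewrite divr_gt0.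
have [H [[LH _] FH uH]] := appr _ e4.
have [_ LHk] := L2X_Dk k LH; have [_ L2H] := LH; have [_ L2F] := LF.
have LuH := L2_B Luk LHk; have LHF := L2_B LHk LFk.
have c1 : Ex P (fun w => (u k w - Dk X k H w) ^+ 2) <= e / 4.
  rewrite -lee_fin -(E_sqr LuH); apply: le_trans (ltW uH).
  rewrite (@nneseriesD1 _ _ k)//; last by move=> n _; apply: expectation_ge0 => w; exact: sqr_ge0.
  by rewrite leeDl// nneseries_ge0// => n _ _; apply: expectation_ge0 => w; exact: sqr_ge0.
have c2 : Ex P (fun w => (Dk X k H w - Dk X k F w) ^+ 2) <= e / 4.
  apply: (le_trans (Dk_contraction k LH LF)).
  move: FH; rewrite (E_sqr (L2_B L2F L2H)) lte_fin => /ltW; apply: le_trans.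
  by rewrite le_eqVlt; apply/orP; left; apply/eqP; congr Ex; apply/funext => w /=; ring.
have := Ex_sqrD_le LuH LHF.
rewrite (_ : (fun w => (_ + _) ^+ 2) = (fun w => (u k w - Dk X k F w) ^+ 2)); last first.
  by apply/funext => w /=; congr (_ ^+ 2); ring.
lra.
Qed.

Lemma Ex_D_graph F u k : D_graph X F u ->
  Ex P (fun w => u k w ^+ 2) = Ex P (fun w => Dk X k F w ^+ 2).
Proof.
move=> D; have [LF [Lu _] _] := D; congr fine; apply: Ex_ae.
- by apply: measurable_funX; exact: (L2X_measurable (Lu k)).
- by apply: measurable_funX; exact: (L2X_measurable (L2X_Dk k LF)).
- by have := D_graph_Dk k D; apply: filterS => w ->.
Qed.

Lemma D_graph_sum F u : D_graph X F u ->
  (\sum_(0 <= k <oo) (Ex P (fun w => Dk X k F w ^+ 2))%:E < +oo)%E.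
Proof.
move=> D; have [_ [Lu uoo] _] := D.
rewrite (eq_eseriesr (g := fun k => 'E_P[fun w => u k w ^+ 2]))// => k _.
by rewrite -(Ex_D_graph k D) E_sqr//; exact: (Lu k).2.
Qed.

(** Allows F to be replaced by f(X), which is a function of X at every point, so that resampling can
    act on it. *)
Lemma D_graph_ae F F' u : D_graph X F u -> measurable_wrt (sigmaX X) F' ->
  {ae P, forall w, F w = F' w} -> D_graph X F' u.
Proof.
move=> [LF Lu appr] mF' FF'.
have mF'T := measurable_wrt_measurable (@sigmaX_measurable _ _ _ _ _ _ X) mF'.
have mF := L2X_measurable LF.
have LF' : L2X X F'.
  split => //; apply: L2P => //; apply: L1_ge0P; first exact: measurable_funX.
    by move=> w; exact: sqr_ge0.
  rewrite -(@Ex_ae _ _ _ _ (fun w => F w ^+ 2)); last 3 first.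
  - exact: measurable_funX.
  - exact: measurable_funX.
  - by apply: filterS FF' => w ->.
  by rewrite E_sqr ?ltry//; exact: LF.2.
split => // e /appr[H [fH FH uH]]; exists H; split => //.
have mH : measurable_fun setT H by case: fH => /L2X_measurable.
rewrite -(@Ex_ae _ _ _ _ (fun w => (F w - H w) ^+ 2))//.
- by apply: measurable_funX; exact: measurable_funB.
- by apply: measurable_funX; exact: measurable_funB.
- by apply: filterS FF' => w ->.
Qed.

(* The tail of the series is controlled by the contraction property, its first
   terms by the L^2-convergence of the approximants. *)
Lemma D_graph_lipschitz (phi : R -> R) (C : R) F u : measurable_fun setT phi ->
  (forall x y, `|phi x - phi y| <= C * `|x - y|) -> D_graph X F u ->
  D_graph X (phi \o F) (fun k => Dk X k (phi \o F)).
Proof.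
move=> mphi phiC D; have [LF [Lu uoo] appr] := D.
have LphiF := L2X_lipschitz mphi phiC LF.
pose a k := Ex P (fun w => Dk X k F w ^+ 2).
have a0 k : 0 <= a k by exact: Ex_sqr_ge0.
have aoo := D_graph_sum D.
pose K := C ^+ 2; have K0 : 0 <= K by exact: sqr_ge0.
have LDphi k := (L2X_Dk k LphiF).2.
split => //.
  split; first by move=> k; exact: L2X_Dk.
  apply: (@le_lt_trans _ _ (\sum_(0 <= k <oo) (K%:E * (a k)%:E))%E).
    apply: lee_nneseries => [k _ _|k _]; first by apply: expectation_ge0 => w; exact: sqr_ge0.
    by rewrite E_sqr// -EFinM lee_fin; exact: Dk_lipschitz.
  by rewrite nneseriesZl => [|k _]; rewrite ?lte_mul_pinfty ?lee_fin.
move=> e e0.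
(* [e1] and, further down, [dl] are such that the head N K dl and the tail 6 K e1 + 4 K dl of the
   final series add up to less than e; the summands 1 keep the denominators positive. *)
pose e1 := e / (4 * (6 * K + 1)).
have e10 : 0 < e1 by rewrite divr_gt0// mulr_gt0// ltr_wpDl// mulr_ge0.
have [N tailN] : exists N, (\sum_(N <= k <oo) (a k)%:E <= e1%:E)%E.
  have := @nneseries_tail_cvg _ (fun k => (a k)%:E) xpredT aoo (fun k _ => a0 k).
  move=> /fine_cvgP[fin /cvgrPdist_le /(_ _ e10)] [M2 _ H2].
  have [M1 _ H1] := fin; exists (maxn M1 M2).
  have := H2 (maxn M1 M2) (leq_maxr _ _).
  have f1 := H1 (maxn M1 M2) (leq_maxl _ _).
  rewrite /= sub0r normrN => h; rewrite -(fineK f1) lee_fin.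
  by rewrite (le_trans _ h)// ler_norm.
pose dl := e / (4 * (N%:R * K + 4 * K + 1)).
have NK : 0 <= N%:R * K by rewrite mulr_ge0.
have dl0 : 0 < dl.
  by rewrite divr_gt0// mulr_gt0// ltr_wpDl// addr_ge0// mulr_ge0.
have [H [fH FH uH]] := appr _ dl0.
have [LH [n mHn]] := fH; have [_ L2H] := LH; have [_ L2F] := LF.
have LphiH := L2X_lipschitz mphi phiC LH.
have LDH k := (L2X_Dk k LphiH).2.
have mHT := L2X_measurable LH.
have FHR : Ex P (fun w => (F w - H w) ^+ 2) <= dl.
  by rewrite -lee_fin -(E_sqr (L2_B L2F L2H)) ltW.
pose c k := Ex P (fun w => (u k w - Dk X k H w) ^+ 2).
have c0 k : 0 <= c k by exact: Ex_sqr_ge0.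
have LuH k : (fun w => u k w - Dk X k H w) \in Lfun P 2%:E.
  exact: (L2_B (Lu k).2 (L2X_Dk k LH).2).
have cdl : (\sum_(0 <= k <oo) (c k)%:E <= dl%:E)%E.
  rewrite (eq_eseriesr (g := fun k => 'E_P[fun w => (u k w - Dk X k H w) ^+ 2])); first exact: ltW.
  by move=> k _; rewrite E_sqr.
have phiFH : Ex P (fun w => (phi (F w) - phi (H w)) ^+ 2) <= K * dl.
  apply: (@le_trans _ _ (K * Ex P (fun w => (F w - H w) ^+ 2))); last by rewrite ler_wpM2l.
  rewrite -ExZ; last by apply/L2_sqr/L2_B.
  apply: Ex_le; first exact: (L2_sqr (L2_B LphiF.2 LphiH.2)).
    by apply/L1_scale/L2_sqr/L2_B.
  move=> w /=; rewrite -exprMn.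
  rewrite -[leLHS]ger0_norm ?sqr_ge0// -[leRHS]ger0_norm ?sqr_ge0// !normrX.
  by rewrite lerXn2r ?nnegrE// (le_trans (phiC _ _))// normrM ler_wpM2r// ler_norm.
pose dd k := Ex P (fun w => (Dk X k (phi \o F) w - Dk X k (phi \o H) w) ^+ 2).
have ddE k : 'E_P[fun w => (Dk X k (phi \o F) w - Dk X k (phi \o H) w) ^+ 2] = (dd k)%:E.
  by rewrite (E_sqr (L2_B (LDphi k) (LDH k))).
have dd0 k : 0 <= dd k by exact: Ex_sqr_ge0.
(* Uniform in k, to be used for the first N terms. *)
have dd1 k : dd k <= K * dl.
  by apply: le_trans phiFH; exact: (Dk_contraction k LphiF LphiH).
(* Summable in k, for the tail. The two terms of the difference are bounded separately by
   [Dk_lipschitz], and E[(D_k H)^2] <= 2 a k + 2 c k; this gives 2 K + 4 K = 6 K. *)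
have dd2 k : dd k <= 6 * K * a k + 4 * K * c k.
  have s1 := Dk_lipschitz k mphi phiC LF; have s2 := Dk_lipschitz k mphi phiC LH.
  have s3 := Ex_sqrD_le (LDphi k) (L2_scale (-1) (LDH k)).
  have s4 := Ex_sqrD_le (Lu k).2 (L2_scale (-1) (LuH k)).
  move: s3 s4.
  rewrite [X in X <= _ -> _](_ : _ = dd k); last first.
    by congr Ex; apply/funext => w /=; congr (_ ^+ 2); ring.
  under [X in _ <= _ + 2 * Ex P X -> _]eq_fun do rewrite mulN1r sqrrN.
  move=> s3.
  rewrite [X in X <= _ -> _](_ : _ = Ex P (fun w => Dk X k H w ^+ 2)); last first.
    by congr Ex; apply/funext => w /=; congr (_ ^+ 2); ring.
  under [X in _ <= _ + 2 * Ex P X -> _]eq_fun do rewrite mulN1r sqrrN.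
  rewrite (Ex_D_graph k D) -/(a k) -/(c k) => s4.
  have s5 : K * Ex P (fun w => Dk X k H w ^+ 2) <= K * (2 * a k + 2 * c k).
    by rewrite ler_wpM2l.
  rewrite -/K -/(a k) in s1 s2; lra.
exists (phi \o H); split.
- by split => //; exists n; exact: measurable_wrt_comp.
- rewrite (E_sqr (L2_B LphiF.2 LphiH.2)) lte_fin (le_lt_trans phiFH)//.
  rewrite /dl mulrA ltr_pdivrMr; last by rewrite mulr_gt0// ltr_wpDl// addr_ge0// mulr_ge0.
  rewrite mulrC ltr_pM2l//; lra.
- under eq_eseriesr do rewrite ddE.
  rewrite (nneseries_split 0 N)/=; last by move=> k _; rewrite lee_fin.
  rewrite add0n.
  have h1 : (\sum_(0 <= k < N) (dd k)%:E <= (N%:R * (K * dl))%:E)%E.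
    rewrite sumEFin lee_fin (le_trans (ler_sum _ (fun k _ => dd1 k)))//.
    by rewrite sumr_const_nat subn0 mulr_natl.
  have h2 : (\sum_(N <= k <oo) (dd k)%:E <= (6 * K * e1 + 4 * K * dl)%:E)%E.
    apply: (@le_trans _ _ (\sum_(N <= k <oo) ((6 * K)%:E * (a k)%:E + (4 * K)%:E * (c k)%:E))%E).
      by apply: lee_nneseries => k _; rewrite ?lee_fin// -!EFinM -EFinD lee_fin dd2.
    rewrite nneseriesD; [|by move=> k _ _; apply: mule_ge0; rewrite lee_fin// mulr_ge0..].
    rewrite nneseriesZl; last by move=> k _; rewrite lee_fin.
    rewrite nneseriesZl; last by move=> k _; rewrite lee_fin.
    rewrite EFinD (EFinM (6 * K)) (EFinM (4 * K)).
    have K6 : 0 <= 6 * K by rewrite mulr_ge0.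
    have K4 : 0 <= 4 * K by rewrite mulr_ge0.
    apply: leeD; apply: lee_wpmul2l => //; rewrite ?lee_fin//.
    apply: le_trans cdl; rewrite [leRHS](nneseries_split 0 N)/=; last by move=> k _; rewrite lee_fin.
    rewrite add0n.
    by rewrite leeDr//; apply: sume_ge0 => i _; rewrite lee_fin.
  apply: (le_lt_trans (leeD h1 h2)); rewrite -EFinD lte_fin.
  have E1 : (6 * K + 1) * e1 = e / 4.
    by rewrite /e1; field; apply: lt0r_neq0; lra.
  have E2 : (N%:R * K + 4 * K + 1) * dl = e / 4.
    by rewrite /dl; field; apply: lt0r_neq0; lra.
  lra.
Qed.

End malliavin_derivative.

(** * Integration by parts *)

Section stein_identity.
Context (dE : nat -> measure_display) (E : forall n, measurableType (dE n)).
Context (R : realType) (mu_ : forall n, probability (E n) R)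
  (mu : probability (prodE E) R).
Hypothesis hmu : is_product_measure mu_ mu.
Context d (T : measurableType d) (P : probability T R) (X X' : {RV P >-> prodE E}).
Hypotheses (hX : has_law X mu) (hX' : has_law X' mu) (hXX' : independent_RV X X').
Local Open Scope ring_scope.

Lemma measurable_Delta k (f : prodE E -> R) : measurable_fun setT f ->
  measurable_fun setT (Delta X X' k f).
Proof.
move=> mf; apply: measurable_funB; apply: measurableT_comp => //.
exact: measurable_resample.
Qed.

Lemma L2_Delta k (f : prodE E -> R) : measurable_fun setT f ->
  f \o X \in Lfun P 2%:E -> Delta X X' k f \in Lfun P 2%:E.
Proof.
move=> mf Lf; apply: L2_B => //.
exact: (L2_resample hmu hX hX' hXX' k mf Lf).
Qed.

(** D_k is an orthogonal projection, so E[D_k F D_k G] = E[F D_k G], to which [Ex_mul_Dk]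
    applies. *)
Lemma Ex_Dk_mul k (f g : prodE E -> R) :
  measurable_fun setT f -> measurable_fun setT g ->
  L2X X (f \o X) -> L2X X (g \o X) ->
  Ex P (fun w => Dk X k (f \o X) w * Dk X k (g \o X) w) =
  2^-1 * Ex P (fun w => Delta X X' k f w * Delta X X' k g w).
Proof.
move=> mf mg Lf Lg.
have Gm := @sigma_coords_measurable _ _ _ _ _ P X [set j | j <> k].
have Hf := Dk_cond_exp X k Lf.2; have Hg := Dk_cond_exp X k Lg.2.
have LHf := cond_exp_L2 Gm Lf.2 Hf; have LDg := (L2X_Dk k Lg).2.
have [mHf _ _] := Hf.
rewrite -(Ex_mul_Dk hmu hX hX' hXX' mf mg Lf.2 Lg.2 Hg).
have O : Ex P (fun w => Dk X k (g \o X) w * cond_exp P (sigma_coords X [set j | j <> k]) (f \o X) w) = 0.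
  by apply: (cond_exp_orthogonal Gm (L2_L1 Lg.2) Hg) => //; exact: (L2M LDg LHf).
rewrite -[RHS]subr0 -O -ExB; [|exact: (L2M Lf.2 LDg)|exact: (L2M LDg LHf)].
by congr Ex; apply/funext => w; rewrite /Dk /=; ring.
Qed.

(** Turns membership in dom(D) into square summability of the differences Delta_k f. *)
Lemma Ex_Delta_sqr k (f : prodE E -> R) : measurable_fun setT f -> L2X X (f \o X) ->
  Ex P (fun w => Delta X X' k f w ^+ 2) = 2 * Ex P (fun w => Dk X k (f \o X) w ^+ 2).
Proof.
move=> mf Lf; have := Ex_Dk_mul k mf mf Lf Lf.
under eq_fun do rewrite -expr2; under [in RHS]eq_fun do rewrite -expr2.
by move=> ->; field.
Qed.

Lemma Delta_sqr_sum (f : prodE E -> R) u : measurable_fun setT f ->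
  D_graph X (f \o X) u ->
  (\sum_(0 <= k <oo) 'E_P[fun w => (Delta X X' k f w ^+ 2)%R] < +oo)%E.
Proof.
move=> mf D; have [LF _ _] := D.
rewrite (eq_eseriesr (g := fun k => 2%:E * (Ex P (fun w => Dk X k (f \o X) w ^+ 2))%:E)%E).
  rewrite nneseriesZl => [|k _]; last by rewrite lee_fin Ex_sqr_ge0.
  by rewrite lte_mul_pinfty ?lee_fin//; exact: D_graph_sum D.
by move=> k _; rewrite E_sqr ?(L2_Delta k mf LF.2)// Ex_Delta_sqr.
Qed.

Lemma lty_sum_mul (Y Z : nat -> T -> R) :
  (forall k, Y k \in Lfun P 2%:E) -> (forall k, Z k \in Lfun P 2%:E) ->
  (\sum_(0 <= k <oo) 'E_P[fun w => (Y k w ^+ 2)%R] < +oo)%E ->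
  (\sum_(0 <= k <oo) 'E_P[fun w => (Z k w ^+ 2)%R] < +oo)%E ->
  (\sum_(0 <= k <oo) 'E_P[fun w => (`|Y k w * Z k w|)%R] < +oo)%E.
Proof.
move=> LY LZ Yoo Zoo.
have e0 (W : nat -> T -> R) k : (0 <= 'E_P[fun w => (W k w ^+ 2)%R])%E.
  by apply: expectation_ge0 => w; exact: sqr_ge0.
apply: (@le_lt_trans _ _ (\sum_(0 <= k <oo)
  ('E_P[fun w => (Y k w ^+ 2)%R] + 'E_P[fun w => (Z k w ^+ 2)%R]))%E).
  apply: lee_nneseries => [k _ _|k _]; first by apply: expectation_ge0 => w.
  rewrite -expectationD; [|exact: L2_sqr..].
  rewrite !ExE; [|by apply: L1_D; exact: L2_sqr|by apply: L1_norm; exact: L2M].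
  rewrite lee_fin; apply: Ex_le; first by apply: L1_norm; exact: L2M.
    by apply: L1_D; exact: L2_sqr.
  move=> w /=; rewrite normrM -[Y k w ^+ 2]real_normK ?num_real//.
  rewrite -[Z k w ^+ 2]real_normK ?num_real//.
  have : 0 <= (`|Y k w| - `|Z k w|) ^+ 2 by exact: sqr_ge0.
  have : 0 <= `|Y k w| * `|Z k w| by rewrite mulr_ge0.
  by rewrite sqrrB; lra.
rewrite nneseriesD => [|k _ _|k _ _]; [|exact: e0..].
by rewrite lte_add_pinfty.
Qed.

(** The adjoint relation is an equality of extended-real series; absolute convergence makes it a
    limit in R. *)
Lemma cvg_series_EFin (a : nat -> R) (l : R) : cvgn [normed series a] ->
  (\sum_(0 <= k <oo) (a k)%:E)%E = l%:E -> series a @ \oo --> l.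
Proof.
move=> /normed_cvg ca; rewrite (_ : (\sum_(0 <= k <oo) (a k)%:E)%E = (limn (series a))%:E).
  by move=> [<-].
rewrite -EFin_lim//; apply/congr_lim/funext => n /=.
by rewrite /series /= sumEFin.
Qed.

Lemma cvg_normed_Ex (Y : nat -> T -> R) : (forall k, Y k \in Lfun P 1) ->
  (\sum_(0 <= k <oo) 'E_P[fun w => `|Y k w|%R] < +oo)%E ->
  cvgn [normed series (fun k => Ex P (Y k))].
Proof.
move=> LY Yoo.
apply: nnseries_is_cvg => [k|]; first exact: normr_ge0.
apply: le_lt_trans Yoo; apply: lee_nneseries => [k _ _|k _]; first by rewrite lee_fin normr_ge0.
by rewrite ExE ?L1_norm// lee_fin /= Ex_norm.
Qed.

(** The adjoint relation tested on phi(f(X)), with [F0] in the role of L g(X). Each [ug k] is a.s.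
    D_k g(X), and the factor 2 undoes the 1/2 of [Ex_Dk_mul]. *)
Lemma stein_identity (f g : prodE E -> R) uf ug F0 (phi : R -> R) (C : R) :
  measurable_fun setT f -> measurable_fun setT g ->
  D_graph X (f \o X) uf -> D_graph X (g \o X) ug ->
  delta_graph X ug (\- F0) ->
  (forall x y, `|phi x - phi y| <= C * `|x - y|) ->
  series (fun k => Ex P (fun w => Delta X X' k (phi \o f) w * Delta X X' k g w))
    @ \oo --> - (2 * Ex P (fun w => phi (f (X w)) * F0 w)).
Proof.
move=> mf mg Df Dg [Lug LF0 dg] phiC.
have mphi := lipschitz_measurable phiC.
have Dphi := D_graph_lipschitz mphi phiC Df.
have [Lphi [Lv voo] _] := Dphi; have [LG [Lu uoo] _] := Dg.
have mpf : measurable_fun setT (phi \o f) by exact: measurableT_comp.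
have LvT k := (Lv k).2; have LuT k := (Lu k).2.
have Lvu k : (fun w => Dk X k (phi \o (f \o X)) w * ug k w) \in Lfun P 1.
  exact: L2M.
have LN : (\- F0) \in Lfun P 2%:E by exact: LF0.2.
have vuoo := lty_sum_mul LvT LuT voo uoo.
have H := dg _ _ Dphi.
have {}H : series (fun k => Ex P (fun w => Dk X k (phi \o (f \o X)) w * ug k w)) @ \oo -->
    - Ex P (fun w => phi (f (X w)) * F0 w).
  apply: cvg_series_EFin; first exact: (cvg_normed_Ex Lvu vuoo).
  rewrite (eq_eseriesr (g := fun k => 'E_P[fun w => (Dk X k (phi \o (f \o X)) w * ug k w)%R])); last first.
    by move=> k _; rewrite ExE.
  rewrite H ExE; last exact: (L2M Lphi.2 LN).
  congr (_%:E); rewrite -mulN1r -ExZ; last first.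
    have := L2M Lphi.2 (L2_scale (-1) LN).
    by under eq_fun do rewrite /= mulN1r opprK.
  by congr Ex; apply/funext => w /=; ring.
have -> : (fun k => Ex P (fun w => Delta X X' k (phi \o f) w * Delta X X' k g w)) =
   (fun k => 2 * Ex P (fun w => Dk X k (phi \o (f \o X)) w * ug k w)).
  apply/funext => k.
  rewrite (_ : Ex P (fun w => Dk X k (phi \o (f \o X)) w * ug k w) =
    Ex P (fun w => Dk X k ((phi \o f) \o X) w * Dk X k (g \o X) w)).
    by rewrite (Ex_Dk_mul k mpf mg Lphi LG) mulrA mulfV ?mul1r.
  congr fine; apply: Ex_ae.
  - exact: L1_measurable (Lvu k).
  - by apply: (@L1_measurable _ _ _ P _ 1); exact: (L2M (LvT k) (L2X_Dk k LG).2).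
  - by have := D_graph_Dk k Dg; apply: filterS => w ->.
rewrite -mulrN.
have -> : series (fun k => 2 * Ex P (fun w => Dk X k (phi \o (f \o X)) w * ug k w)) =
  (fun n => 2 * series (fun k => Ex P (fun w => Dk X k (phi \o (f \o X)) w * ug k w)) n).
  by apply/funext => n; rewrite /series /= mulr_sumr.
exact: cvgMr.
Qed.

End stein_identity.

(** * The bound with remainders *)

Section stein_bound.
Context (dE : nat -> measure_display) (E : forall n, measurableType (dE n)).
Context (R : realType) (mu_ : forall n, probability (E n) R)
  (mu : probability (prodE E) R).
Hypothesis hmu : is_product_measure mu_ mu.
Context d (T : measurableType d) (P : probability T R) (X X' : {RV P >-> prodE E}).
Hypotheses (hX : has_law X mu) (hX' : has_law X' mu) (hXX' : independent_RV X X').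
Local Open Scope ring_scope.
Variables (f g : prodE E -> R) (uf ug : nat -> T -> R) (F0 : T -> R).
Hypotheses (mf : measurable_fun setT f) (mg : measurable_fun setT g).
Hypotheses (Df : D_graph X (f \o X) uf) (Dg : D_graph X (g \o X) ug).
Hypothesis dg : delta_graph X ug (\- F0).

Let Lf : f \o X \in Lfun P 2%:E. Proof. by case: Df => -[]. Qed.
Let Lg : g \o X \in Lfun P 2%:E. Proof. by case: Dg => -[]. Qed.
Let LDf k : Delta X X' k f \in Lfun P 2%:E.
Proof. exact: (L2_Delta hmu hX hX' hXX' k mf Lf). Qed.
Let LDg k : Delta X X' k g \in Lfun P 2%:E.
Proof. exact: (L2_Delta hmu hX hX' hXX' k mg Lg). Qed.
Let LDfg k : (fun w => Delta X X' k f w * Delta X X' k g w) \in Lfun P 1.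
Proof. exact: L2M. Qed.

Lemma Delta_mul_sum :
  (\sum_(0 <= k <oo) 'E_P[fun w => `|Delta X X' k f w * Delta X X' k g w|%R] < +oo)%E.
Proof.
apply: lty_sum_mul => //.
- exact: (Delta_sqr_sum hmu hX hX' hXX' mf Df).
- exact: (Delta_sqr_sum hmu hX hX' hXX' mg Dg).
Qed.

Let c k := cond_exp P (sigmaX X) (fun w' => Delta X X' k f w' * Delta X X' k (\- g) w').

Let LDfNg k : (fun w => Delta X X' k f w * Delta X X' k (\- g) w) \in Lfun P 1.
Proof.
rewrite (_ : (fun w => _) = (fun w => -1 * (Delta X X' k f w * Delta X X' k g w))).
  exact: L1_scale.
by apply/funext => w; rewrite /Delta /=; ring.
Qed.

Let cP k : is_cond_exp P (sigmaX X)
  (fun w => Delta X X' k f w * Delta X X' k (\- g) w) (c k).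
Proof. by apply: cond_expP; [exact: (@sigmaX_measurable _ _ _ _ _ _ X)|exact: LDfNg]. Qed.

Let Lc k : c k \in Lfun P 1. Proof. exact: cond_exp_L1 (cP k). Qed.

Lemma bounded_term_sum (xi : T -> R) (Y : nat -> T -> R) (C : R) :
  measurable_fun setT xi -> (forall w, `|xi w| <= C) ->
  (forall k, Y k \in Lfun P 1) ->
  (\sum_(0 <= k <oo) 'E_P[fun w => `|Y k w|%R] < +oo)%E ->
  (\sum_(0 <= k <oo) 'E_P[fun w => `|xi w * Y k w|%R] < +oo)%E.
Proof.
(* Nonnegativity of [C] is read off at a point of [T]; for empty [T] every term is 0. *)
move=> mxi xiC LY Yoo; have [w0|noT] := pselect (exists w : T, True); last first.
  rewrite eseries0 ?ltry// => k _ _; rewrite expectationE.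
  rewrite (_ : [set: T] = set0) ?integral_set0//.
  by apply/seteqP; split => // w; exfalso; apply: noT; exists w.
have C0 : 0 <= C by have [w _] := w0; exact: le_trans (xiC w).
apply: (@le_lt_trans _ _ (\sum_(0 <= k <oo) (C%:E * 'E_P[fun w => `|Y k w|%R]))%E).
  apply: lee_nneseries => [k _ _|k _]; first exact: expectation_ge0.
  rewrite !ExE; [|by apply: L1_norm|by apply: L1_norm; exact: (L1_boundedM mxi xiC (LY k))].
  rewrite -EFinM lee_fin -ExZ ?L1_norm//.
  apply: Ex_le; [by apply: L1_norm; exact: (L1_boundedM mxi xiC (LY k))|by apply: L1_scale; apply: L1_norm|].
  by move=> w; rewrite normrM ler_wpM2r.
rewrite nneseriesZl => [|k _]; last exact: expectation_ge0.
by rewrite lte_mul_pinfty ?lee_fin.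
Qed.

(** Conditioning contracts in L^1, so absolute convergence is inherited from [Delta_mul_sum]. *)
Let coo : (\sum_(0 <= k <oo) 'E_P[fun w => `|c k w|%R] < +oo)%E.
Proof.
apply: le_lt_trans Delta_mul_sum; apply: lee_nneseries => [k _ _|k _].
  exact: expectation_ge0.
rewrite !ExE ?L1_norm// lee_fin.
apply: (le_trans (cond_exp_norm (@sigmaX_measurable _ _ _ _ _ _ X) (LDfNg k) (cP k))).
rewrite le_eqVlt; apply/orP; left; apply/eqP; congr Ex; apply/funext => w.
by rewrite -normrN; congr (`| _ |); rewrite /Delta /=; ring.
Qed.

Lemma Gamma0_L1 : Gamma0 X X' f (\- g) \in Lfun P 1.
Proof. by have [L _ _] := expectation_series Lc coo; exact: L1_scale. Qed.

Lemma Ex_mul_series (xi : T -> R) (Y : nat -> T -> R) (C : R) :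
  measurable_fun setT xi -> (forall w, `|xi w| <= C) ->
  (forall k, Y k \in Lfun P 1) ->
  (\sum_(0 <= k <oo) 'E_P[fun w => `|Y k w|%R] < +oo)%E ->
  series (fun k => Ex P (fun w => xi w * Y k w)) @ \oo -->
    Ex P (fun w => xi w * limn (series (Y ^~ w))).
Proof.
move=> mxi xiC LY Yoo.
have LxY k : (fun w => xi w * Y k w) \in Lfun P 1.
  exact: (L1_boundedM mxi xiC (LY k)).
have [LS _ cS] := expectation_series LxY (bounded_term_sum mxi xiC LY Yoo).
have [LS' cY _] := expectation_series LY Yoo.
suff <- : Ex P (fun w => limn (series (fun k => xi w * Y k w))) =
  Ex P (fun w => xi w * limn (series (Y ^~ w))) by [].
congr fine; apply: Ex_ae.
- exact: L1_measurable LS.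
- by apply: measurable_funM => //; exact: L1_measurable LS'.
(* [xi w] is moved through [limn] where the series converges, that is, almost surely. *)
- apply: filterS cY => w cw; apply/cvg_lim => //.
  rewrite (_ : series _ = (fun n => xi w * series (Y ^~ w) n)); first exact: cvgMr.
  by apply/funext => n; rewrite /series /= mulr_sumr.
Qed.

(** psi(f(X)) is bounded and sigma(X)-measurable, so the conditional expectations inside [Gamma0]
    disappear. The sign comes from - g, the factor 2 from the 1/2 in [Gamma0]. *)
Lemma Ex_mul_Gamma0 (psi : R -> R) (c0 : R) : measurable_fun setT psi ->
  (forall x, `|psi x| <= c0) ->
  series (fun k => Ex P (fun w => psi (f (X w)) * (Delta X X' k f w * Delta X X' k g w)))
   @ \oo --> - (2 * Ex P (fun w => psi (f (X w)) * Gamma0 X X' f (\- g) w)).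
Proof.
move=> mpsi psiC.
have mxi : measurable_fun setT (psi \o (f \o X)).
  by apply: measurableT_comp => //; exact: measurableT_comp.
have xiC w : `|psi (f (X w))| <= c0 by [].
have mw : measurable_wrt (sigmaX X) (psi \o (f \o X)).
  by apply: (measurable_wrt_preimage (Y := X) (psi := psi \o f)); exact: measurableT_comp.
have H := Ex_mul_series mxi xiC Lc coo.
have -> : 2 * Ex P (fun w => psi (f (X w)) * Gamma0 X X' f (\- g) w) =
    Ex P (fun w => psi (f (X w)) * limn (series (c ^~ w))).
  rewrite -ExZ; last exact: (L1_boundedM mxi xiC Gamma0_L1).
  by congr Ex; apply/funext => w; rewrite /Gamma0 /c; field.
rewrite (_ : series _ = - series (fun k => Ex P (fun w => psi (f (X w)) * c k w))).
  exact: cvgN.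
apply/funext => n; rewrite fctE /series /= -sumrN; apply: eq_bigr => k _.
rewrite -(cond_exp_pullout_bounded (@sigmaX_measurable _ _ _ _ _ _ X) (LDfNg k) (cP k) mw xiC).
rewrite -mulN1r -ExZ; last exact: (L1_boundedM mxi xiC (LDfNg k)).
by congr Ex; apply/funext => w; rewrite /Delta /=; ring.
Qed.

(** An extended-real inequality, because the remainder series may diverge. [psi] enters only through
    boundedness and measurability, which leaves its value at a kink of [phi] free. *)
Lemma stein_bound (phi psi : R -> R) (C c0 : R) :
  (forall x y, `|phi x - phi y| <= C * `|x - y|) ->
  measurable_fun setT psi -> (forall x, `|psi x| <= c0) ->
  (`|Ex P (fun w => psi (f (X w))) - Ex P (fun w => phi (f (X w)) * F0 w)|%:E <=
  c0%:E * 'E_P[fun w => `|1 - Gamma0 X X' f (\- g) w|%R] +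
  2^-1%:E * \sum_(0 <= k <oo) 'E_P[fun w =>
    (`|phi (f (resample X X' k w)) - phi (f (X w)) - psi (f (X w)) * Delta X X' k f w|
     * `|Delta X X' k g w|)%R])%E.
Proof.
move=> phiC mpsi psiC.
have mphi := lipschitz_measurable phiC.
have mxi : measurable_fun setT (psi \o (f \o X)).
  by apply: measurableT_comp => //; exact: measurableT_comp.
have xiC w : `|psi (f (X w))| <= c0 by [].
pose r k w := phi (f (resample X X' k w)) - phi (f (X w)) - psi (f (X w)) * Delta X X' k f w.
have mDf k := measurable_Delta X X' k mf.
have mDg k := measurable_Delta X X' k mg.
have mphif : measurable_fun setT (phi \o f) by exact: measurableT_comp.
have LDphi k : Delta X X' k (phi \o f) \in Lfun P 2%:E.
  apply: (L2_le (k := C) _ _ (LDf k)); first exact: measurable_Delta.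
  by move=> w; exact: phiC.
have Lr k : r k \in Lfun P 2%:E.
  apply: (L2_B (LDphi k)).
  apply: (L2_le (k := c0) _ _ (LDf k)) => [|w]; first exact: measurable_funM.
  by rewrite normrM ler_wpM2r.
have Lrg k : (fun w => r k w * Delta X X' k g w) \in Lfun P 1 by exact: L2M.
have L1G : (cst 1 \- Gamma0 X X' f (\- g)) \in Lfun P 1.
  by apply: L1_B; [exact: Lfun_cst|exact: Gamma0_L1].
have S1 := stein_identity hmu hX hX' hXX' mf mg Df Dg dg phiC.
have S2 := Ex_mul_Gamma0 mpsi psiC.
set s1 := series _ in S1; set s2 := series _ in S2.
set a := Ex P (fun w => phi (f (X w)) * F0 w) in S1 *.
set b := Ex P (fun w => psi (f (X w)) * Gamma0 _ _ _ _ w) in S2.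
have S3 : series (fun k => Ex P (fun w => r k w * Delta X X' k g w)) @ \oo --> 2 * b - 2 * a.
  rewrite (_ : series _ = s1 - s2); last first.
    apply/funext => n; rewrite fctE /s1 /s2 /series /= -sumrB; apply: eq_bigr => k _.
    rewrite -ExB; [|exact: (L2M (LDphi k) (LDg k))|exact: (L1_boundedM mxi xiC (LDfg k))].
    by congr Ex; apply/funext => w; rewrite /r /Delta /=; ring.
  rewrite (_ : 2 * b - 2 * a = - (2 * a) - - (2 * b)); last by ring.
  exact: cvgB.
(* The partial sums stay below the possibly infinite series, and so does their limit. *)
have B3 : (`|2 * b - 2 * a|%:E <= \sum_(0 <= k <oo) 'E_P[fun w => (`|r k w| * `|Delta X X' k g w|)%R])%E.
  have cS : (fun n => (`|series (fun k => Ex P (fun w => r k w * Delta X X' k g w)) n|)%:E) @ \oo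
      --> (`|2 * b - 2 * a|)%:E.
    by apply: cvg_EFin; [exact: nearW|exact: cvg_norm].
  rewrite -(cvg_lim _ cS)//; apply: lime_le; first by apply/cvg_ex; eexists; exact: cS.
  apply: nearW => n.
  apply: (@le_trans _ _ (\sum_(0 <= k < n) 'E_P[fun w => (`|r k w| * `|Delta X X' k g w|)%R])%E).
    rewrite (eq_bigr (fun k => (Ex P (fun w => `|r k w * Delta X X' k g w|))%:E)); last first.
      move=> k _; rewrite -ExE ?L1_norm//; congr ('E_P[ _ ]).
      by apply/funext => w; rewrite normrM.
    rewrite sumEFin lee_fin /series /=.
    apply: (le_trans (ler_norm_sum _ _ _)); apply: ler_sum => k _; exact: Ex_norm.
  by apply: nneseries_lim_ge => k *; apply: expectation_ge0 => w; rewrite mulr_ge0.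
have -> : Ex P (fun w => psi (f (X w))) - a = 
    Ex P (fun w => psi (f (X w)) * (1 - Gamma0 X X' f (\- g) w)) + 2^-1 * (2 * b - 2 * a).
  rewrite (_ : (fun w => _ * (1 - _)) = (fun w => psi (f (X w))) \-
    (fun w => psi (f (X w)) * Gamma0 X X' f (\- g) w)); last first.
    by apply/funext => w /=; ring.
  rewrite ExB; first by rewrite -/b; lra.
    exact: L1_bounded xiC.
  exact: (L1_boundedM mxi xiC Gamma0_L1).
apply: (@le_trans _ _ ((`|Ex P (fun w => psi (f (X w)) * (1 - Gamma0 X X' f (\- g) w))|)%:E +
   (2^-1 * `|2 * b - 2 * a|)%:E)%E).
  rewrite -EFinD lee_fin; apply: (le_trans (ler_normD _ _)).
  by rewrite lerD2l normrM ger0_norm.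
apply: leeD; last by rewrite EFinM; apply: lee_wpmul2l => //; rewrite lee_fin.
rewrite (ExE (L1_norm L1G)) -EFinM lee_fin -ExZ ?L1_norm//.
apply: (le_trans (Ex_norm (L1_boundedM mxi xiC L1G))).
apply: Ex_le; first by apply: L1_norm; exact: (L1_boundedM mxi xiC L1G).
  by apply: L1_scale; apply: L1_norm.
by move=> w /=; rewrite normrM ler_wpM2r.
Qed.

End stein_bound.

(** * Gaussian tails *)

Section gaussian.
Context (R : realType).
Local Open Scope ring_scope.
Implicit Types (x y w : R).
Notation lam := (@lebesgue_measure R).

Definition gp (x : R) : R := normal_pdf 0 1 x.

Lemma gpE x : gp x = gp 0 * expR (- (x ^+ 2) / 2).
Proof.
rewrite /gp !normal_pdfE ?oner_eq0// /normal_fun !subr0 expr0n/= oppr0 mul0r expR0 mulr1.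
by rewrite expr1n mulr2n.
Qed.

Lemma gp0E : gp 0 = (Num.sqrt (2 * pi))^-1.
Proof.
rewrite /gp normal_pdfE ?oner_eq0// /normal_fun subr0 expr0n/= oppr0 mul0r expR0 mulr1.
by rewrite /normal_peak expr1n mul1r mulr2n mulrDl mul1r.
Qed.

Lemma gp0_gt0 : 0 < gp 0.
Proof. by rewrite gp0E invr_gt0 sqrtr_gt0 mulr_gt0// pi_gt0. Qed.

Lemma gp_gt0 x : 0 < gp x.
Proof. by rewrite gpE mulr_gt0 ?gp0_gt0 ?expR_gt0. Qed.

Lemma gp_ge0 x : 0 <= gp x. Proof. exact/ltW/gp_gt0. Qed.

Lemma gpN x : gp (- x) = gp x.
Proof. by rewrite gpE [in RHS]gpE sqrrN. Qed.

Lemma gp_der x : is_derive x 1 gp (- (x * gp x)).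
Proof.
have D := derM (derC (gp 0) x)
  (derExp (derM (derN (derM (derI x) (derI x))) (derC (2^-1) x))).
rewrite (_ : gp = (fun t => gp 0 * expR (- (t * t) * 2^-1))); last first.
  by apply/funext => t; rewrite gpE expr2.
by apply: (der_eq D) => /=; field.
Qed.

Lemma gp_continuous : continuous gp.
Proof. by move=> x; exact: der_continuous (gp_der x). Qed.

Lemma gp_measurable : measurable_fun setT gp.
Proof. exact: measurable_normal_pdf. Qed.

Lemma gp_integrable : lam.-integrable setT (EFin \o gp).
Proof. exact: integrable_normal_pdf. Qed.

Lemma integrable_itv (f : R -> R) (i : interval R) :
  lam.-integrable setT (EFin \o f) -> lam.-integrable [set` i] (EFin \o f).
Proof. by move=> fi; apply: (integrableS _ _ _ fi) => //; exact: measurable_itv. Qed.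

Lemma gp0_le1 : gp 0 <= 1.
Proof.
rewrite gp0E invf_le1 ?sqrtr_gt0 ?mulr_gt0 ?pi_gt0//.
rewrite -[leLHS]sqrtr1 ler_wsqrtr//; have := @pi_ge2 R; lra.
Qed.

(** 1 + t <= exp t at t = x^2 / 2; crude, but enough for the decay at infinity. *)
Lemma gp_le x : gp x * (2 + x ^+ 2) <= 2.
Proof.
have e1 : 1 + x ^+ 2 / 2 <= expR (x ^+ 2 / 2) by exact: expR_ge1Dx.
have E : expR (- (x ^+ 2) / 2) * expR (x ^+ 2 / 2) = 1.
  by rewrite -expRD mulNr addNr expR0.
have E0 := expR_gt0 (- (x ^+ 2) / 2).
rewrite gpE -mulrA.
apply: (@le_trans _ _ (1 * (expR (- (x ^+ 2) / 2) * (2 + x ^+ 2)))).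
  rewrite ler_wpM2r ?gp0_le1//; apply: mulr_ge0; first exact: ltW.
  by rewrite addr_ge0// sqr_ge0.
rewrite mul1r (_ : 2 + x ^+ 2 = 2 * (1 + x ^+ 2 / 2)); last by field.
by rewrite mulrCA ger_pMr// -[leRHS]E ler_wpM2l// ltW.
Qed.

Lemma gp_le_inv x : 1 <= x -> gp x <= 2 / x.
Proof.
move=> x1; have x0 : 0 < x by lra.
rewrite ler_pdivlMr//; apply: le_trans (gp_le x).
rewrite ler_wpM2l ?gp_ge0//; have := sqr_ge0 (x - 1); rewrite sqrrB1; lra.
Qed.

Lemma xgp_le_inv x : 1 <= x -> x * gp x <= 2 / x.
Proof.
move=> x1; have x0 : 0 < x by lra.
rewrite ler_pdivlMr// mulrAC -expr2 mulrC; apply: le_trans (gp_le x).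
by rewrite ler_wpM2l ?gp_ge0//; lra.
Qed.

Lemma cvg0_le_inv (f : R -> R) (K : R) :
  (forall x, 1 <= x -> `|f x| <= K / x) -> f x @[x --> +oo] --> 0.
Proof.
move=> H; have K0 : 0 <= K by have := H 1 (lexx _); rewrite divr1; exact: le_trans.
apply/cvgrPdist_le => e e0; near=> x; rewrite sub0r normrN.
have x1 : 1 <= x by near: x; exact: nbhs_pinfty_ge.
have x0 : 0 < x by lra.
apply: (le_trans (H _ x1)); rewrite ler_pdivrMr// mulrC -ler_pdivrMr//.
Unshelve. all: by end_near. Qed.

(** The lower bound - K / y vanishes at infinity, and monotonicity carries it back from a far point
    [y] to [x]. *)
Lemma nonincreasing_ge0 (f : R -> R) (K a : R) :
  (forall x y, a <= x -> x <= y -> f y <= f x) ->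
  (forall x, 1 <= x -> - (K / x) <= f x) ->
  forall x, a <= x -> 0 <= f x.
Proof.
move=> fd fK x ax; apply/ler_addgt0Pr => e e0.
pose y := Num.max (Num.max x 1) (`|K| / e).
have xy : x <= y by rewrite /y !le_max lexx.
have y1 : 1 <= y by rewrite /y !le_max lexx orbT.
have y0 : 0 < y by lra.
have Ky : `|K| / e <= y by rewrite /y le_max lexx orbT.
have := fd _ _ ax xy; have := fK _ y1.
have : K / y <= e.
  rewrite ler_pdivrMr//; move: Ky; rewrite ler_pdivrMr// => Ky.
  by rewrite mulrC; apply: le_trans Ky; exact: ler_norm.
lra.
Qed.

Lemma ge0_integral_opp (f : R -> \bar R) w : measurable_fun setT f ->
  (forall x, (0 <= f x)%E) ->
  (\int[lam]_(x in `]-oo, w]) f (- x)%R = \int[lam]_(x in `[(- w)%R, +oo[) f x)%E.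
Proof.
move=> mf f0.
have mo : measurable_fun setT (-%R : measurableTypeR R -> measurableTypeR R) by [].
transitivity (\int[pushforward lam (-%R : measurableTypeR R -> measurableTypeR R)]_(x
    in `[(- w)%R, +oo[) f x)%E.
  rewrite ge0_integral_pushforward//; last exact: measurable_funTS.
  congr (integral _ _ _); apply/seteqP; split => x /=; rewrite !in_itv/= andbT lerN2//.
by apply: eq_measure_integral => A mA _; exact: lebesgue_measureN.
Qed.

Definition gL w : R := \int[lam]_(x in `]-oo, w]) gp x.
Definition gQ w : R := 1 - gL w.

Lemma gL_der w : is_derive w 1 gL (gp w).
Proof.
have [d1 d2] := @continuous_FTC1 R gp -oo%O w (w + 1) (ltr_pwDr ltr01 (lexx w))
   (integrable_itv _ gp_integrable)
   (ltNyr _) (@gp_continuous w).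
by apply: DeriveDef; [exact: d1|rewrite -derive1E; exact: d2].
Qed.

Lemma gQ_der w : is_derive w 1 gQ (- gp w).
Proof. by apply: (der_eq (derB (derC 1 w) (gL_der w))); rewrite sub0r. Qed.

Lemma Rintegral_gp : \int[lam]_x gp x = 1.
Proof. by rewrite /Rintegral integral_normal_pdf. Qed.

Lemma Rintegral_split (f : R -> R) w : lam.-integrable setT (EFin \o f) ->
  \int[lam]_x f x = \int[lam]_(x in `]-oo, w]) f x + \int[lam]_(x in `[w, +oo[) f x.
Proof.
move=> fi; rewrite -Rintegral_itv_obnd_cbnd; last first.
  exact: integrable_itv.
rewrite -Rintegral_setU//=.
- by congr (Rintegral _ _ _); rewrite -itv_bndbnd_setU//; apply/seteqP.
- by apply: (integrableS _ _ _ fi) => //; apply: measurableU; exact: measurable_itv.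
- by rewrite disj_set2E; apply/eqP/seteqP; split => // x /=; rewrite !in_itv/= andbT => -[]; lra.
Qed.

Lemma gQE w : gQ w = \int[lam]_(x in `[w, +oo[) gp x.
Proof. by rewrite /gQ /gL -Rintegral_gp (Rintegral_split w gp_integrable) addrC addKr. Qed.

Lemma gL_ge0 w : 0 <= gL w.
Proof. by apply: Rintegral_ge0 => x _; exact: gp_ge0. Qed.

Lemma gQ_ge0 w : 0 <= gQ w.
Proof. by rewrite gQE; apply: Rintegral_ge0 => x _; exact: gp_ge0. Qed.

Lemma gLN w : gL (- w) = gQ w.
Proof.
rewrite gQE /gL /Rintegral; congr fine.
rewrite -{2}[w]opprK -ge0_integral_opp; last 2 first.
- by apply/measurable_EFinP; exact: gp_measurable.
- by move=> x; rewrite lee_fin gp_ge0.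
by apply: eq_integral => x _; rewrite /= gpN.
Qed.

Lemma gQN w : gQ (- w) = gL w.
Proof. by rewrite -gLN opprK. Qed.

Lemma gLQ w : gL w + gQ w = 1.
Proof. by rewrite /gQ addrC subrK. Qed.

Lemma gL_le1 w : gL w <= 1. Proof. by have := gLQ w; have := gQ_ge0 w; lra. Qed.


Lemma cvg_gp_pinfty : gp x @[x --> +oo] --> 0.
Proof.
apply: (@cvg0_le_inv _ 2) => x x1; rewrite ger0_norm ?gp_ge0//; exact: gp_le_inv.
Qed.

Lemma ge0_FTC2y (f F : R -> R) (a l : R) : (forall x, a <= x -> 0 <= f x) ->
  continuous f -> (forall x, is_derive x 1 F (f x)) ->
  F x @[x --> +oo] --> l ->
  (\int[lam]_(x in `[a, +oo[) (f x)%:E = (l - F a)%:E)%E.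
Proof.
move=> f0 cf dF Fl; have c1 : {within `[a, +oo[, continuous f} by exact: continuous_subspaceT.
have c2 x : a < x -> derivable F x 1 by have [] := dF x.
have c3 : F x @[x --> a^'+] --> F a.
  by apply: cvg_at_right_filter; exact: der_continuous (dF a).
have c4 : {in `]a, +oo[, (F^`())%classic =1 f}.
  by move=> x _; rewrite derive1E; have [_ ->] := dF x.
by rewrite (ge0_continuous_FTC2y f0 c1 Fl c2 c3 c4) EFinB.
Qed.

(* On [1, +oo[, gp is dominated by the derivative of - gp. *)
Lemma gQ_le w : 1 <= w -> gQ w <= gp w.
Proof.
move=> w1; rewrite gQE.
have E : (\int[lam]_(x in `[w, +oo[) (x * gp x)%:E = (0 - - gp w)%:E)%E.
  apply: (@ge0_FTC2y (fun x => x * gp x) (fun x => - gp x)).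
  - by move=> x wx; rewrite mulr_ge0 ?gp_ge0//; lra.
  - by move=> x; exact: der_continuous (derM (derI x) (gp_der x)).
  - by move=> x; apply: (der_eq (derN (gp_der x))); rewrite opprK.
  - by rewrite -oppr0; apply: cvgN; exact: cvg_gp_pinfty.
rewrite -lee_fin -[X in (_ <= X%:E)%E]opprK -(add0r (- - _)) -E.
rewrite fineK; last first.
  by apply: integrable_fin_num => //; exact: (integrable_itv _ gp_integrable).
apply: ge0_le_integral => //.
- by move=> x _; rewrite lee_fin gp_ge0.
- by apply/measurable_EFinP; apply: measurable_funTS; exact: gp_measurable.
- apply/measurable_EFinP; apply: measurable_funTS; apply: measurable_funM => //.
  exact: gp_measurable.
- move=> x; rewrite /= in_itv/= andbT => wx; rewrite lee_fin ler_peMl ?gp_ge0//; lra.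
Qed.

Lemma cvg_gQ_pinfty : gQ x @[x --> +oo] --> 0.
Proof.
apply: (@cvg0_le_inv _ 2) => x x1; rewrite ger0_norm ?gQ_ge0//.
exact: le_trans (gQ_le x1) (gp_le_inv x1).
Qed.

(* galpha, gbeta and ggamma / 2 are the integrals of gL over ]-oo, w], of gQ
   over [w, +oo[ and of gbeta over [w, +oo[. *)
Definition galpha w := gp w + w * gL w.
Definition gbeta w := gp w - w * gQ w.

Lemma gbetaN w : gbeta (- w) = galpha w.
Proof. by rewrite /gbeta gpN gQN mulNr opprK. Qed.

(** [gbeta w] is E[(Z - w)^+] for standard normal Z, the form in which increments of a 1-Lipschitz
    function are compared with it. The primitive used vanishes at infinity. *)
Lemma integral_gbeta w :
  (\int[lam]_(x in `[w, +oo[) ((x - w) * gp x)%:E = (gbeta w)%:E)%E.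
Proof.
rewrite (_ : gbeta w = 0 - (- gp w + w * gQ w)); last by rewrite /gbeta; ring.
apply: (@ge0_FTC2y (fun x => (x - w) * gp x) (fun x => - gp x + w * gQ x)).
- by move=> x wx; rewrite mulr_ge0 ?gp_ge0// subr_ge0.
- by move=> x; exact: (der_continuous (derM (derB (derI x) (derC w x)) (gp_der x))).
- move=> x; apply: (der_eq (derD (derN (gp_der x)) (derM (derC w x) (gQ_der x)))).
  by ring.
- rewrite -[X in _ --> X](_ : - 0 + w * 0 = 0); last by rewrite oppr0 mulr0 addr0.
  apply: cvgD; first by apply: cvgN; exact: cvg_gp_pinfty.
  by apply: cvgMr; exact: cvg_gQ_pinfty.
Qed.

Lemma integral_galpha w :
  (\int[lam]_(x in `]-oo, w]) ((w - x) * gp x)%:E = (galpha w)%:E)%E.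
Proof.
rewrite -gbetaN -integral_gbeta.
transitivity (\int[lam]_(x in `]-oo, w]) (`|- x + w| * gp (- x))%:E)%E.
  apply: eq_integral => x; rewrite inE /= in_itv/= => xw.
  by rewrite gpN ger0_norm 1?addrC// subr_ge0.
rewrite (@ge0_integral_opp (fun x => (`|x + w| * gp x)%:E)).
- apply: eq_integral => x; rewrite inE /= in_itv/= andbT => xw.
  by rewrite opprK ger0_norm//; lra.
- apply/measurable_EFinP; apply: measurable_funM; last exact: gp_measurable.
  by apply: measurableT_comp => //; exact: measurable_funD.
- by move=> x; rewrite lee_fin mulr_ge0 ?gp_ge0.
Qed.

Lemma gbeta_ge0 w : 0 <= gbeta w.
Proof.
rewrite -lee_fin -integral_gbeta integral_ge0// => x.
by rewrite /= in_itv/= andbT lee_fin => wx; rewrite mulr_ge0 ?gp_ge0// subr_ge0.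
Qed.

Lemma galpha_ge0 w : 0 <= galpha w.
Proof. by rewrite -gbetaN gbeta_ge0. Qed.

Lemma gbeta_der w : is_derive w 1 gbeta (- gQ w).
Proof.
apply: (der_eq (derB (gp_der w) (derM (derI w) (gQ_der w)))).
by ring.
Qed.

Lemma galpha_der w : is_derive w 1 galpha (gL w).
Proof.
apply: (der_eq (derD (gp_der w) (derM (derI w) (gL_der w)))).
by ring.
Qed.

Definition ggamma w := (1 + w ^+ 2) * gQ w - w * gp w.

(** [ggamma] is nonincreasing, its derivative being - 2 [gbeta], and for x >= 1 it is at least - x
    gp x >= - 2 / x. *)
Lemma ggamma_ge0 w : 0 <= ggamma w.
Proof.
have der x : is_derive x 1 ggamma (- (2 * gbeta x)).
  rewrite (_ : ggamma = (fun w => (1 + w * w) * gQ w - w * gp w)); last first.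
    by apply/funext => y; rewrite /ggamma expr2.
  apply: (der_eq (derB (derM (derD (derC 1 x) (derM (derI x) (derI x))) (gQ_der x))
    (derM (derI x) (gp_der x)))).
  by rewrite /gbeta; ring.
apply: (@nonincreasing_ge0 ggamma 2 w) => // [x y _ xy|x x1].
  apply: (der_le0_ge xy (fun t _ => der t)) => t _.
  by rewrite oppr_le0 mulr_ge0// gbeta_ge0.
rewrite /ggamma lerBrDr addrC; apply: (@le_trans _ _ 0).
  by rewrite subr_le0 xgp_le_inv.
by rewrite mulr_ge0 ?gQ_ge0// addr_ge0// sqr_ge0.
Qed.

(** A polynomial identity in w, gp w and gQ w once gL w is eliminated. *)
Lemma gbeta_gamma_id w :
  galpha w * ggamma w + gbeta w * ggamma (- w) = gp w.
Proof.
rewrite /galpha /gbeta /ggamma gpN gQN sqrrN.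
have -> : gL w = 1 - gQ w by have := gLQ w; lra.
by ring.
Qed.

End gaussian.

(** * A sharp inequality between Gaussian tails *)

Section gaussian_product_bound.
Context (R : realType).
Local Open Scope ring_scope.
Implicit Types (x y w : R).

(** For w >= 0, the standard normal probability of [- w, w]. *)
Let dl w : R := gL w - gQ w.

Let dl_der w : is_derive w 1 dl (2 * gp w).
Proof. by apply: (der_eq (derB (gL_der w) (gQ_der w))); ring. Qed.

Let dl0 : dl 0 = 0.
Proof. by rewrite /dl -gLN oppr0 subrr. Qed.

Let dl_ge w : 0 <= w -> 2 * w * gp w <= dl w.
Proof.
move=> w0; rewrite -subr_ge0.
have der x : is_derive x 1 (fun t => dl t - 2 * t * gp t) (2 * x ^+ 2 * gp x).
  apply: (der_eq (derB (dl_der x) (derM (derM (derC 2 x) (derI x)) (gp_der x)))).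
  by ring.
have := der_ge0_le w0 (fun t _ => der t).
rewrite dl0 mulr0 mul0r subrr; apply => t _.
by rewrite mulr_ge0 ?gp_ge0// mulr_ge0// sqr_ge0.
Qed.

(** The derivative 2 x (dl x - x gp x) is nonnegative by [dl_ge]. Up to a positive factor the
    expression is minus the derivative of [S] below. *)
Let M_ge0 w : 0 <= w -> 0 <= 4 * w * gp w - (2 - w ^+ 2) * dl w.
Proof.
move=> w0.
pose M t := 4 * t * gp t - (2 - t * t) * dl t.
have der x : is_derive x 1 M (2 * x * (dl x - x * gp x)).
  apply: (der_eq (derB (derM (derM (derC 4 x) (derI x)) (gp_der x))
    (derM (derB (derC 2 x) (derM (derI x) (derI x))) (dl_der x)))).
  by ring.
have := der_ge0_le w0 (fun t _ => der t).
rewrite /M dl0 !mulr0 !mul0r subrr expr2; apply => t /andP[t0 _].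
rewrite mulr_ge0 ?mulr_ge0// subr_ge0; apply: le_trans (dl_ge t0).
by rewrite -mulrA ler_peMl ?mulr_ge0 ?gp_ge0// ler1n.
Qed.

(* - w (2 + w ^ 2) S w / gp w is the derivative of galpha gbeta / gp, and the
   rational coefficients make all terms of S' but two cancel. *)
Let S w := gL w * gQ w - gp w * dl w * ((1 + w * w) * (w * (2 + w * w))^-1)
  - gp w * gp w * (2 + w * w)^-1.

Let S_der w : 0 < w -> is_derive w 1 S
  (gp w / (w ^+ 2 * (2 + w ^+ 2) ^+ 2) * ((2 - w ^+ 2) * dl w - 4 * w * gp w)).
Proof.
move=> w0.
have ww := derM (derI w) (derI w).
have d2 := derD (derC 2 w) ww.
have n2 : 2 + w * w != 0 by apply: lt0r_neq0; rewrite ltr_pwDl// -expr2 sqr_ge0.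
have n1 : w * (2 + w * w) != 0 by rewrite mulf_neq0// gt_eqF.
have w00 : w != 0 by rewrite gt_eqF.
have D := derB (derB (derM (gL_der w) (gQ_der w))
  (derM (derM (gp_der w) (dl_der w)) (derM (derD (derC 1 w) ww)
    (derV (f := fun t : R => t * (2 + t * t)) n1 (derM (derI w) d2)))))
  (derM (derM (gp_der w) (gp_der w)) (derV (f := fun t : R => 2 + t * t) n2 d2)).
apply: (der_eq D).
rewrite /dl; field.
by rewrite w00 expr2 n2.
Qed.

(** [S] is nonincreasing by [M_ge0]. For x >= 1 each of its two subtracted terms is at most gp x <=
    2 / x, whence the constant 4. *)
Let S_ge0 w : 0 < w -> 0 <= S w.
Proof.
move=> w0; apply: (@nonincreasing_ge0 _ S 4 w) => // [x y wx xy|x x1].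
  have x0 : 0 < x by exact: lt_le_trans wx.
  apply: (der_le0_ge xy (df := fun w => gp w / (w ^+ 2 * (2 + w ^+ 2) ^+ 2) *
    ((2 - w ^+ 2) * dl w - 4 * w * gp w))) => t /andP[xt _].
    by apply: S_der; exact: lt_le_trans xt.
  have t0 : 0 <= t by apply: (le_trans (ltW x0)).
  rewrite mulr_ge0_le0//.
    by rewrite divr_ge0 ?gp_ge0// mulr_ge0 ?sqr_ge0.
  by have := M_ge0 t0; lra.
have x0 : 0 < x by lra.
have xx : 1 <= x * x by nra.
have d1 : dl x <= 1 by rewrite /dl; have := gL_le1 x; have := gQ_ge0 x; lra.
have dp : 0 <= dl x by apply: le_trans (dl_ge (ltW x0)); rewrite !mulr_ge0 ?gp_ge0// ltW.
have r1 : (1 + x * x) / (x * (2 + x * x)) <= 1.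
  by rewrite ler_pdivrMr ?mul1r; nra.
have r0 : 0 <= (1 + x * x) / (x * (2 + x * x)).
  by rewrite divr_ge0//; nra.
have r2 : (2 + x * x)^-1 <= 1 by rewrite invf_le1; lra.
have r3 : 0 <= (2 + x * x)^-1 by rewrite invr_ge0; lra.
have p1 : gp x <= 1.
  have := gp_le x; have := gp_ge0 x; rewrite expr2; nra.
have P1 : gp x * dl x * ((1 + x * x) / (x * (2 + x * x))) <= gp x.
  rewrite -mulrA ler_piMr ?gp_ge0// mulr_ile1//.
have P2 : gp x * gp x * (2 + x * x)^-1 <= gp x.
  rewrite -mulrA ler_piMr ?gp_ge0// mulr_ile1// gp_ge0//.
have P3 : 0 <= gL x * gQ x by rewrite mulr_ge0 ?gL_ge0 ?gQ_ge0.
have P4 := gp_le_inv x1.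
rewrite /S; have : 4 / x = 2 / x + 2 / x by rewrite -mulrDl; congr (_ / _); lra.
lra.
Qed.

Let K w := galpha w * gbeta w * (gp w)^-1.

(** There is equality at 0. On the nonnegative half-line the quotient [K] is nonincreasing by the
    sign of [S], and w |-> - w exchanges [galpha] and [gbeta]. *)
Lemma galpha_gbeta_le w : galpha w * gbeta w <= gp 0 * gp w.
Proof.
wlog w0 : w / 0 <= w.
  move=> W; have [/W//|/ltW w0] := leP 0 w.
  have := W (- w); rewrite oppr_ge0 gpN gbetaN -[galpha (- w)]gbetaN opprK mulrC.
  exact.
suff H : K w <= gp 0.
  by have := H; rewrite /K ler_pdivrMr ?gp_gt0.
have K0 : K 0 = gp 0.
  rewrite /K /galpha /gbeta !mul0r addr0 subr0 -mulrA mulfV ?mulr1//.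
  by rewrite gt_eqF// gp_gt0.
rewrite -K0.
have der (t : R) : is_derive t 1 K
    ((gL t * gbeta t - galpha t * gQ t) / gp t + t * (galpha t * gbeta t) / gp t).
  have p0 : gp t != 0 by rewrite gt_eqF ?gp_gt0.
  apply: (der_eq (derM (derM (galpha_der t) (gbeta_der t)) (derV p0 (gp_der t)))).
  by field.
apply: (der_le0_ge w0 (fun t _ => der t)) => t /andP[t0 _].
have p0 : gp t != 0 by rewrite gt_eqF ?gp_gt0.
(* [S] divides by t; at 0 the derivative of [K] vanishes by symmetry. *)
have [->|tn0] := eqVneq t 0.
  have E : gQ 0 = gL 0 :> R by rewrite -gLN oppr0.
  by rewrite /galpha /gbeta !mul0r !addr0 !subr0 E [gp 0 * _]mulrC subrr mul0r.
have tp : 0 < t by rewrite lt_neqAle eq_sym tn0.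
have n2 : 2 + t ^+ 2 != 0 by apply: lt0r_neq0; rewrite ltr_pwDl// sqr_ge0.
rewrite (_ : _ + _ = - ((t * (2 + t ^+ 2)) * S t / gp t)).
  rewrite oppr_le0 divr_ge0 ?gp_ge0// mulr_ge0 ?S_ge0// mulr_ge0// addr_ge0// sqr_ge0//.
rewrite /galpha /gbeta /S /dl; field.
by rewrite p0 n2 tn0.
Qed.

End gaussian_product_bound.

Section gaussian_integrals.
Context (R : realType).
Local Open Scope ring_scope.
Implicit Types (x y w : R).
Notation lam := (@lebesgue_measure R).

(** The integral is galpha w + gbeta w; the integrand dominates (h x - h w) gp x for 1-Lipschitz
    [h]. *)
Lemma abs_gp_integrable w : lam.-integrable setT (EFin \o (fun x => `|x - w| * gp x)).
Proof.
have mf : measurable_fun setT (fun x : R => `|x - w| * gp x).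
  apply: measurable_funM; last exact: gp_measurable.
  by apply: measurableT_comp => //; exact: measurable_funB.
have me : measurable_fun setT (EFin \o (fun x => `|x - w| * gp x)) by exact/measurable_EFinP.
apply/integrableP; split => //.
under eq_integral do rewrite /= ger0_norm ?mulr_ge0 ?normr_ge0 ?gp_ge0//.
rewrite (_ : setT = `]-oo, w] `|` `]w, +oo[); last first.
  by rewrite -itv_bndbnd_setU//; apply/seteqP.
rewrite ge0_integral_setU//; last 3 first.
- by apply: measurable_funTS; exact: me.
- by move=> x _; rewrite lee_fin mulr_ge0 ?gp_ge0.
- by rewrite disj_set2E; apply/eqP/seteqP; split => // x /=; rewrite !in_itv/= andbT => -[]; lra.
rewrite integral_itv_obnd_cbnd; last by apply: measurable_funTS; exact: me.
have E1 : (\int[lam]_(x in `]-oo, w]) (`|x - w|%R * gp x)%:E = (galpha w)%:E)%E.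
  rewrite -integral_galpha; apply: eq_integral => x; rewrite inE /= in_itv/= => xw.
  by rewrite distrC ger0_norm// subr_ge0.
have E2 : (\int[lam]_(x in `[w, +oo[) (`|x - w|%R * gp x)%:E = (gbeta w)%:E)%E.
  rewrite -integral_gbeta; apply: eq_integral => x; rewrite inE /= in_itv/= andbT => xw.
  by rewrite ger0_norm// subr_ge0.
by rewrite [X in (X + _)%E]E1 [X in (_ + X)%E]E2 -EFinD ltry.
Qed.

End gaussian_integrals.

(** * Solutions of the Stein equation *)

Section stein_solution_lipschitz.
Context (R : realType) (h : R -> R).
Local Open Scope ring_scope.
Implicit Types (x y w : R).
Notation lam := (@lebesgue_measure R).
Hypothesis hlip : forall x y, `|h x - h y| <= `|x - y|.

Let h_continuous : continuous h.
Proof.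
move=> x; apply/cvgrPdist_le => e e0; near=> y.
by apply: (le_trans (hlip _ _)); near: y; apply/nbhs_ballP; exists e => //= y /ltW.
Unshelve. all: by end_near. Qed.

Let mh : measurable_fun setT h. Proof. exact: continuous_measurable_fun. Qed.

Let integrable_dom (f : R -> R) w : measurable_fun setT f ->
  (forall x, `|f x| <= `|x - w| * gp x) -> lam.-integrable setT (EFin \o f).
Proof.
move=> mf H; apply: (le_integrable _ _ _ (abs_gp_integrable w)) => //.
  exact/measurable_EFinP.
by move=> x _; rewrite /= lee_fin (le_trans (H x))// ler_norm.
Qed.

Let u_int w : lam.-integrable setT (EFin \o (fun x => (h x - h w) * gp x)).
Proof.
apply: (@integrable_dom _ w).
  by apply: measurable_funM; [exact: measurable_funB|exact: gp_measurable].
by move=> x; rewrite normrM [X in _ * X]ger0_norm ?gp_ge0// ler_wpM2r ?gp_ge0.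
Qed.

Let c_int (a : R) : lam.-integrable setT (EFin \o (fun x => a * gp x)).
Proof. by apply: (@integrableZl _ _ _ _ _ measurableT a _ (@gp_integrable R)). Qed.

Lemma lipschitz_gp_integrable : lam.-integrable setT (EFin \o (fun x => h x * gp x)).
Proof.
rewrite (_ : _ \o _ = ((EFin \o (fun x => ((h x - h 0) * gp x)%R)) \+ (EFin \o (fun x => (h 0 * gp x)%R)))%E).
  by apply: integrableD.
by apply/funext => x /=; rewrite -EFinD; congr (_%:E); ring.
Qed.

Let hint := lipschitz_gp_integrable.

Let Nh : R := \int[lam]_x (h x * gp x).

Let k_int : lam.-integrable setT (EFin \o (fun x => (h x - Nh) * gp x)).
Proof.
rewrite (_ : _ \o _ = ((EFin \o (fun x => (h x * gp x)%R)) \- (EFin \o (fun x => (Nh * gp x)%R)))%E).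
  by apply: integrableB.
by apply/funext => x /=; rewrite -EFinB; congr (_%:E); ring.
Qed.

(** Centring at h w rather than at the mean [Nh] gives |A| <= galpha and |B| <= gbeta directly,
    while [I], h w - Nh, [psi] and the derivative of [V] below are all linear in A and B. *)
Let A w := \int[lam]_(x in `]-oo, w]) ((h x - h w) * gp x).
Let B w := \int[lam]_(x in `[w, +oo[) ((h x - h w) * gp x).
Let I w := \int[lam]_(x in `]-oo, w]) ((h x - Nh) * gp x).

Let Rint_lin (i : interval R) (a : R) :
  \int[lam]_(x in [set` i]) ((h x - a) * gp x) =
  \int[lam]_(x in [set` i]) (h x * gp x) - a * \int[lam]_(x in [set` i]) gp x.
Proof.
rewrite -RintegralZl//; last exact: (integrable_itv _ (@gp_integrable R)).
rewrite -RintegralB//; last 2 first.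
- exact: (integrable_itv _ hint).
- exact: (integrable_itv _ (c_int a)).
by apply: eq_Rintegral => x _ /=; ring.
Qed.

Let AB w : A w + B w = Nh - h w.
Proof.
rewrite /A /B !Rint_lin -gQE -/(gL w) /Nh (Rintegral_split w hint).
by have := gLQ w => E; rewrite -[in RHS](mulr1 (h w)) -E; ring.
Qed.

Let IE w : I w = A w * gQ w - B w * gL w.
Proof.
have E : I w = A w + (h w - Nh) * gL w.
  by rewrite /I /A !Rint_lin -/(gL w); ring.
have EL := gLQ w; have EAB := AB w.
rewrite E (_ : h w - Nh = - (A w + B w)); last by rewrite EAB opprB.
by rewrite (_ : gQ w = 1 - gL w)//; ring.
Qed.

Let A_le w : `|A w| <= galpha w.
Proof.
apply: (le_trans (le_normr_Rintegral _ _)) => //; first exact: (integrable_itv _ (u_int w)).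
rewrite -lee_fin -integral_galpha /Rintegral fineK; last first.
  apply: integrable_fin_num => //; apply: (integrable_itv _ (f := fun x => `|(h x - h w) * gp x|)).
  by have := integrable_abse (u_int w).
apply: ge0_le_integral => //.
- apply/measurable_EFinP; apply: measurable_funTS; apply: measurableT_comp => //.
  by apply: measurable_funM; [exact: measurable_funB|exact: gp_measurable].
- apply/measurable_EFinP; apply: measurable_funTS.
  by apply: measurable_funM; [exact: measurable_funB|exact: gp_measurable].
- move=> x; rewrite /= in_itv/= => xw; rewrite lee_fin normrM.
  rewrite [X in _ * X]ger0_norm ?gp_ge0// ler_wpM2r ?gp_ge0//.
  by rewrite (le_trans (hlip _ _))// distrC ger0_norm// subr_ge0.
Qed.

Let B_le w : `|B w| <= gbeta w.
Proof.
apply: (le_trans (le_normr_Rintegral _ _)) => //; first exact: (integrable_itv _ (u_int w)).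
rewrite -lee_fin -integral_gbeta /Rintegral fineK; last first.
  apply: integrable_fin_num => //; apply: (integrable_itv _ (f := fun x => `|(h x - h w) * gp x|)).
  by have := integrable_abse (u_int w).
apply: ge0_le_integral => //.
- apply/measurable_EFinP; apply: measurable_funTS; apply: measurableT_comp => //.
  by apply: measurable_funM; [exact: measurable_funB|exact: gp_measurable].
- apply/measurable_EFinP; apply: measurable_funTS.
  by apply: measurable_funM; [exact: measurable_funB|exact: gp_measurable].
- move=> x; rewrite /= in_itv/= andbT => xw; rewrite lee_fin normrM.
  rewrite [X in _ * X]ger0_norm ?gp_ge0// ler_wpM2r ?gp_ge0//.
  by rewrite (le_trans (hlip _ _))// ger0_norm// subr_ge0.
Qed.

Let I_der w : is_derive w 1 I ((h w - Nh) * gp w).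
Proof.
have cf : {for w, continuous (fun x => (h x - Nh) * gp x)}.
  apply: cvgM; last exact: gp_continuous.
  by apply: cvgB; [exact: h_continuous|exact: cvg_cst].
have [d1 d2] := @continuous_FTC1 R (fun x => (h x - Nh) * gp x) -oo%O w (w + 1)
   (ltr_pwDr ltr01 (lexx w)) (integrable_itv _ k_int) (ltNyr _) cf.
by apply: DeriveDef; [exact: d1|rewrite -derive1E; exact: d2].
Qed.

(** The classical solution of the Stein equation; [psi] is defined by the equation and then shown to
    be the derivative of [phi]. *)
Let phi w := I w * (gp w)^-1.
Let psi w := w * phi w + h w - Nh.

Let gp_neq0 w : gp w != 0. Proof. by rewrite gt_eqF ?gp_gt0. Qed.

Let phi_der w : is_derive w 1 phi (psi w).
Proof.
apply: (der_eq (derM (I_der w) (derV (gp_neq0 w) (gp_der w)))).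
by rewrite /psi /phi; field.
Qed.

Let psiE w : psi w = - (A w * gbeta w + B w * galpha w) / gp w.
Proof.
rewrite /psi /phi IE -addrA (_ : h w - Nh = - (A w + B w)); last by rewrite AB opprB.
by rewrite /galpha /gbeta; field.
Qed.

Let psi_le w : `|psi w| <= 2 * gp 0.
Proof.
rewrite psiE normrM normrN normfV [X in _ / X]ger0_norm ?gp_ge0//.
rewrite ler_pdivrMr ?gp_gt0//; apply: (le_trans (ler_normD _ _)).
rewrite !normrM (ger0_norm (gbeta_ge0 w)) (ger0_norm (galpha_ge0 w)).
have h1 : `|A w| * gbeta w <= galpha w * gbeta w by rewrite ler_wpM2r ?gbeta_ge0.
have h2 : `|B w| * galpha w <= gbeta w * galpha w by rewrite ler_wpM2r ?galpha_ge0.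
have := galpha_gbeta_le w; lra.
Qed.

Let V w := w * phi w.

(* |A| <= galpha and |B| <= gbeta make the bound on V' exactly 1, by
   gbeta_gamma_id. *)
Let V_lip x y : `|V x - V y| <= `|x - y|.
Proof.
have der w : is_derive w 1 V ((A w * ggamma w - B w * ggamma (- w)) / gp w).
  apply: (der_eq (derM (derI w) (phi_der w))).
  rewrite psiE /phi IE /galpha /gbeta /ggamma gpN gQN; field.
  exact: gp_neq0.
rewrite -[leRHS]mul1r; apply: (der_bounded_lipschitz der) => w.
rewrite normrM normfV [X in _ / X]ger0_norm ?gp_ge0//.
rewrite ler_pdivrMr ?gp_gt0// mul1r -gbeta_gamma_id.
apply: (le_trans (ler_normB _ _)); rewrite !normrM.
rewrite (ger0_norm (ggamma_ge0 w)) (ger0_norm (ggamma_ge0 (- w))).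
by apply: lerD; rewrite ler_wpM2r ?ggamma_ge0.
Qed.

(** [h] need not be differentiable, so [psi] is split as V + h - Nh, where [V] is differentiable and
    both [V] and [h] are 1-Lipschitz. *)
Let psi_lip x y : `|psi x - psi y| <= 2 * `|x - y|.
Proof.
rewrite (_ : psi x - psi y = (V x - V y) + (h x - h y)); last by rewrite /psi /V; ring.
by apply: (le_trans (ler_normD _ _)); rewrite mulr2n mulrDl mul1r lerD.
Qed.

Let taylor x y : `|phi y - phi x - psi x * (y - x)| <= (y - x) ^+ 2.
Proof.
(* Adding s (t - x)^2 with s = 1 or s = -1 makes the remainder monotone on either side of x, because
   [psi] is 2-Lipschitz. *)
have der (s t : R) : is_derive t 1 (fun t => phi t - psi x * (t - x) + s * ((t - x) * (t - x)))
    (psi t - psi x + s * (2 * (t - x))).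
  have dx := derB (derI t) (derC x t).
  apply: (der_eq (derD (derB (phi_der t) (derM (derC (psi x) t) dx))
    (derM (derC s t) (derM dx dx)))).
  by ring.
have lo t : x <= t -> `|psi t - psi x| <= 2 * (t - x).
  by move=> xt; rewrite (le_trans (psi_lip _ _))// ger0_norm// subr_ge0.
have hi t : t <= x -> `|psi t - psi x| <= 2 * (x - t).
  by move=> xt; rewrite (le_trans (psi_lip _ _))// distrC ger0_norm// subr_ge0.
rewrite ler_norml expr2; have [xy|/ltW yx] := leP x y; apply/andP; split.
- have c t : x <= t <= y -> 0 <= psi t - psi x + 1 * (2 * (t - x)).
    by move=> /andP[xt _]; have := lo _ xt; rewrite ler_norml => /andP[]; lra.
  by have := der_ge0_le xy (fun t _ => der (1) t) c; rewrite !subrr !mulr0 subr0 addr0; lra.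
- have c t : x <= t <= y -> psi t - psi x + -1 * (2 * (t - x)) <= 0.
    by move=> /andP[xt _]; have := lo _ xt; rewrite ler_norml => /andP[]; lra.
  by have := der_le0_ge xy (fun t _ => der (-1) t) c; rewrite !subrr !mulr0 subr0 addr0; lra.
- have c t : y <= t <= x -> psi t - psi x + 1 * (2 * (t - x)) <= 0.
    by move=> /andP[_ xt]; have := hi _ xt; rewrite ler_norml => /andP[]; lra.
  by have := der_le0_ge yx (fun t _ => der (1) t) c; rewrite !subrr !mulr0 subr0 addr0; lra.
- have c t : y <= t <= x -> 0 <= psi t - psi x + -1 * (2 * (t - x)).
    by move=> /andP[_ xt]; have := hi _ xt; rewrite ler_norml => /andP[]; lra.
  by have := der_ge0_le yx (fun t _ => der (-1) t) c; rewrite !subrr !mulr0 subr0 addr0; lra.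
Qed.

Lemma stein_solution_lipschitz : exists phi psi : R -> R,
  [/\ forall x y, `|phi x - phi y| <= 2 * gp 0 * `|x - y|,
      forall x y, `|psi x - psi y| <= 2 * `|x - y|,
      forall x, `|psi x| <= 2 * gp 0,
      forall x y, `|phi y - phi x - psi x * (y - x)| <= (y - x) ^+ 2 &
      forall x, psi x = x * phi x + h x - \int[lam]_x (h x * gp x)].
Proof.
exists phi, psi; split => //.
exact: (der_bounded_lipschitz phi_der psi_le).
Qed.

End stein_solution_lipschitz.

Lemma two_gp0 (R : realType) : (2 * gp 0 = Num.sqrt (2 / pi) :> R)%R.
Proof.
have p0 := @pi_gt0 R.
have pn0 : (pi != 0 :> R)%R by rewrite gt_eqF.
apply/eqP; rewrite -(@eqrXn2 _ 2)//; last 1 first.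
- by rewrite mulr_ge0// ltW// gp0_gt0.
rewrite gp0E exprMn exprVn !sqr_sqrtr; last 2 first.
- by rewrite divr_ge0// ltW.
- by rewrite mulr_ge0// ltW.
by apply/eqP; move: pi pn0 {p0} => x x0; field.
Qed.

(** * Half-line test functions *)

Section stein_solution_halfline.
Context (R : realType) (z : R).
Local Open Scope ring_scope.
Implicit Types (x y w : R).

Let gp_neq0 w : gp w != 0. Proof. by rewrite gt_eqF ?gp_gt0. Qed.

(** [W] is the Mills ratio of the normal law, [U] its reflection. *)
Let U x := gL x * (gp x)^-1.
Let W x := gQ x * (gp x)^-1.

Let U_der x : is_derive x 1 U (x * U x + 1).
Proof.
apply: (der_eq (derM (gL_der x) (derV (gp_neq0 x) (gp_der x)))).
by rewrite /U; field.
Qed.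

Let W_der x : is_derive x 1 W (x * W x - 1).
Proof.
apply: (der_eq (derM (gQ_der x) (derV (gp_neq0 x) (gp_der x)))).
by rewrite /W; field.
Qed.

Let xU_mono x y : x <= y -> x * U x <= y * U y.
Proof.
move=> xy.
have der (t : R) : is_derive t 1 (fun t => t * U t) (ggamma (- t) / gp t).
  apply: (der_eq (derM (derI t) (U_der t))).
  by rewrite /ggamma /U gpN gQN; field.
apply: (der_ge0_le xy (fun t _ => der t)) => t _.
by rewrite divr_ge0 ?ggamma_ge0 ?gp_ge0.
Qed.

Let xW_mono x y : x <= y -> x * W x <= y * W y.
Proof.
move=> xy.
have der (t : R) : is_derive t 1 (fun t => t * W t) (ggamma t / gp t).
  apply: (der_eq (derM (derI t) (W_der t))).
  by rewrite /ggamma /W; field.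
apply: (der_ge0_le xy (fun t _ => der t)) => t _.
by rewrite divr_ge0 ?ggamma_ge0 ?gp_ge0.
Qed.

Let xU_ge x : -1 <= x * U x.
Proof.
rewrite -subr_ge0 (_ : _ - _ = galpha x / gp x); last by rewrite /galpha /U; field.
by rewrite divr_ge0 ?galpha_ge0 ?gp_ge0.
Qed.

Let xW_le x : x * W x <= 1.
Proof.
rewrite -subr_ge0 (_ : _ - _ = gbeta x / gp x); last by rewrite /gbeta /W; field.
by rewrite divr_ge0 ?gbeta_ge0 ?gp_ge0.
Qed.

Let phi x := if x <= z then U x * gQ z else W x * gL z.
Let V x := x * phi x.
Let i x : R := if x <= z then 1 else 0.

Let UW : U z * gQ z = W z * gL z.
Proof. by rewrite /U /W; ring. Qed.

Let VU x : x <= z -> V x = x * U x * gQ z.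
Proof. by move=> xz; rewrite /V /phi xz mulrA. Qed.

Let VW x : z <= x -> V x = x * W x * gL z.
Proof.
rewrite le_eqVlt => /orP[/eqP <-|zx].
  by rewrite /V /phi lexx UW mulrA.
by rewrite /V /phi leNgt zx /= mulrA.
Qed.

(** Each piece is monotone because [ggamma] is nonnegative, and [UW] glues them at z. *)
Let V_mono x y : x <= y -> V x <= V y.
Proof.
have lo a b : a <= b -> b <= z -> V a <= V b.
  by move=> ab bz; rewrite !VU ?(le_trans ab)// ler_wpM2r ?gQ_ge0 ?xU_mono.
have hi a b : a <= b -> z <= a -> V a <= V b.
  by move=> ab za; rewrite !VW ?(le_trans za)// ler_wpM2r ?gL_ge0 ?xW_mono.
move=> xy; have [yz|/ltW zy] := leP y z; first exact: lo.
have [xz|/ltW zx] := leP x z; last exact: hi.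
by apply: (le_trans (lo _ _ xz (lexx z))); exact: hi.
Qed.

Let V_bounds x : - gQ z <= V x <= gL z.
Proof.
have V0 : - gQ z <= V z <= gL z.
  apply/andP; split.
    by rewrite VU// -mulN1r ler_wpM2r ?gQ_ge0.
  by rewrite VW// ler_piMl ?gL_ge0.
have /andP[V1 V2] := V0.
have [xz|/ltW zx] := leP x z; apply/andP; split.
- by rewrite VU// -mulN1r ler_wpM2r ?gQ_ge0.
- by apply: le_trans V2; exact: V_mono.
- by apply: (le_trans V1); exact: V_mono.
- by rewrite VW// ler_piMl ?gL_ge0.
Qed.

(** On this side of z the derivative of [phi] is V + gQ z, which is monotone, so a mean value lies
    between its values at the endpoints. *)
Let phi_lo a b : a <= b -> b <= z ->
  (V a + gQ z) * (b - a) <= phi b - phi a <= (V b + gQ z) * (b - a).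
Proof.
move=> ab bz; have az := le_trans ab bz.
have [c /andP[ac cb] E] := MVT_closed ab (fun t _ => derM (U_der t) (derC (gQ z) t)).
have -> : phi b - phi a = (V c + gQ z) * (b - a).
  rewrite /phi bz az E VU ?(le_trans cb)//; congr (_ * _); ring.
by apply/andP; split; rewrite ler_wpM2r ?subr_ge0// lerD2r V_mono.
Qed.

Let phi_hi a b : a <= b -> z <= a ->
  (V a - gL z) * (b - a) <= phi b - phi a <= (V b - gL z) * (b - a).
Proof.
move=> ab za; have zb := le_trans za ab.
have phiW t : z <= t -> phi t = W t * gL z.
  by rewrite le_eqVlt => /orP[/eqP <-|zt]; rewrite /phi ?lexx ?UW// leNgt zt.
have [c /andP[ac cb] E] := MVT_closed ab (fun t _ => derM (W_der t) (derC (gL z) t)).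
have -> : phi b - phi a = (V c - gL z) * (b - a).
  rewrite !phiW// E VW ?(le_trans za)//; congr (_ * _); ring.
by apply/andP; split; rewrite ler_wpM2r ?subr_ge0// lerD2r V_mono.
Qed.

(* zeta below is V plus the indicator of ]z, +oo[, up to a constant: it is
   nondecreasing, and the two sides of phi_inc differ by (b - a) times its
   increment. *)
Let phi_inc a b : a <= b ->
  (V a + i b - gL z) * (b - a) <= phi b - phi a <= (V b + i a - gL z) * (b - a).
Proof.
move=> ab; have EQ : gQ z = 1 - gL z by [].
have [bz|zb] := leP b z.
  have az := le_trans ab bz.
  have ia : i a = 1 by rewrite /i az.
  have ib : i b = 1 by rewrite /i bz.
  by rewrite ia ib -!addrA -EQ; apply: (phi_lo ab bz).
have [az|za] := leP a z; last first.
  have ia : i a = 0 by rewrite /i leNgt za.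
  have ib : i b = 0 by rewrite /i leNgt zb.
  by rewrite ia ib !addr0; apply: (phi_hi ab (ltW za)).
have ia : i a = 1 by rewrite /i az.
have ib : i b = 0 by rewrite /i leNgt zb.
rewrite ia ib addr0.
have zb' := ltW zb.
have /andP[l1 l2] := phi_lo az (lexx z).
have /andP[h1 h2] := phi_hi zb' (lexx z).
have g1 : (V a - gL z) * (z - a) <= (V a + gQ z) * (z - a).
  by rewrite ler_wpM2r ?subr_ge0// EQ; lra.
have g2 : (V a - gL z) * (b - z) <= (V z - gL z) * (b - z).
  by rewrite ler_wpM2r ?subr_ge0// lerD2r V_mono.
have g3 : (V z + gQ z) * (z - a) <= (V b + gQ z) * (z - a).
  by rewrite ler_wpM2r ?subr_ge0// lerD2r V_mono.
have g4 : (V b - gL z) * (b - z) <= (V b + gQ z) * (b - z).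
  by rewrite ler_wpM2r ?subr_ge0// EQ; lra.
rewrite -addrA -EQ.
have s1 : (V a - gL z) * (b - a) = (V a - gL z) * (z - a) + (V a - gL z) * (b - z) by ring.
have s2 : (V b + gQ z) * (b - a) = (V b + gQ z) * (z - a) + (V b + gQ z) * (b - z) by ring.
by apply/andP; split; rewrite ?s1 ?s2; lra.
Qed.

Let psi x := V x + i x - gL z.
(** The remainder bound involves increments of [zeta] alone; since [V] ranges in [- gQ z, gL z], the
    constant - gL z moves the values of [zeta] into [-1, 1]. *)
Let zeta x := V x + (1 - i x) - gL z.

Let i01 x : 0 <= i x <= 1.
Proof. by rewrite /i; case: ifP; rewrite lexx ler01. Qed.

(** The coefficients of b - a in [phi_inc] lie in [-1, 1]. *)
Let phi_lip x y : `|phi x - phi y| <= 1 * `|x - y|.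
Proof.
rewrite mul1r; wlog xy : x y / x <= y.
  by move=> H; have [/H//|/ltW/H] := leP x y; rewrite distrC [`|y - x|]distrC.
have /andP[h1 h2] := phi_inc xy.
have /andP[v1 v2] := V_bounds x; have /andP[v3 v4] := V_bounds y.
have /andP[i1 i2] := i01 x; have /andP[i3 i4] := i01 y.
have EQ : gQ z = 1 - gL z by [].
rewrite distrC [`|x - y|]distrC [leRHS]ger0_norm ?subr_ge0// ler_norml; apply/andP; split.
  by apply: le_trans h1; rewrite -mulN1r ler_wpM2r ?subr_ge0//; lra.
by apply: (le_trans h2); rewrite -[leRHS]mul1r ler_wpM2r ?subr_ge0//; lra.
Qed.

Lemma stein_solution_halfline : exists phi psi zeta : R -> R,
  [/\ forall x y, `|phi x - phi y| <= 1 * `|x - y|,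
      measurable_fun setT psi /\ (forall x, `|psi x| <= 1),
      measurable_fun setT zeta /\ (forall x, `|zeta x| <= 1),
      forall x y, `|phi y - phi x - psi x * (y - x)| <= (y - x) * (zeta y - zeta x) &
      forall x, psi x = x * phi x + (if x <= z then 1 else 0) - gL z].
Proof.
have mi : measurable_fun setT i.
  by apply: measurable_fun_ifT => //; exact: measurable_fun_ler.
have mV : measurable_fun setT V.
  by apply: measurable_funM => //; exact: (lipschitz_measurable phi_lip).
have EQ : gQ z = 1 - gL z by [].
exists phi, psi, zeta; split => //.
- split; first by apply: measurable_funB => //; exact: measurable_funD.
  move=> x; have /andP[v1 v2] := V_bounds x; rewrite /psi /i ler_norml.
  by case: ifP => _; apply/andP; split; lra.
- split; first by apply: measurable_funB => //; apply: measurable_funD => //; exact: measurable_funB.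
  move=> x; have /andP[v1 v2] := V_bounds x; rewrite /zeta /i ler_norml.
  by case: ifP => _; apply/andP; split; lra.
- move=> x y; rewrite ler_norml /psi /zeta; have [xy|/ltW yx] := leP x y.
    have /andP[h1 h2] := phi_inc xy; have yx0 : 0 <= y - x by rewrite subr_ge0.
    have Vm : 0 <= (y - x) * (V y - V x) by rewrite mulr_ge0// subr_ge0 V_mono.
    have im : 0 <= (y - x) * (i x - i y).
      rewrite mulr_ge0// subr_ge0 /i; case: ifP => [yz|_]; last by case: ifP.
      by rewrite (le_trans xy yz).
    by apply/andP; split; lra.
  have /andP[h1 h2] := phi_inc yx; have yx0 : 0 <= x - y by rewrite subr_ge0.
  have Vm : 0 <= (x - y) * (V x - V y) by rewrite mulr_ge0// subr_ge0 V_mono.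
  have im : 0 <= (x - y) * (i y - i x).
    rewrite mulr_ge0// subr_ge0 /i; case: ifP => [yz|_]; last by case: ifP.
    by rewrite (le_trans yx yz).
  by apply/andP; split; lra.
Qed.

End stein_solution_halfline.

(** * Normal expectations as Lebesgue integrals *)

Section normal_expectation.
Context (R : realType).
Notation lam := (@lebesgue_measure R).

(** The Radon-Nikodym density of [normal_prob] is a.e. equal to [gp], as both have the same
    integrals over measurable sets; change of variables concludes. *)
Lemma ge0_integral_normal_prob (f : R -> \bar R) : measurable_fun setT f ->
  (forall x, 0 <= f x) ->
  \int[normal_prob (0 : R) 1]_x f x = \int[lam]_x (f x * (gp x)%:E).
Proof.
move=> mf f0.
have dom : normal_prob (0 : R) 1 `<< lam by exact: normal_prob_dominates.
pose g := Radon_Nikodym_SigmaFinite.f (normal_prob (0 : R) 1) lam.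
have gi : lam.-integrable setT g by exact: Radon_Nikodym_SigmaFinite.f_integrable.
have mgp : measurable_fun setT (EFin \o (@gp R)) by apply/measurable_EFinP; exact: gp_measurable.
have ae : ae_eq lam setT g (EFin \o (@gp R)).
  apply: integral_ae_eq => // A _ mA.
  by rewrite -Radon_Nikodym_SigmaFinite.f_integral.
rewrite -(Radon_Nikodym_SigmaFinite.change_of_variables dom f0)//.
apply: ae_eq_integral => //.
- by apply: emeasurable_funM => //; exact: measurable_int gi.
- exact: emeasurable_funM.
- by apply: filterS ae => x H xT; congr (_ * _); exact: H.
Qed.

Context d (S : measurableType d) (Q : probability S R) (Z : {RV Q >-> R}).
Hypothesis hZ : has_law Z (normal_prob (0 : R) 1).

Lemma expectation_normal (h : R -> R) : measurable_fun setT h ->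
  'E_Q[h \o Z] = \int[lam]_x (h x * gp x)%:E.
Proof.
move=> mh.
have key (k : R -> \bar R) : measurable_fun setT k -> (forall x, 0 <= k x) ->
    \int[Q]_w k (Z w) = \int[lam]_x (k x * (gp x)%:E).
  move=> mk k0; rewrite -(ge0_integral_normal_prob mk k0).
  pose Zt : S -> measurableTypeR R := Z.
  have mZ : measurable_fun setT Zt by exact: (measurable_funPT Z).
  transitivity (\int[pushforward Q Zt]_x k x).
    by rewrite (ge0_integral_pushforward mZ) ?preimage_setT.
  by apply: eq_measure_integral => A mA _; exact: hZ.
have pos0 (k : R -> R) : measurable_fun setT k ->
    \int[Q]_w (Num.max (k (Z w)) 0%R)%:E = \int[lam]_x (Num.max (k x * gp x) 0)%R%:E.
  move=> mk; rewrite (key (fun x => (Num.max (k x) 0%R)%:E)); last 2 first.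
  - by apply/measurable_EFinP; exact: measurable_maxr.
  - by move=> x; rewrite lee_fin le_max lexx orbT.
  by apply: eq_integral => x _; rewrite -EFinM maxr_pMl ?gp_ge0// mul0r.
rewrite expectationE [LHS]integralE [RHS]integralE; congr (_ - _).
  transitivity (\int[Q]_w (Num.max (h (Z w)) 0%R)%:E).
    by apply: eq_integral => w _; rewrite funeposE -EFin_max.
  by rewrite pos0//; apply: eq_integral => x _; rewrite funeposE -EFin_max.
transitivity (\int[Q]_w (Num.max (- h (Z w))%R 0%R)%:E).
  by apply: eq_integral => w _; rewrite funenegE -EFinN -EFin_max.
rewrite (pos0 (fun x => - h x)%R); last exact: measurableT_comp.
by apply: eq_integral => x _; rewrite funenegE -EFinN -EFin_max mulNr.
Qed.

Lemma normal_le (z : R) : Q [set w | Z w <= z]%R = (gL z)%:E.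
Proof.
have -> : [set w | Z w <= z]%R = Z @^-1` `]-oo, z] by apply/seteqP; split => w /=; rewrite in_itv.
have mz : @measurable _ R `]-oo, z] by exact: measurable_itv.
rewrite -[LHS]/(distribution Q Z _) (hZ mz).
rewrite /gL /Rintegral fineK; first by [].
apply: integrable_fin_num; first exact: measurable_itv.
exact: (integrable_itv (f := @gp R) `]-oo, z] (@gp_integrable R)).
Qed.
End normal_expectation.

(** * Distances to the normal law *)

Section normal_distances.
Context (dE : nat -> measure_display) (E : forall n, measurableType (dE n)).
Context (R : realType) (mu_ : forall n, probability (E n) R)
  (mu : probability (prodE E) R).
Hypothesis hmu : is_product_measure mu_ mu.
Context d (T : measurableType d) (P : probability T R) (X X' : {RV P >-> prodE E}).
Hypotheses (hX : has_law X mu) (hX' : has_law X' mu) (hXX' : independent_RV X X').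
Context d' (S : measurableType d') (Q : probability S R) (Z : {RV Q >-> R}).
Hypothesis hZ : has_law Z (normal_prob (0 : R) 1).
Variables (F : {RV P >-> R}) (f g : prodE E -> R) (uf ug : nat -> T -> R).
Hypotheses (mf : measurable_fun setT f) (mg : measurable_fun setT g).
Hypotheses (Df : D_graph X (f \o X) uf) (Dg : D_graph X (g \o X) ug).
Hypotheses (Ff : {ae P, forall w, F w = f (X w)}) (dg : delta_graph X ug (\- F)%R).
Local Open Scope ring_scope.

Let LfX : L2X X (f \o X). Proof. by case: Df. Qed.
Let Lf : f \o X \in Lfun P 2%:E. Proof. by case: LfX. Qed.
Let Lg : g \o X \in Lfun P 2%:E. Proof. by case: Dg => -[]. Qed.
Let mfX : measurable_fun setT (f \o X). Proof. exact: L2X_measurable LfX. Qed.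

Let stein_bound_F (phi psi : R -> R) (C c0 : R) :
  (forall x y, `|phi x - phi y| <= C * `|x - y|) ->
  measurable_fun setT psi -> (forall x, `|psi x| <= c0) ->
  (`|Ex P (fun w => psi (f (X w))) - Ex P (fun w => f (X w) * phi (f (X w)))|%:E <=
  c0%:E * 'E_P[fun w => `|1 - Gamma0 X X' f (\- g) w|%R] +
  2^-1%:E * \sum_(0 <= k <oo) 'E_P[fun w =>
    (`|phi (f (resample X X' k w)) - phi (f (X w)) - psi (f (X w)) * Delta X X' k f w|
     * `|Delta X X' k g w|)%R])%E.
Proof.
move=> phiC mpsi psiC.
have mphi := lipschitz_measurable phiC.
have mphif : measurable_fun setT (phi \o (f \o X)) by exact: measurableT_comp.
have := stein_bound hmu hX hX' hXX' mf mg Df Dg dg phiC mpsi psiC.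
suff -> : Ex P (fun w => phi (f (X w)) * F w) = Ex P (fun w => f (X w) * phi (f (X w))) by [].
congr fine; apply: Ex_ae; [exact: measurable_funM|exact: measurable_funM|].
by apply: filterS Ff => w ->; rewrite mulrC.
Qed.

Let L2_lipschitz (phi : R -> R) (C : R) : (forall x y, `|phi x - phi y| <= C * `|x - y|) ->
  phi \o (f \o X) \in Lfun P 2%:E.
Proof.
by move=> phiC; have [] := L2X_lipschitz (lipschitz_measurable phiC) phiC LfX.
Qed.

Let mfR k : measurable_fun setT (f \o resample X X' k).
Proof. by apply: measurableT_comp => //; exact: measurable_resample. Qed.

Let mDf k : measurable_fun setT (Delta X X' k f). Proof. exact: measurable_Delta. Qed.

Let mDg k : measurable_fun setT (fun w => `|Delta X X' k g w|).
Proof. by apply: measurableT_comp => //; exact: measurable_Delta. Qed.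

Let measurable_remainder (phi psi : R -> R) k :
  measurable_fun setT phi -> measurable_fun setT psi ->
  measurable_fun setT (fun w =>
    `|phi (f (resample X X' k w)) - phi (f (X w)) - psi (f (X w)) * Delta X X' k f w|
     * `|Delta X X' k g w|).
Proof.
move=> mphi mpsi; apply: measurable_funM => //; apply: measurableT_comp => //.
apply: measurable_funB.
  by apply: measurable_funB; [exact: (measurableT_comp mphi (mfR k))|exact: (measurableT_comp mphi mfX)].
by apply: measurable_funM => //; exact: (measurableT_comp mpsi mfX).
Qed.

Lemma dW_normal_le : (dW F Z <=
    (Num.sqrt (2 / pi))%:E * 'E_P[fun w => `|1 - Gamma0 X X' f (\- g) w|%R]
    + (2^-1)%:E * \sum_(0 <= k <oo)
          'E_P[fun w => (`|Delta X X' k g w| * Delta X X' k f w ^+ 2)%R])%E.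
Proof.
apply: ge_ereal_sup => _ [h /= hlip <-].
have hl x y : `|h x - h y| <= `|x - y|.
  by have /= := hlip (x, y) (conj I I); rewrite mul1r.
have hl1 x y : `|h x - h y| <= 1 * `|x - y| by rewrite mul1r.
have mh := lipschitz_measurable hl1.
have [phi [psi [phiC psiC psib rem eq]]] := stein_solution_lipschitz hl.
have mpsi := lipschitz_measurable psiC.
have L := stein_bound_F phiC mpsi psib; rewrite two_gp0 in L.
set c := \int[_]_x _ in eq.
have Lh : h \o (f \o X) \in Lfun P 1 by apply/L2_L1; exact: (L2_lipschitz hl1).
have Lphi : (fun w => f (X w) * phi (f (X w))) \in Lfun P 1.
  by apply: (L2M Lf); exact: (L2_lipschitz phiC).
have -> : 'E_P[h \o F] = 'E_P[h \o (f \o X)].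
  apply: Ex_ae; [exact: measurableT_comp|exact: measurableT_comp|].
  by apply: filterS Ff => w /= ->.
have -> : 'E_Q[h \o Z] = c%:E.
  rewrite (expectation_normal hZ mh) /c /Rintegral fineK//.
  apply: integrable_fin_num; first exact: measurableT.
  exact: (lipschitz_gp_integrable hl).
rewrite ExE// -EFinB abse_EFin.
(* The Stein equation at f(X), integrated. *)
have -> : Ex P (h \o (f \o X)) - c =
    Ex P (fun w => psi (f (X w))) - Ex P (fun w => f (X w) * phi (f (X w))).
  rewrite (_ : (fun w => psi _) = ((fun w => f (X w) * phi (f (X w))) \+ (h \o (f \o X))) \- cst c).
    rewrite ExB ?ExD ?Ex_cst//; [ring|exact: L1_D|exact: Lfun_cst].
  by apply/funext => w; rewrite eq.
apply: (le_trans L); apply: leeD => //; apply: lee_wpmul2l; first by rewrite lee_fin.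
apply: lee_nneseries => [k _ _|k _].
  by apply: expectation_ge0 => w; rewrite mulr_ge0.
rewrite !expectationE; apply: ge0_le_integral => //.
- by apply/measurable_EFinP; apply: measurable_remainder => //; exact: lipschitz_measurable phiC.
- by apply/measurable_EFinP; apply: measurable_funM => //; exact: measurable_funX.
- by move=> w _; rewrite lee_fin [leLHS]mulrC ler_wpM2l//; exact: rem.
Qed.

Let V k w := `|Delta X X' k g w| * Delta X X' k f w.

Let LV k : V k \in Lfun P 1.
Proof.
apply: L2M; last exact: (L2_Delta hmu hX hX' hXX' k mf Lf).
have LD := L2_Delta hmu hX hX' hXX' k mg Lg.
apply: (L2_le (k := 1) _ _ LD) => [|w]; last by rewrite normr_id mul1r.
by apply: measurableT_comp => //; exact: L1_measurable LD.
Qed.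

Let Voo : (\sum_(0 <= k <oo) 'E_P[fun w => `|V k w|%R] < +oo)%E.
Proof.
rewrite (eq_eseriesr (g := fun k => 'E_P[fun w => `|Delta X X' k f w * Delta X X' k g w|%R])).
  exact: (Delta_mul_sum hmu hX hX' hXX' mf mg Df Dg).
by move=> k _; congr ('E_P[_]); apply/funext => w; rewrite /V !normrM normr_id mulrC.
Qed.

(* Exchanging X with its resampled copy turns V k into - V k. *)
Lemma exchange_sum (zeta : R -> R) : measurable_fun setT zeta ->
  (forall x, `|zeta x| <= 1) ->
  (\sum_(0 <= k <oo) 'E_P[fun w =>
     (V k w * (zeta (f (resample X X' k w)) - zeta (f (X w))))%R])%E =
  (- (2 * Ex P (fun w => zeta (f (X w)) * limn (series (V ^~ w)))))%:E.
Proof.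
move=> mz z1.
have mzX : measurable_fun setT (fun w => zeta (f (X w))).
  by apply: measurableT_comp => //.
have mzR k : measurable_fun setT (fun w => zeta (f (resample X X' k w))).
  by do 2 (apply: measurableT_comp => //); exact: measurable_resample.
have LzX k : (fun w => zeta (f (X w)) * V k w) \in Lfun P 1.
  by apply: (L1_boundedM mzX _ (LV k)) => w; exact: z1.
have LzR k : (fun w => zeta (f (resample X X' k w)) * V k w) \in Lfun P 1.
  by apply: (L1_boundedM (mzR k) _ (LV k)) => w; exact: z1.
have cS := Ex_mul_series mzX (fun w => z1 _) LV Voo.
have exch k : Ex P (fun w => zeta (f (resample X X' k w)) * V k w) =
    - Ex P (fun w => zeta (f (X w)) * V k w).
  rewrite -mulN1r -ExZ//.
  pose q (x : prodE E * prodE E) := zeta (f x.2) * (`|g x.2 - g x.1| * (f x.2 - f x.1)).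
  have mq : measurable_fun setT q.
    have mDf2 : measurable_fun setT (fun x : prodE E * prodE E => f x.2 - f x.1).
      by apply: measurable_funB; apply: measurableT_comp.
    have mDg2 : measurable_fun setT (fun x : prodE E * prodE E => `|g x.2 - g x.1|).
      by apply: measurableT_comp => //; apply: measurable_funB; apply: measurableT_comp.
    apply: measurable_funM; last exact: measurable_funM.
    by apply: (measurableT_comp mz); exact: measurableT_comp.
  have := expectation_exchange hmu hX hX' hXX' k mq; rewrite /q /= => H.
  rewrite /Ex /V /Delta [X in fine X = _]H; congr (fine 'E_P[ _ ]).
  by apply/funext => w; rewrite distrC; ring.
have term k : 'E_P[fun w => V k w * (zeta (f (resample X X' k w)) - zeta (f (X w)))] =
    (- 2 * Ex P (fun w => zeta (f (X w)) * V k w))%:E.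
  rewrite (_ : (fun w => _) = (fun w => zeta (f (resample X X' k w)) * V k w) \-
      (fun w => zeta (f (X w)) * V k w)); last by apply/funext => w /=; ring.
  rewrite ExE ?L1_B// ExB// exch; congr (_%:E); ring.
under eq_eseriesr do rewrite term.
(* The terms may have either sign here, so the series is evaluated as a limit of real partial
   sums. *)
apply/cvg_lim => //.
rewrite (_ : (fun n => _) = EFin \o
    (fun n => - 2 * series (fun k => Ex P (fun w => zeta (f (X w)) * V k w)) n)).
  rewrite -mulNr; apply: cvg_EFin; first exact: nearW.
  exact: cvgMr.
by apply/funext => n /=; rewrite sumEFin /series /= mulr_sumr.
Qed.

Lemma dK_normal_le : (dK F Z <=
    'E_P[fun w => `|1 - Gamma0 X X' f (\- g) w|%R]
    + 'E_P[fun w =>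
        `|cond_exp P (g_sigma_algebra_preimage F)
            (fun w' => limn (series (fun k =>
               `|Delta X X' k g w'| * Delta X X' k f w'))) w|%R])%E.
Proof.
apply: ge_ereal_sup => _ [z _ <-].
have [phi [psi [zeta [phiC [mpsi psi1] [mz z1] rem eq]]]] := stein_solution_halfline z.
have L := stein_bound_F phiC mpsi psi1; rewrite mul1e in L.
have [LW _ _] := expectation_series LV Voo.
set W := fun w => _ in LW.
have mF : measurable_fun setT F by [].
have subF := preimage_sub_measurable mF.
have HH := cond_expP subF LW.
set H := cond_exp _ _ _ in HH *.
have LH := cond_exp_L1 HH.
have mzF : measurable_fun setT (zeta \o F) by exact: measurableT_comp.
have mphif : measurable_fun setT (phi \o (f \o X)).
  exact: measurableT_comp (lipschitz_measurable phiC) mfX.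
have Lphi : (fun w => f (X w) * phi (f (X w))) \in Lfun P 1.
  by apply: (L2M Lf); exact: (L2_lipschitz phiC).
pose ind (x : R) : R := if x <= z then 1 else 0.
have mind : measurable_fun setT ind.
  by apply: measurable_fun_ifT => //; exact: measurable_fun_ler.
have ind1 x : `|ind x| <= 1 by rewrite /ind; case: ifP; rewrite ?normr1 ?normr0.
have Lind : (fun w => ind (f (X w))) \in Lfun P 1.
  by apply: L1_bounded => [|w]; [exact: (measurableT_comp mind mfX)|exact: ind1].
have -> : P [set w | F w <= z] = (Ex P (fun w => ind (f (X w))))%:E.
  have mA : measurable [set w | F w <= z].
    rewrite (_ : [set w | F w <= z] = F @^-1` `]-oo, z]).
      by apply: (measurable_preimage mF); exact: measurable_itv.
    by apply/seteqP; split => w /=; rewrite in_itv.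
  rewrite -ExE// -(expectation_indic P mA); apply: Ex_ae => //.
    exact: (measurableT_comp mind mfX).
  apply: filterS Ff => w <-; rewrite indicE /ind.
  by case: ifP => Fz; [rewrite mem_set|rewrite memNset//= Fz].
rewrite (normal_le hZ) -EFinB abse_EFin.
have -> : Ex P (fun w => ind (f (X w))) - gL z =
    Ex P (fun w => psi (f (X w))) - Ex P (fun w => f (X w) * phi (f (X w))).
  rewrite (_ : (fun w => psi _) = ((fun w => f (X w) * phi (f (X w))) \+
      (fun w => ind (f (X w)))) \- cst (gL z)).
    rewrite ExB ?ExD ?Ex_cst//; [ring|exact: L1_D|exact: Lfun_cst].
  by apply/funext => w; rewrite eq.
apply: (le_trans L); apply: leeD => //.
(* The factor 2 matches the one in [exchange_sum], the 1/2 the one in [stein_bound_F]. *)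
have -> : 'E_P[fun w => `|H w|%R] = (2^-1%:E * (2 * Ex P (fun w => `|H w|))%:E)%E.
  by rewrite ExE ?L1_norm// -EFinM mulKf.
apply: lee_wpmul2l; first by rewrite lee_fin.
(* [rem] bounds the remainder by Delta_k f times the increment of [zeta]; the weight |Delta_k g|
   completes [V k]. *)
apply: (@le_trans _ _ (\sum_(0 <= k <oo) 'E_P[fun w =>
     (V k w * (zeta (f (resample X X' k w)) - zeta (f (X w))))%R])%E).
  apply: lee_nneseries => [k _ _|k _].
    by apply: expectation_ge0 => w; rewrite mulr_ge0.
  rewrite !expectationE; apply: ge0_le_integral => //.
  - apply/measurable_EFinP; apply: measurable_remainder => //.
    exact: lipschitz_measurable phiC.
  - apply/measurable_EFinP; apply: measurable_funM; first exact: L1_measurable (LV k).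
    apply: measurable_funB; [exact: (measurableT_comp mz (mfR k))|exact: (measurableT_comp mz mfX)].
  - by move=> w _; rewrite lee_fin [leLHS]mulrC /V -mulrA ler_wpM2l//; exact: rem.
rewrite exchange_sum// lee_fin -mulrN ler_pM2l//.
(* zeta(F) is bounded and sigma(F)-measurable, so the series may be replaced by its conditional
   expectation given F. *)
have -> : Ex P (fun w => zeta (f (X w)) * limn (series (V ^~ w))) =
    Ex P (fun w => zeta (F w) * H w).
  rewrite -(cond_exp_pullout_bounded subF LW HH (measurable_wrt_preimage mz) (fun w => z1 _)).
  congr fine; apply: Ex_ae.
  - by apply: measurable_funM; [exact: (measurableT_comp mz mfX)|exact: L1_measurable LW].
  - by apply: measurable_funM => //; exact: L1_measurable LW.
  - by apply: filterS Ff => w /= ->.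
have LzH := L1_boundedM mzF (fun w => z1 (F w)) LH.
rewrite (le_trans (ler_norm _))// normrN (le_trans (Ex_norm LzH))//.
apply: Ex_le; [exact: L1_norm|exact: L1_norm|move=> w].
by rewrite normrM ler_piMl//; exact: z1.
Qed.

End normal_distances.

Theorem theorem3p9 (R : realType)
  (dE : nat -> measure_display) (E : forall n, measurableType (dE n))
  (mu_ : forall n, probability (E n) R)
  (mu : probability (prodE E) R) (hmu : is_product_measure mu_ mu)
  (d : measure_display) (T : measurableType d) (P : probability T R)
  (X X' : {RV P >-> prodE E})
  (hX : has_law X mu) (hX' : has_law X' mu) (hXX' : independent_RV X X')
  (d' : measure_display) (S : measurableType d') (Q : probability S R)
  (Z : {RV Q >-> R}) (hZ : has_law Z (normal_prob (0 : R) 1))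
  (F : {RV P >-> R}) (hF : dom_D X F) (hF0 : 'E_P[F] = 0)
  (LinvF : {RV P >-> R}) (hLinvF : is_Linv X F LinvF)
  (f g : prodE E -> R)
  (hf : is_representative X mu f F) (hg : is_representative X mu g LinvF) :
  dW F Z <=
    (Num.sqrt (2 / pi))%:E
      * 'E_P[fun w => `|1 - Gamma0 X X' f (\- g) w|]%R
    + (2^-1)%:E
      * \sum_(0 <= k <oo)
          'E_P[fun w => `|Delta X X' k g w| * Delta X X' k f w ^+ 2]%R
  /\
  dK F Z <=
    'E_P[fun w => `|1 - Gamma0 X X' f (\- g) w|]%R
    + 'E_P[fun w =>
        `|cond_exp P (g_sigma_algebra_preimage F)
            (fun w' => limn (series (fun k =>
               `|Delta X X' k g w'| * Delta X X' k f w'))) w|]%R.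
Proof.
have [f2 Ff] := hf; have [g2 Gg] := hg.
have mf := L1_measurable f2; have mg := L1_measurable g2.
have [uf DF] := hF; have [[ug [DG dG]] _] := hLinvF.
have mwX (k : prodE E -> R) : measurable_fun setT k -> measurable_wrt (sigmaX X) (k \o X).
  exact: (measurable_wrt_preimage (Y := X)).
(* F and L^{-1}F are replaced by f(X) and g(X) in the graph of D, while [dG] still refers to F
   itself. *)
have Df := D_graph_ae DF (mwX _ mf) Ff; have Dg := D_graph_ae DG (mwX _ mg) Gg.
split.
- exact: (dW_normal_le hmu hX hX' hXX' hZ mf mg Df Dg Ff dG).
- exact: (dK_normal_le hmu hX hX' hXX' hZ mf mg Df Dg Ff dG).
Qed.
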